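(* Let $0<\alpha<2n$, $1<p_1,p_2<\infty$, and $\frac1q=\frac1{p_1}+\frac1{p_2}-\frac{\alpha}{n}$ with $0<q<\infty$. Let $\mathcal{D}$ be a dyadic grid on $\mathbb{R}^n$ and suppose that $b\in L^1_{\mathrm{loc}}(\mathbb{R}^n)$. Then, for $j=1,2$, $$ \big\|[b,\mathcal{I}_\alpha^{\mathcal{D}}]_j\big\|_{L^{p_1}(\mathbb{R}^n)\times L^{p_2}(\mathbb{R}^n)\to L^q(\mathbb{R}^n)}\simeq\|b\|_{BMO_{\mathcal{D}}}, $$ that is, each side is bounded by a constant multiple of the other, with constants independent of $b$.
   Context: For a dyadic grid $\mathcal{D}$ on $\mathbb{R}^n$ and $0<\alpha<2n$, the dyadic bilinear fractional integral operator is $$\mathcal{I}_\alpha^{\mathcal{D}}(f_1,f_2)(x)=\sum_{Q\in\mathcal{D}}|Q|^{\frac{\alpha}{n}}\langle f_1\rangle_Q\langle f_2\rangle_Q\,\mathbf{1}_Q(x),\qquad x\in\mathbb{R}^n,$$ where $\langle f\rangle_Q=\frac1{|Q|}\int_Q f$. For a bilinear operator $T$ and a function $b$, the bilinear commutators are $$[b,T]_1(f_1,f_2)=b\,T(f_1,f_2)-T(bf_1,f_2),\qquad [b,T]_2(f_1,f_2)=b\,T(f_1,f_2)-T(f_1,bf_2).$$ The dyadic BMO norm is $$\|b\|_{BMO_{\mathcal{D}}}=\sup_{Q\in\mathcal{D}}\frac1{|Q|}\int_Q|b(x)-\langle b\rangle_Q|\,dx .$$ Both sides of the equivalence are allowed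 to be $+\infty$. *)

(* Defs.v *)
From HB Require Import structures.
From mathcomp Require Import all_boot all_order all_algebra.
From mathcomp Require Import all_classical all_reals all_analysis.
Import Order.TTheory GRing.Theory Num.Theory.
Import numFieldNormedType.Exports.

Set Implicit Arguments.
Unset Strict Implicit.
Unset Printing Implicit Defensive.

Local Open Scope classical_set_scope.
Local Open Scope ring_scope.

(* The n-fold product of a sigma-finite measure, on tuples with the product
   sigma-algebra: a Dirac mass on the empty tuple, then the image of
   mu \x mu^n under (x, t) |-> x :: t. *)
Section tuple_product_measure.
Context d (T : measurableType d) (R : realType).
Variable mu : {sigma_finite_measure set T -> \bar R}.
Local Open Scope ereal_scope.

Definition tuple_cons n (x : T * n.-tuple T) : n.+1.-tuple T :=
  [the n.+1.-tuple T of x.1 :: x.2].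

Lemma measurable_tuple_cons n : measurable_fun setT (@tuple_cons n).
Proof.
by apply: measurable_cons; [exact: measurable_fst|exact: measurable_snd].
Qed.

Section step.
Variables (n : nat) (nu : {sigma_finite_measure set (n.-tuple T) -> \bar R}).

Definition tuple_measure_step : set (n.+1.-tuple T) -> \bar R :=
  pushforward (mu \x nu) (@tuple_cons n).

Let step0 : tuple_measure_step set0 = 0.
Proof. by rewrite /tuple_measure_step /pushforward preimage_set0 measure0. Qed.

Let step_ge0 A : 0 <= tuple_measure_step A.
Proof. exact: (measure_ge0 (mu \x nu)). Qed.

Let step_sigma_additive : semi_sigma_additive tuple_measure_step.
Proof.
move=> F mF tF mUF; rewrite /tuple_measure_step /pushforward preimage_bigcup.
have mc := @measurable_tuple_cons n.
apply: (@measure_semi_sigma_additive _ _ _ (mu \x nu)).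
- by move=> k; rewrite -[X in measurable X]setTI; exact: mc.
- apply/trivIsetP => /= i j _ _ ij; rewrite -preimage_setI.
  by move/trivIsetP : tF => /(_ _ _ _ _ ij) ->//; rewrite preimage_set0.
- by rewrite -preimage_bigcup -[X in measurable X]setTI; exact: mc.
Qed.

HB.instance Definition _ := isMeasure.Build _ _ _ tuple_measure_step
  step0 step_ge0 step_sigma_additive.

Let step_sigma_finite : sigma_finite setT tuple_measure_step.
Proof.
have /sigma_finiteP[A [TA ndA Aoo]] := sigma_finiteT mu.
have /sigma_finiteP[B [TB ndB Boo]] := sigma_finiteT nu.
pose un (t : n.+1.-tuple T) : T * n.-tuple T :=
  (tnth t ord0, [tuple of behead t]).
have consK : cancel (@tuple_cons n) un.
  by move=> [x t]; rewrite /un /tuple_cons /=; congr pair; exact: val_inj.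
have mun : measurable_fun setT un.
  by apply: measurable_fun_pair;
    [exact: measurable_tnth|exact: measurable_behead].
exists (fun k => un @^-1` (A k `*` B k)).
  apply/esym/seteqP; split => // t _.
  have [i _ Ai] : (\bigcup_i A i) (un t).1 by rewrite -TA.
  have [j _ Bj] : (\bigcup_j B j) (un t).2 by rewrite -TB.
  exists (maxn i j) => //; split.
  - by move: Ai; exact/subsetPset/ndA/leq_maxl.
  - by move: Bj; exact/subsetPset/ndB/leq_maxr.
move=> k; have [mA Akoo] := Aoo k; have [mB Bkoo] := Boo k; split.
  by rewrite -[X in measurable X]setTI; apply: mun => //; exact: measurableX.
rewrite /tuple_measure_step /pushforward -comp_preimage.
rewrite (_ : un \o @tuple_cons n = id); last exact/funext.
by rewrite preimage_id product_measure1E// lte_mul_pinfty// ge0_fin_numE.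
Qed.

HB.instance Definition _ := Measure_isSigmaFinite.Build _ _ _
  tuple_measure_step step_sigma_finite.

End step.

Fixpoint tuple_measure n : {sigma_finite_measure set (n.-tuple T) -> \bar R} :=
  match n with
  | 0 => [the {sigma_finite_measure set (0.-tuple T) -> \bar R} of
            @dirac _ (0.-tuple T) [tuple] R]
  | m.+1 => [the {sigma_finite_measure set (m.+1.-tuple T) -> \bar R} of
               tuple_measure_step (tuple_measure m)]
  end.

Lemma tuple_measure_box n (A : 'I_n -> set T) : (forall i, measurable (A i)) ->
  tuple_measure n [set t | forall i, A i (tnth t i)] = \prod_(i < n) mu (A i).
Proof.
elim: n A => [|n IHn] A mA.
  rewrite big_ord0 /= diracE mem_set//.
  by case.
rewrite big_ord_recl -IHn// -product_measure1E//; last first.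
  rewrite (_ : mkset _ = \bigcap_(i in [set: 'I_n])
      ((@tnth _ T ^~ i) @^-1` A (lift ord0 i))).
    apply: fin_bigcap_measurable => // i _.
    by rewrite -[X in measurable X]setTI; exact: measurable_tnth.
  by apply/seteqP; split => [t At i _|t At i]; exact: At.
rewrite /= /tuple_measure_step /pushforward; congr (_ _).
apply/seteqP; split => [[x t]/= At|[x t]/= [Ax At] i].
  split; first by have := At ord0.
  by move=> i; have := At (lift ord0 i); rewrite tnthS.
case: (unliftP ord0 i) => [j ->|-> //].
by rewrite tnthS; exact: At.
Qed.

End tuple_product_measure.

Notation Rn R n := (n.-tuple (measurableTypeR R)).

Definition lebesgue_Rn (R : realType) (n : nat) :
    {sigma_finite_measure set (Rn R n) -> \bar R} :=
  tuple_measure [the {sigma_finite_measure set (measurableTypeR R) -> \bar R} of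
                   @lebesgue_measure R] n.

Section euclidean.
Context (R : realType) (n : nat).
Local Notation V := (Rn R n).
Local Notation mu := (lebesgue_Rn R n).
Implicit Types (Q : set V) (D : set (set V)).
Local Open Scope ereal_scope.

(* Tuples carry no topology: compactness is that of the image in 'rV[R]_n. *)
Definition rV_of_tuple (x : V) : 'rV[R]_n := (\row_i tnth x i)%R.

Definition locally_integrable_Rn (b : V -> R) : Prop :=
  measurable_fun setT b /\
  forall K : set V, compact (rV_of_tuple @` K) ->
    \int[mu]_(x in K) `|b x|%:E < +oo.

Definition cube (a : V) (l : R) : set V :=
  [set x : V | forall i, tnth a i <= tnth x i < tnth a i + l]%R.

Definition cubes_of_side (l : R) : set (set V) := [set cube a l | a in setT].

Definition dyadic_grid D : Prop :=
  [/\ forall Q, D Q -> exists k : int, cubes_of_side (2 ^ k)%R Q,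
      forall P Q, D P -> D Q ->
        [\/ P `&` Q = set0, P `&` Q = P | P `&` Q = Q] &
      forall k : int, partition (D `&` cubes_of_side (2 ^ k)%R) id setT].

Definition average (f : V -> \bar R) Q : \bar R :=
  (fine (mu Q))^-1%:E * \int[mu]_(x in Q) f x.

Definition BMO_norm D (b : V -> R) : \bar R :=
  ereal_sup
    [set average (fun x => `|(b x)%:E - average (EFin \o b) Q|) Q | Q in D].

(* An unordered sum over the grid, as a difference of sums of nonnegative
   terms. Averages and sums take values in \bar R, so that wherever the
   defining integrals or series fail to converge absolutely the result is not
   hidden behind a finite default value. *)
Definition dyadic_fractional_integral (alpha : R) D (f1 f2 : V -> R) (x : V) :
    \bar R :=
  let a Q := (fine (mu Q) `^ (alpha / n%:R))%:E *
             average (EFin \o f1) Q * average (EFin \o f2) Q * (\1_Q x)%:E in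
  \esum_(Q in D) a^\+ Q - \esum_(Q in D) a^\- Q.

Definition commutator1 (b : V -> R) (T : (V -> R) -> (V -> R) -> V -> \bar R)
    (f1 f2 : V -> R) (x : V) : \bar R :=
  (b x)%:E * T f1 f2 x - T (b \* f1)%R f2 x.

Definition commutator2 (b : V -> R) (T : (V -> R) -> (V -> R) -> V -> \bar R)
    (f1 f2 : V -> R) (x : V) : \bar R :=
  (b x)%:E * T f1 f2 x - T f1 (b \* f2)%R x.

Definition bilinear_opnorm (p1 p2 q : R)
    (T : (V -> R) -> (V -> R) -> V -> \bar R) : \bar R :=
  ereal_sup [set 'N[mu]_q%:E[T f.1 f.2] | f in
    [set f : (V -> R) * (V -> R) |
      [/\ f.1 \in Lfun mu p1%:E, f.2 \in Lfun mu p2%:E,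
          'N[mu]_p1%:E[EFin \o f.1] <= 1 & 'N[mu]_p2%:E[EFin \o f.2] <= 1]]].

End euclidean.

Definition comparable_on (R : realType) (X : Type) (A : set X)
    (N M : X -> \bar R) : Prop :=
  exists c C : R, [/\ 0 < c, 0 < C &
    forall x, A x -> (c%:E * M x <= N x)%E /\ (N x <= C%:E * M x)%E].

(* Main.v *)
(* Write Q for the cells containing x, a = alpha/n, M for the dyadic maximal
   function, and beta = ||b||_BMO. Since
     b(x) <f1>_Q - <b f1>_Q = (b(x) - <b>_Q) <f1>_Q - <(b - <b>_Q) f1>_Q,
   the commutator is bounded by two sums. In the second one a stopping-time
   induction over the generations gives <|b - <b>_Q| g>_Q <= C beta <M g>_Q, which
   reduces it to the fractional integral of (M f1, f2); that is controlled by
   Hedberg's trick (split the sum over Q where the bounds |Q|^a M f1 M f2 and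
   |Q|^(-1/q) balance) and by Doob's inequality. The first sum is handled by
   subadditivity of t^q and concavity on each cell when q <= 1, and, when q > 1,
   by pairing with a dual function h and using the same inequality
   <|b - <b>_Q| h>_Q <= C beta <M h>_Q.

   For the lower bound fix Q and a child Q' of Q, and test with f1 a multiple of
   (s - <s>_Q) 1_Q, where s = sgn (b - <b>_Q), and f2 a multiple of the indicator
   of Q minus Q'. On Q' the fractional integral of (f1, f2) vanishes, and that of
   (b f1, f2) is a sum of nonnegative terms, among which the term of Q is a
   multiple of <|b - <b>_Q|>_Q. *)
Require Import Defs.
From HB Require Import structures.
From mathcomp Require Import all_boot all_order all_algebra.
From mathcomp Require Import all_classical all_reals all_analysis.
From mathcomp Require Import measurable_realfun simple_functions.
From mathcomp Require Import ring lra zify.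
Import Order.TTheory GRing.Theory Num.Theory.
Import numFieldNormedType.Exports.

Set Implicit Arguments.
Unset Strict Implicit.
Unset Printing Implicit Defensive.

Local Open Scope classical_set_scope.
Local Open Scope ring_scope.

(** * Integrals and powers *)

(** The upper estimates see the grid only as nested countable partitions into sets of equal measure,
    with a fixed ratio between generations, so they are carried out for an abstract filtration. The
    cells around a point need not exhaust the space; sums over generations are therefore bounded on
    finite windows, with constants independent of the window, before a monotone limit is taken. The
    main obstacle is that [b] is merely locally integrable and [f1] merely in [L^p1], so that even
    the integrability of [b f1] on a cell is in doubt. The stopping-time inequality settles this
    along with the estimate: it pays with [M g] at the same exponent, and so needs no higher
    integrability of the oscillation of [b]. Its induction requires finitely many generations; it is
    run on averages of [b] over small cells and carried over to [b] by [L^1] density. With P = 1/p1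
    + 1/p2, the balance in Hedberg's split leaves M f1 M f2 to the power 1/(qP); the q-th power is
    (M f1 M f2)^(1/P), which Young's inequality separates into (M f1)^p1 and (M f2)^p2 whatever the
    size of q. In the lower bound the relation between the exponents cancels all powers of |Q|, so
    one constant serves every cube. *)

Section ge0_integral.
Context d (V : measurableType d) (R : realType) (mu : {measure set V -> \bar R}).
Implicit Types (A : set V) (f g : V -> R).
Local Open Scope ereal_scope.

(* No measurability is required: the integral of a nonnegative function is a
   supremum over the simple functions below it. *)
Lemma le_ge0_integral A (phi psi : V -> \bar R) :
  (forall x, A x -> 0 <= phi x) -> (forall x, A x -> phi x <= psi x) ->
  \int[mu]_(x in A) phi x <= \int[mu]_(x in A) psi x.
Proof.
move=> phi0 le; have psi0 x : A x -> 0 <= psi x.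
  by move=> Ax; exact: le_trans (phi0 _ Ax) (le _ Ax).
rewrite !ge0_integralE//; apply: le_ereal_sup => _ [h hphi <-]; exists h => // x.
by apply: (le_trans (hphi x)); rewrite /patch; case: ifPn => // /set_mem/le.
Qed.

Lemma ge0_integralDr A f g : measurable A ->
  measurable_fun setT f -> measurable_fun setT g ->
  (forall x, 0 <= f x)%R -> (forall x, 0 <= g x)%R ->
  \int[mu]_(x in A) (f x + g x)%:E =
  \int[mu]_(x in A) (f x)%:E + \int[mu]_(x in A) (g x)%:E.
Proof.
move=> mA mf mg f0 g0; under eq_integral do rewrite EFinD.
rewrite ge0_integralD//; try by move=> x _; rewrite lee_fin.
- by apply/measurable_EFinP; exact: measurable_funS mf.
- by apply/measurable_EFinP; exact: measurable_funS mg.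
Qed.

Lemma ge0_integralZr_EFin A f (c : R) : measurable A ->
  measurable_fun setT f -> (forall x, 0 <= f x)%R -> (0 <= c)%R ->
  \int[mu]_(x in A) (c * f x)%:E = c%:E * \int[mu]_(x in A) (f x)%:E.
Proof.
move=> mA mf f0 c0; under eq_integral do rewrite EFinM.
rewrite ge0_integralZl_EFin//; first by move=> x _; rewrite lee_fin.
by apply/measurable_EFinP; exact: measurable_funS mf.
Qed.

(** Monotone convergence for a function squeezed below a supremum. As [phi] need not be measurable,
    it applies directly to a power of the commutator. *)
Lemma integral_ereal_sup_le A (u : nat -> V -> \bar R) (phi : V -> \bar R) C :
  measurable A -> (forall n, measurable_fun setT (u n)) ->
  (forall n x, 0 <= u n x) ->
  (forall x, {homo u ^~ x : m n / (m <= n)%N >-> m <= n}) ->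
  (forall n, \int[mu]_(x in A) u n x <= C) ->
  (forall x, A x -> 0 <= phi x <= ereal_sup (range (u ^~ x))) ->
  \int[mu]_(x in A) phi x <= C.
Proof.
move=> mA mu_ u0 nd leC phiu.
apply: (@le_trans _ _ (\int[mu]_(x in A) limn (u ^~ x))).
  apply: le_ge0_integral => x Ax; have /andP[//] := phiu x Ax.
  move=> _ /le_trans; apply.
  by rewrite (cvg_lim _ (ereal_nondecreasing_cvgn (nd x))).
have := @cvg_monotone_convergence _ _ _ mu A mA u.
move=> /(_ (fun n => measurable_funS measurableT (@subsetT _ _) (mu_ n))).
move=> /(_ (fun n x _ => u0 n x) (fun x _ => nd x)) cv.
rewrite -(cvg_lim _ cv)//; apply: lime_le; first by apply/cvg_ex; eexists; exact: cv.
exact: nearW.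
Qed.

End ge0_integral.

(** * Young's inequality and real powers *)

Section young.
Variable R : realType.
Implicit Types a b p : R.

Lemma conj_exp_gt0 p : 1 < p -> 0 < p / (p - 1).
Proof. by move=> p1; rewrite divr_gt0; lra. Qed.

Lemma conj_exp_inv p : 1 < p -> p^-1 + (p / (p - 1))^-1 = 1.
Proof. by move=> p1; rewrite invf_div; field; rewrite gt_eqF//; lra. Qed.

Lemma conj_exp_invE p : 1 < p -> (p / (p - 1))^-1 = 1 - p^-1.
Proof.
by move=> p1; apply/eqP; rewrite eq_sym subr_eq addrC (conj_exp_inv p1).
Qed.

Lemma young_powRB1 a b p : 1 < p -> 0 <= a -> 0 <= b ->
  a * b `^ (p - 1) <= a `^ p / p + b `^ p / (p / (p - 1)).
Proof.
move=> p1 a0 b0.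
have := @conjugate_powR R a (b `^ (p - 1)) p (p / (p - 1)) a0 (powR_ge0 _ _).
rewrite -powRrM (_ : (p - 1) * (p / (p - 1)) = p); last first.
  by field; rewrite gt_eqF//; lra.
by apply; rewrite ?conj_exp_inv ?conj_exp_gt0//; lra.
Qed.

(** This is Young's bound for a b^(p-1), multiplied by p/(p-1) and rearranged. In Doob's inequality
    [b] is the running maximum and [a] the average that overtakes it: the growth of the p-th power
    is charged to an expression linear in that average. *)
Lemma powR_increment a b p : 1 < p -> 0 <= b <= a ->
  a `^ p <= b `^ p + p / (p - 1) * (a * (a `^ (p - 1) - b `^ (p - 1))).
Proof.
move=> p1 /andP[b0 ba]; have a0 := le_trans b0 ba.
have := young_powRB1 p1 a0 b0.
have -> : a * (a `^ (p - 1) - b `^ (p - 1)) = a `^ p - a * b `^ (p - 1).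
  by rewrite mulrBr mulr_powRB1//; lra.
set u := a * _; set A := a `^ p; set B := b `^ p => uAB.
have p0 : 0 < p / (p - 1) by exact: conj_exp_gt0.
have : p / (p - 1) * u <= p / (p - 1) * (A / p + B / (p / (p - 1))).
  by rewrite ler_pM2l.
rewrite (_ : p / (p - 1) * (A / p + B / (p / (p - 1))) = (p / (p - 1) - 1) * A + B).
  by rewrite mulrBr; lra.
by field; rewrite !gt_eqF//; lra.
Qed.

Lemma ler_powR2 a b p : 0 <= p -> 0 <= a -> a <= b -> a `^ p <= b `^ p.
Proof.
move=> p0 a0 ab; apply: ge0_ler_powR => //; rewrite nnegrE//.
exact: le_trans ab.
Qed.

Lemma lee_poweR2 (x y : \bar R) p : 0 <= p -> (0 <= x)%E -> (x <= y)%E ->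
  (x `^ p <= y `^ p)%E.
Proof.
move=> p0 x0 xy; apply: gt0_ler_poweR => //; rewrite in_itv/= leey andbT//.
exact: le_trans xy.
Qed.

Lemma powR_max a b p : (Num.max a b) `^ p <= a `^ p + b `^ p.
Proof.
by rewrite /Num.max; case: ifP => _; rewrite ?lerDl ?lerDr ?powR_ge0.
Qed.

Lemma powRD_le a b p : 0 <= p -> 0 <= a -> 0 <= b ->
  (a + b) `^ p <= 2 `^ p * (a `^ p + b `^ p).
Proof.
move=> p0 a0 b0; apply: (@le_trans _ _ ((2 * Num.max a b) `^ p)).
  apply: ler_powR2 => //; first exact: addr_ge0.
  by rewrite mulr_natl mulr2n lerD// le_max lexx ?orbT.
rewrite powRM//; last by rewrite le_max a0.
by rewrite ler_wpM2l ?powR_ge0// powR_max.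
Qed.

End young.


(** * Dyadic filtrations and averages *)

(* [cell k x] is the atom of generation [k] around [x]. Atoms get larger as [k]
   increases, and all atoms of one generation have the same measure. *)
Record dyadic_filtration d (V : measurableType d) (R : realType)
    (mu : {measure set V -> \bar R}) := DyadicFiltration {
  cell : int -> V -> set V;
  vol : int -> R;
  ratio : R;
  point : nat -> V;
  ratio_gt1 : 1 < ratio;
  vol_gt0 : forall k, 0 < vol k;
  volS : forall k, vol (k + 1) = ratio * vol k;
  measurable_cell : forall k x, measurable (cell k x);
  mu_cell : forall k x, mu (cell k x) = (vol k)%:E;
  cell_refl : forall k x, cell k x x;
  cell_eq : forall k x y, cell k x y -> cell k y = cell k x;
  cellS : forall k x, cell k x `<=` cell (k + 1) x;
  cell_point : forall k x, exists i, cell k (point i) x;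
  cell_generate : @measurable d V `<=` <<s [set cell kx.1 kx.2 | kx in setT] >>
}.

Section cells.
Context d (V : measurableType d) (R : realType) (mu : {measure set V -> \bar R}).
Variable F : dyadic_filtration mu.
Local Notation cell := (cell F).
Local Notation vol := (vol F).
Local Notation rho := (ratio F).
Implicit Types (k : int) (x y : V) (f g : V -> R).

#[local] Hint Resolve measurable_cell cell_refl : core.

Lemma vol_neq0 k : vol k != 0. Proof. by rewrite gt_eqF// vol_gt0. Qed.

Lemma invvol_gt0 k : 0 < (vol k)^-1. Proof. by rewrite invr_gt0 vol_gt0. Qed.

Lemma cell_sym k x y : cell k x y -> cell k y x.
Proof. by move=> /cell_eq ->. Qed.

Lemma cell_le k x (j : nat) : cell k x `<=` cell (k + j%:Z) x.
Proof.
elim: j => [|j IHj]; first by rewrite addr0.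
by apply: (subset_trans IHj); rewrite -addn1 PoszD addrA; exact: cellS.
Qed.

Definition level T k (h : V -> T) := forall x y, cell k x y -> h y = h x.

Lemma levelW T k (j : nat) (h : V -> T) : level (k + j%:Z) h -> level k h.
Proof. by move=> lh x y xy; apply: lh; exact: cell_le xy. Qed.

(** A generation has countably many atoms by [cell_point], so every preimage is a countable union of
    cells. *)
Lemma measurable_level d' (T : measurableType d') k (h : V -> T) :
  level k h -> measurable_fun setT h.
Proof.
move=> lh _ Y mY; rewrite setTI.
rewrite (_ : h @^-1` Y = \bigcup_(i in [set i | Y (h (point F i))])
                            cell k (point F i)).
  by apply: bigcup_measurable => i _; exact: measurable_cell.
apply/seteqP; split => [x /= Yx|x [i /= Yi ix]].
  have [i ix] := cell_point F k x.
  by exists i => //=; rewrite -(lh _ _ ix).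
by rewrite (lh _ _ ix).
Qed.

Definition saturated k (A : set V) := forall x, A x -> cell k x `<=` A.

Lemma saturated_cell k (j : nat) x : saturated k (cell (k + j%:Z) x).
Proof. by move=> y /cell_eq <-; exact: cell_le. Qed.

Lemma saturatedT k : saturated k setT. Proof. by []. Qed.

Lemma measurable_saturated k A : saturated k A -> measurable A.
Proof.
move=> sA; rewrite (_ : A = \bigcup_(i in [set i | A (point F i)])
                            cell k (point F i)).
  by apply: bigcup_measurable => i _; exact: measurable_cell.
apply/seteqP; split => [x Ax|x [i /= Ai]]; last exact: sA.
have [i ix] := cell_point F k x.
by exists i => //=; apply: (sA _ Ax); exact: cell_sym.
Qed.

Local Open Scope ereal_scope.

Lemma le_integral_cells k (A : set V) (phi psi : V -> \bar R) :
  saturated k A -> measurable_fun setT phi -> measurable_fun setT psi ->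
  (forall x, 0 <= phi x) -> (forall x, 0 <= psi x) ->
  (forall x, A x ->
    \int[mu]_(y in cell k x) phi y <= \int[mu]_(y in cell k x) psi y) ->
  \int[mu]_(y in A) phi y <= \int[mu]_(y in A) psi y.
Proof.
move=> sA mphi mpsi phi0 psi0 le.
(* The points enumerate cells with repetitions. [P] keeps only the least index of each cell inside
   [A], which makes the sets [G i] a countable partition of [A]. *)
pose P i := `[< A (point F i) /\
                forall j, (j < i)%N -> ~ cell k (point F j) (point F i) >].
pose G i := if P i then cell k (point F i) else set0.
have mG i : measurable (G i) by rewrite /G; case: ifP => _ //; exact: measurable_cell.
have AE : A = \bigcup_i G i.
  apply/seteqP; split=> [x Ax|x [i _]]; last first.
    by rewrite /G; case: ifPn => // /asboolP[Ai _]; exact: sA.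
  have ex : exists i, `[< cell k (point F i) x >].
    by have [i ix] := cell_point F k x; exists i; exact/asboolP.
  case: (ex_minnP ex) => i /asboolP ix imin; exists i => //.
  have Pi : P i.
    apply/asboolP; split; first by apply: (sA _ Ax); exact: cell_sym.
    move=> j ji jpi; have : (i <= j)%N.
      by apply: imin; apply/asboolP; rewrite -(cell_eq jpi).
    by rewrite leqNgt ji.
  by rewrite /G Pi.
have tG : trivIset setT G.
  apply/trivIsetP => i j _ _.
  wlog ij : i j / (i < j)%N.
    move=> W; rewrite neq_ltn => /orP[ij|ji]; first by apply: W => //; rewrite ltn_eqF.
    by rewrite setIC; apply: W => //; rewrite ltn_eqF.
  move=> _; rewrite /G; case: ifPn => Pi; last by rewrite set0I.
  case: ifPn => Pj; last by rewrite setI0.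
  apply/seteqP; split => // x [xi xj].
  move/asboolP : Pj => [_ /(_ _ ij)]; apply.
  by rewrite -(cell_eq xi) (cell_eq xj).
rewrite AE !ge0_integral_bigcup//; last 2 first.
  exact: measurable_funS mpsi.
  exact: measurable_funS mphi.
apply: lee_nneseries => i _; first by move=> _; apply: integral_ge0.
rewrite /G; case: ifPn => [/asboolP[Ai _]|_]; first exact: le.
by rewrite !integral_set0.
Qed.

Lemma eq_integral_cells k (A : set V) (phi psi : V -> \bar R) :
  saturated k A -> measurable_fun setT phi -> measurable_fun setT psi ->
  (forall x, 0 <= phi x) -> (forall x, 0 <= psi x) ->
  (forall x, A x ->
    \int[mu]_(y in cell k x) phi y = \int[mu]_(y in cell k x) psi y) ->
  \int[mu]_(y in A) phi y = \int[mu]_(y in A) psi y.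
Proof.
move=> sA m1 m2 p1 p2 e; apply/eqP; rewrite eq_le; apply/andP; split;
  by apply: (le_integral_cells sA) => // x /e ->.
Qed.

Local Close Scope ereal_scope.

Definition locint f := measurable_fun setT f /\
  forall k x, mu.-integrable (cell k x) (EFin \o f).

(** The conditional expectation on generation [k]. [Rintegral] returns a default value when the
    integral is not finite, which is why the lemmas relating it to integrals ask for [locint]. *)
Definition cexp k f x : R := (vol k)^-1 * \int[mu]_(y in cell k x) f y.

Lemma cexp_level k f : level k (cexp k f).
Proof. by move=> x y xy; rewrite /cexp (cell_eq xy). Qed.

Lemma measurable_cexp k f : measurable_fun setT (cexp k f).
Proof. exact/measurable_level/cexp_level. Qed.

Lemma cexp_ge0 k f x : (forall y, 0 <= f y) -> 0 <= cexp k f x.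
Proof.
by move=> f0; rewrite mulr_ge0 ?(ltW (invvol_gt0 _))//; apply: Rintegral_ge0.
Qed.

Lemma integral_cexp k f x : locint f ->
  (\int[mu]_(y in cell k x) (f y)%:E)%E = (vol k * cexp k f x)%:E.
Proof.
move=> [mf fi]; rewrite /cexp mulrA divff ?vol_neq0// mul1r.
by rewrite /Rintegral fineK//; exact: integrable_fin_num.
Qed.

Lemma le_cexp k f g x : locint f -> locint g ->
  (forall y, cell k x y -> f y <= g y) -> cexp k f x <= cexp k g x.
Proof.
move=> [_ fi] [_ gi] fg; rewrite ler_pM2l ?invvol_gt0//.
exact: le_Rintegral.
Qed.

Lemma cexp_cst_on k f x (c : R) : (forall y, cell k x y -> f y = c) ->
  cexp k f x = c.
Proof.
move=> fc; rewrite /cexp (_ : \int[mu]_(y in cell k x) f y = c * vol k).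
  by rewrite mulrCA mulVf ?mulr1// vol_neq0.
under eq_Rintegral => y /set_mem/fc -> do [].
by rewrite Rintegral_cst// mu_cell.
Qed.

Lemma cexpB k f g x : locint f -> locint g ->
  cexp k (fun y => f y - g y) x = cexp k f x - cexp k g x.
Proof. by move=> [_ fi] [_ gi]; rewrite /cexp RintegralB// mulrBr. Qed.

Lemma cexpZ k f x (c : R) : locint f ->
  cexp k (fun y => c * f y) x = c * cexp k f x.
Proof. by move=> [_ fi]; rewrite /cexp RintegralZl// mulrCA. Qed.

Lemma cexp_norm k f x : locint f -> `|cexp k f x| <= cexp k (fun y => `|f y|) x.
Proof.
move=> [_ fi]; rewrite normrM gtr0_norm ?invvol_gt0//.
by rewrite ler_pM2l ?invvol_gt0//; exact: le_normr_Rintegral.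
Qed.

Lemma locintD f g : locint f -> locint g -> locint (fun y => f y + g y).
Proof.
move=> [mf fi] [mg gi]; split; first exact: measurable_funD.
move=> k x; apply: (eq_integrable _ ((EFin \o f) \+ (EFin \o g))%E) => //.
exact: integrableD.
Qed.

Lemma locintZ f (c : R) : locint f -> locint (fun y => c * f y).
Proof.
move=> [mf fi]; split; first exact: measurable_funM.
move=> k x; apply: (eq_integrable _ (fun y => c%:E * (f y)%:E)%E) => //.
exact: integrableZl.
Qed.

Lemma locintB f g : locint f -> locint g -> locint (fun y => f y - g y).
Proof.
move=> lf lg; have := locintD lf (locintZ (-1) lg).
by under [X in locint X -> _]eq_fun do rewrite mulN1r.
Qed.

Lemma locint_norm f : locint f -> locint (fun y => `|f y|).
Proof.
move=> [mf fi]; split; first exact: measurableT_comp.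
by move=> k x; have := integrable_norm (fi k x).
Qed.

Lemma locint_le f g : measurable_fun setT f -> locint g ->
  (forall x, `|f x| <= g x) -> locint f.
Proof.
move=> mf [mg gi] fg; split => // k x.
apply: (le_integrable _ _ _ (gi k x)) => //.
  by apply/measurable_EFinP; exact: measurable_funS mf.
by move=> y _; rewrite /= lee_fin (le_trans (fg y))// ler_norm.
Qed.


Lemma locint_cst (c : R) : locint (cst c).
Proof.
split => // k x; apply/integrableP; split; first exact/measurable_EFinP.
rewrite (eq_integral (cst `|c|%:E))// integral_cst//.
by rewrite mu_cell -EFinM ltry.
Qed.

Lemma locint_ge0P f : measurable_fun setT f -> (forall x, 0 <= f x) ->
  (forall k x, \int[mu]_(y in cell k x) (f y)%:E < +oo)%E -> locint f.
Proof.
move=> mf f0 fi; split => // k x; apply/integrableP; split.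
  by apply/measurable_EFinP; exact: measurable_funS mf.
by under eq_integral => y _ do rewrite /= ger0_norm//.
Qed.

(** The tower property: [h] is constant on each cell and leaves the integral over it, where [f] and
    its average have the same mass. *)
Lemma integral_level_cexp k (A : set V) (h f : V -> R) : saturated k A ->
  level k h -> (forall x, 0 <= h x) -> locint f -> (forall x, 0 <= f x) ->
  (\int[mu]_(x in A) (h x * f x)%:E = \int[mu]_(x in A) (h x * cexp k f x)%:E)%E.
Proof.
move=> sA lh h0 lf f0; have [mf fi] := lf.
have mh := measurable_level lh.
apply: (eq_integral_cells sA).
- by apply/measurable_EFinP; exact: measurable_funM.
- by apply/measurable_EFinP; apply: measurable_funM => //; exact: measurable_cexp.
- by move=> x; rewrite lee_fin mulr_ge0.
- by move=> x; rewrite lee_fin mulr_ge0// cexp_ge0.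
move=> x Ax.
transitivity ((h x)%:E * \int[mu]_(y in cell k x) (f y)%:E)%E.
  rewrite -ge0_integralZl//; last 3 first.
    by apply/measurable_EFinP; exact: measurable_funS mf.
    by move=> y _; rewrite lee_fin.
    by rewrite lee_fin.
  by apply: eq_integral => y /set_mem xy; rewrite (lh _ _ xy) EFinM.
rewrite integral_cexp//.
under eq_integral => y /set_mem xy do rewrite (lh _ _ xy) (cexp_level f xy).
by rewrite integral_cst// mu_cell -!EFinM mulrCA [in RHS]mulrA mulrC mulrA mulrAC.
Qed.

End cells.

(** * The dyadic maximal function *)

Section maximal_function.
Context d (V : measurableType d) (R : realType) (mu : {measure set V -> \bar R}).
Variable F : dyadic_filtration mu.
Local Notation cell := (cell F).
Local Notation vol := (vol F).
Local Notation cexp := (cexp F).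
Local Notation locint := (locint F).
Local Notation level := (level F).

(** The running maximum of a martingale, read from the coarse generation [K] down to [K - j].
    Stopping at a finite depth keeps it constant on cells of the last generation, as the induction
    in Doob's inequality requires. *)
Fixpoint tmax (f : V -> R) (K : int) (j : nat) (x : V) : R :=
  if j is i.+1 then Num.max (tmax f K i x) (cexp (K - j%:Z) f x)
  else cexp K f x.

Section fixed.
Variables (f : V -> R).

Lemma tmax_ge0 K j x : (forall y, 0 <= f y) -> 0 <= tmax f K j x.
Proof. by move=> f0; case: j => [|j] /=; rewrite ?le_max cexp_ge0// orbT. Qed.

Lemma cexp_le_tmax K j i x : (i <= j)%N -> cexp (K - i%:Z) f x <= tmax f K j x.
Proof.
elim: j => [|j IHj] /=; first by rewrite leqn0 => /eqP ->; rewrite subr0.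
rewrite leq_eqVlt => /predU1P[->|ij]; first by rewrite le_max lexx orbT.
by rewrite le_max IHj.
Qed.

Lemma tmax_le K j x (c : R) :
  (forall i, (i <= j)%N -> cexp (K - i%:Z) f x <= c) -> tmax f K j x <= c.
Proof.
elim: j => [|j IHj] le /=; first by have := le 0 (leqnn _); rewrite subr0.
by rewrite ge_max le// IHj// => i ij; rewrite le// ltnW.
Qed.

Lemma tmax_level K j : level (K - j%:Z) (tmax f K j).
Proof.
elim: j => [|j IHj] /=; first by rewrite subr0; exact: cexp_level.
move=> x y xy; rewrite (cexp_level f xy); congr Num.max.
apply: (@levelW _ _ _ _ _ _ _ 1%N) xy.
by rewrite (_ : K - j.+1%:Z + 1%N = K - j%:Z) //; lia.
Qed.

Lemma measurable_tmax K j : measurable_fun setT (tmax f K j).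
Proof. exact/measurable_level/tmax_level. Qed.

Lemma measurable_tmaxX K j r : measurable_fun setT (fun x => tmax f K j x `^ r).
Proof.
by apply: (measurableT_comp (measurable_powR r)); exact: measurable_tmax.
Qed.

End fixed.

Local Open Scope ereal_scope.

(** The [N]-th window runs over the generations from [N] down to [- N]. [fine] sends an infinite
    supremum to 0, so domination of the averages is only available almost everywhere. *)
Definition dyadic_max (f : V -> R) (x : V) : R :=
  fine (ereal_sup (range (fun N : nat => (tmax f N (N + N) x)%:E))).


Lemma tmax_homo (f : V -> R) x : {homo (fun N : nat => tmax f N (N + N) x) :
  m n / (m <= n)%N >-> (m <= n)%R}.
Proof.
apply: (homo_leq (@lexx _ _) (@le_trans _ _)) => N; apply: tmax_le => i iN.
have -> : (Posz N - Posz i = Posz N.+1 - Posz i.+1)%R by lia.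
by apply: cexp_le_tmax; lia.
Qed.

Lemma measurable_ereal_sup_range (u : nat -> V -> \bar R) :
  (forall n, measurable_fun setT (u n)) ->
  measurable_fun setT (fun x => ereal_sup (range (u ^~ x))).
Proof.
move=> mu_; rewrite (_ : (fun _ => _) = (fun x => esups (u ^~ x) 0%N)).
  exact: measurable_fun_esups.
by apply/funext => x; congr ereal_sup; apply/seteqP; split => [_ [n _ <-]|_ [n _ <-]];
  exists n.
Qed.

Lemma measurable_dyadic_max f : measurable_fun setT (dyadic_max f).
Proof.
apply: measurableT_comp; first exact: fine_measurable.
apply: (measurable_ereal_sup_range (u := fun N x => (tmax f N (N + N) x)%:E)).
by move=> N; apply/measurable_EFinP; exact: measurable_tmax.
Qed.

Lemma dyadic_max_ge0 f x : (forall y, 0 <= f y)%R -> (0 <= dyadic_max f x)%R.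
Proof.
move=> f0; rewrite fine_ge0//.
apply: (@le_trans _ _ (tmax f 0 0 x)%:E); first by rewrite lee_fin tmax_ge0.
by apply: ereal_sup_ubound; exists 0%N.
Qed.

Section doob.
Variables (p : R) (p1 : (1 < p)%R).
Local Notation p' := (p / (p - 1))%R.

Let p0 : (0 < p)%R. Proof. by rewrite (lt_trans _ p1). Qed.
Let pB0 : (0 < p - 1)%R. Proof. by rewrite subr_gt0. Qed.
Let p'0 : (0 < p')%R. Proof. exact: conj_exp_gt0. Qed.
Let p'ge0 : (0 <= p')%R. Proof. exact: ltW. Qed.

Section fixed.
Variables (f : V -> R) (f0 : forall x, (0 <= f x)%R) (lf : locint f).

Let mf : measurable_fun setT f. Proof. by have [] := lf. Qed.

(** One generation is added at a time. The increment [h] of the (p-1)-th power is constant on cells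
    of the new generation, so the tower property replaces the new average by [f] itself, and the
    increments telescope. *)
Lemma integral_tmax_le K j :
  \int[mu]_x ((tmax f K j x) `^ p)%:E <=
  p'%:E * \int[mu]_x (f x * (tmax f K j x) `^ (p - 1))%:E.
Proof.
have mX r i : measurable_fun setT (fun x => tmax f K i x `^ r)%R.
  exact: measurable_tmaxX.
have X0 r i x : (0 <= tmax f K i x `^ r)%R by exact: powR_ge0.
elim: j => [|j IHj].
  have lh : level K (fun x => cexp K f x `^ (p - 1))%R.
    by move=> x y xy; rewrite (cexp_level f xy).
  have tow := integral_level_cexp (@saturatedT _ _ _ _ F K) lh
    (fun x => powR_ge0 (cexp K f x) (p - 1)) lf f0.
  have -> : \int[mu]_x ((tmax f K 0 x) `^ p)%:E =
      \int[mu]_x ((tmax f K 0 x) `^ (p - 1) * f x)%:E.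
    rewrite [RHS]tow; apply: eq_integral => x _.
    by rewrite mulrC mulr_powRB1 ?cexp_ge0.
  under eq_integral do rewrite mulrC.
  rewrite -[leLHS]mul1e; apply: lee_wpmul2r.
    by apply: integral_ge0 => x _; rewrite lee_fin; exact: mulr_ge0.
  by rewrite lee_fin ler_pdivlMr// mul1r gerBl.
have M0 := @tmax_ge0 f K j.+1.
pose h x := (tmax f K j.+1 x `^ (p - 1) - tmax f K j x `^ (p - 1))%R.
have h0 x : (0 <= h x)%R.
  rewrite subr_ge0; apply: ler_powR2; [exact: ltW|exact: tmax_ge0|].
  by rewrite /= le_max lexx.
have lh : level (K - j.+1%:Z) h.
  move=> x y xy; rewrite /h (tmax_level f xy); congr (_ - _ `^ _)%R.
  apply: (@levelW _ _ _ _ _ _ _ 1%N) xy.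
  by rewrite (_ : K - j.+1%:Z + 1%N = K - j%:Z)%R; [exact: tmax_level|lia].
have tow := integral_level_cexp (@saturatedT _ _ _ _ F (K - j.+1%:Z)%R) lh h0 lf f0.
have e0 x := @cexp_ge0 _ _ _ _ F (K - j.+1%:Z)%R f x f0.
have me := measurable_cexp F (K - j.+1%:Z)%R f.
have step x : (tmax f K j.+1 x `^ p <=
    tmax f K j x `^ p + p' * (h x * cexp (K - j.+1%:Z) f x))%R.
  rewrite /h /= /Num.max; case: ifPn => me_x; last first.
    by rewrite subrr mul0r mulr0 addr0.
  rewrite [(_ * cexp _ _ _)%R]mulrC; apply: powR_increment; first exact: p1.
  by apply/andP; split; [exact: tmax_ge0|exact: ltW].
have sumE x : (f x * tmax f K j.+1 x `^ (p - 1) =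
    f x * tmax f K j x `^ (p - 1) + h x * f x)%R.
  by rewrite /h; ring.
have mh := measurable_level lh.
rewrite [X in _ <= _ * X](eq_integral
  (fun x => (f x * tmax f K j x `^ (p - 1) + h x * f x)%:E)); last first.
  by move=> x _; rewrite sumE.
have := @le_ge0_integral _ _ _ mu setT (fun x => (tmax f K j.+1 x `^ p)%:E)
  (fun x => (tmax f K j x `^ p + p' * (h x * cexp (K - j.+1%:Z) f x))%:E)
  (fun x _ => X0 _ _ _) (fun x _ => step x).
move: IHj tow (mX p j) (X0 p j) (mX (p - 1)%R j) (X0 (p - 1)%R j) e0 me mh h0.
move: (cexp _ _) (tmax f K j) h {mX X0 lh step sumE M0} => e m h.
move=> IHj tow mmp mp0 mmp1 mp10 e0 me mh h0 le; apply: (le_trans le).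
have mhe : measurable_fun setT (fun x => h x * e x)%R by exact: measurable_funM.
have he0 x : (0 <= h x * e x)%R by exact: mulr_ge0.
have mhf : measurable_fun setT (fun x => h x * f x)%R by exact: measurable_funM.
have hf0 x : (0 <= h x * f x)%R by exact: mulr_ge0.
have mfm : measurable_fun setT (fun x => f x * m x `^ (p - 1))%R by exact: measurable_funM.
have fm0 x : (0 <= f x * m x `^ (p - 1))%R by exact: mulr_ge0.
rewrite (ge0_integralDr mu measurableT mmp
  (measurable_funM (measurable_cst p') mhe) mp0 (fun x => mulr_ge0 p'ge0 (he0 x))).
rewrite (ge0_integralZr_EFin mu measurableT mhe he0 p'ge0) -tow.
rewrite (ge0_integralDr mu measurableT mfm mhf fm0 hf0).
have i1 : 0 <= \int[mu]_x (f x * m x `^ (p - 1))%:E.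
  by apply: integral_ge0 => x _; rewrite lee_fin.
have i2 : 0 <= \int[mu]_x (h x * f x)%:E.
  by apply: integral_ge0 => x _; rewrite lee_fin.
by rewrite (ge0_muleDr p'%:E i1 i2); exact: leeD2r.
Qed.

(** Jensen's inequality through the tangent at the average [t]: Young's bound for t^(p-1) f is
    integrated over the cell, and the resulting multiple of t^p is absorbed. *)
Lemma integral_cexp_powR_le K :
  \int[mu]_x ((cexp K f x) `^ p)%:E <= \int[mu]_x (f x `^ p)%:E.
Proof.
have mfp : measurable_fun setT (fun x => f x `^ p)%R.
  exact: (measurableT_comp (measurable_powR p)).
apply: (le_integral_cells (F := F) (k := K)).
- exact: saturatedT.
- by apply/measurable_EFinP/(measurableT_comp (measurable_powR p))/measurable_cexp.
- exact/measurable_EFinP.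
- by move=> x; rewrite lee_fin powR_ge0.
- by move=> x; rewrite lee_fin powR_ge0.
move=> x _; set t := cexp K f x.
have t0 : (0 <= t)%R by exact: cexp_ge0.
have mc := measurable_cell F K x.
rewrite (eq_integral (cst (t `^ p)%:E)); last first.
  by move=> y /set_mem xy; rewrite (cexp_level f xy).
rewrite integral_cst// mu_cell -EFinM.
have := @le_ge0_integral _ _ _ mu (cell K x)
  (fun y => (t `^ (p - 1) * f y)%:E) (fun y => (f y `^ p / p + t `^ p / p')%:E).
have H1 y : cell K x y -> 0 <= (t `^ (p - 1) * f y)%:E.
  by rewrite lee_fin mulr_ge0 ?powR_ge0.
move=> /(_ H1); have H2 y : cell K x y ->
    (t `^ (p - 1) * f y)%:E <= (f y `^ p / p + t `^ p / p')%:E.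
  by rewrite lee_fin mulrC => _; exact: young_powRB1.
move=> /(_ H2); under eq_integral do rewrite EFinM.
rewrite ge0_integralZl_EFin ?powR_ge0//; last 2 first.
  by move=> y _; rewrite lee_fin.
  by apply/measurable_EFinP; exact: measurable_funS mf.
rewrite integral_cexp// -/t -EFinM ge0_integralDr//; last 3 first.
- exact: measurable_funM.
- by move=> y; rewrite divr_ge0 ?powR_ge0 ?ltW.
- by move=> y; rewrite divr_ge0 ?powR_ge0 ?ltW.
under eq_integral do rewrite mulrC.
rewrite ge0_integralZr_EFin//; last 2 first.
  by move=> y; exact: powR_ge0.
  by rewrite invr_ge0 ltW.
rewrite integral_cst// mu_cell.
have : 0 <= \int[mu]_(y in cell K x) (f y `^ p)%:E.
  by apply: integral_ge0 => y _; rewrite lee_fin powR_ge0.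
case: (\int[mu]_(y in cell K x) (f y `^ p)%:E) => [I| |]//; last first.
  by move=> _ _; rewrite leey.
rewrite !lee_fin => I0; rewrite mulrCA -[(t `^ (p - 1) * t)%R]mulrC mulr_powRB1//.
set T := (t `^ p)%R => H.
move: H; rewrite conj_exp_invE// => H.
have : (vol K * T / p <= I / p)%R by nra.
by rewrite ler_pM2r ?invr_gt0// mulrC.
Qed.

(** Only finiteness counts here: without it a multiple of the left-hand side could not be absorbed
    in [doob_tmax]. *)
Lemma integral_tmax_lty K j : \int[mu]_x (f x `^ p)%:E < +oo ->
  \int[mu]_x ((tmax f K j x) `^ p)%:E < +oo.
Proof.
move=> fp; elim: j => [|j IHj].
  exact: le_lt_trans (integral_cexp_powR_le _) fp.
apply: (@le_lt_trans _ _
  (\int[mu]_x ((tmax f K j x) `^ p + (cexp (K - j.+1%:Z) f x) `^ p)%:E)).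
  apply: le_ge0_integral => x _; first by rewrite lee_fin powR_ge0.
  by rewrite lee_fin powR_max.
rewrite ge0_integralDr//; last 4 first.
  exact: measurable_tmaxX.
  exact/(measurableT_comp (measurable_powR p))/measurable_cexp.
  by move=> x; exact: powR_ge0.
  by move=> x; exact: powR_ge0.
apply: lte_add_pinfty; first exact: IHj.
exact: le_lt_trans (integral_cexp_powR_le _) fp.
Qed.

Lemma doob_tmax K j : \int[mu]_x (f x `^ p)%:E < +oo ->
  \int[mu]_x ((tmax f K j x) `^ p)%:E <=
  (p' `^ p)%:E * \int[mu]_x (f x `^ p)%:E.
Proof.
move=> fp; have := integral_tmax_lty K j fp.
have mfp : measurable_fun setT (fun x => f x `^ p)%R.
  exact: (measurableT_comp (measurable_powR p)).
set M := tmax f K j => Mfin.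
(* Young's inequality with p' f as first factor gives M^p the coefficient 1/p' < 1. Absorbing that
   term leaves 1/p on the left, which cancels the 1/p in front of f^p. *)
have : \int[mu]_x ((M x) `^ p)%:E <=
  \int[mu]_x (p' `^ p / p * f x `^ p + p'^-1 * M x `^ p)%:E.
  apply: (le_trans (integral_tmax_le K j)).
  rewrite -ge0_integralZr_EFin//; last 2 first.
    by apply: measurable_funM => //; exact: measurable_tmaxX.
    by move=> x; rewrite mulr_ge0 ?powR_ge0.
  apply: le_ge0_integral => x _; rewrite lee_fin.
    by apply: mulr_ge0 => //; rewrite mulr_ge0 ?powR_ge0.
  rewrite mulrA; apply: (le_trans (young_powRB1 p1 _ (tmax_ge0 K j x f0))).
    by rewrite mulr_ge0.
  rewrite powRM//.
  by rewrite -/M le_eqVlt; apply/orP; left; apply/eqP; ring.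
rewrite ge0_integralDr//; last 4 first.
  exact: measurable_funM.
  by apply: measurable_funM => //; exact: measurable_tmaxX.
  by move=> x; rewrite mulr_ge0 ?divr_ge0 ?powR_ge0 ?ltW.
  by move=> x; rewrite mulr_ge0 ?invr_ge0 ?powR_ge0 ?ltW.
rewrite ge0_integralZr_EFin//; last 2 first.
  by move=> x; exact: powR_ge0.
  by rewrite divr_ge0 ?powR_ge0 ?ltW.
rewrite ge0_integralZr_EFin//; last 3 first.
  exact: measurable_tmaxX.
  by move=> x; exact: powR_ge0.
  by rewrite invr_ge0 ltW.
have : 0 <= \int[mu]_x (f x `^ p)%:E.
  by apply: integral_ge0 => y _; rewrite lee_fin powR_ge0.
have : 0 <= \int[mu]_x (M x `^ p)%:E.
  by apply: integral_ge0 => y _; rewrite lee_fin powR_ge0.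
move: fp Mfin; case: (\int[mu]_x (f x `^ p)%:E) => [I| |]//.
case: (\int[mu]_x (M x `^ p)%:E) => [J| |]// _ _.
rewrite -!EFinM -EFinD !lee_fin => J0 I0.
rewrite conj_exp_invE//.
set q := (p' `^ p)%R => H.
have : (J / p <= q * I / p)%R by lra.
by rewrite ler_pM2r ?invr_gt0.
Qed.

End fixed.

Let maxX f x := ereal_sup (range (fun N : nat => (tmax f N (N + N) x `^ p)%:E)).

Let tmax_bound f x c : (forall y, 0 <= f y)%R -> maxX f x = c%:E ->
  forall N : nat, (tmax f N (N + N) x <= c `^ p^-1)%R.
Proof.
move=> f0 fxc N.
have : (tmax f N (N + N) x `^ p)%:E <= c%:E.
  by rewrite -fxc; apply: ereal_sup_ubound; exists N.
rewrite lee_fin => Nc; have := @ler_powR2 R _ _ p^-1 _ (powR_ge0 _ _) Nc.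
by rewrite -powRrM divff ?gt_eqF// powRr1 ?tmax_ge0//; apply; rewrite invr_ge0 ltW.
Qed.

Section lp.
Variables (f : V -> R) (f0 : forall x, (0 <= f x)%R) (lf : locint f).
Hypothesis fp : \int[mu]_x (f x `^ p)%:E < +oo.

Let int_maxX (phi : V -> \bar R) : (forall x, 0 <= phi x <= maxX f x) ->
  \int[mu]_x phi x <= (p' `^ p)%:E * \int[mu]_x (f x `^ p)%:E.
Proof.
move=> phiX; apply: (integral_ereal_sup_le
    (u := fun N x => (tmax f N (N + N) x `^ p)%:E)) => //.
- by move=> N; apply/measurable_EFinP; exact: measurable_tmaxX.
- by move=> N x; rewrite lee_fin powR_ge0.
- move=> x m n mn; rewrite lee_fin ler_powR2 ?tmax_ge0 ?(ltW p0)//.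
  exact: tmax_homo.
- by move=> N; exact: doob_tmax.
Qed.

Lemma dyadic_max_powR : \int[mu]_x (dyadic_max f x `^ p)%:E <=
  (p' `^ p)%:E * \int[mu]_x (f x `^ p)%:E.
Proof.
apply: int_maxX => x; rewrite lee_fin powR_ge0/=.
have : 0 <= maxX f x.
  apply: (@le_trans _ _ (tmax f 0 0 x `^ p)%:E).
    by rewrite lee_fin powR_ge0.
  by apply: ereal_sup_ubound; exists 0%N.
case E : (maxX f x) => [c| |]; [|by rewrite !leey|by []].
rewrite !lee_fin => c0.
have e : (c = (c `^ p^-1) `^ p)%R by rewrite -powRrM mulVf ?gt_eqF// powRr1.
rewrite [leRHS]e ler_powR2 ?(ltW p0) ?dyadic_max_ge0//.
rewrite -lee_fin fineK.
  by apply: ge_ereal_sup => _ [N _ <-]; rewrite lee_fin; exact: tmax_bound.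
rewrite ge0_fin_numE.
  apply: (@le_lt_trans _ _ (c `^ p^-1)%:E); last exact: ltry.
  by apply: ge_ereal_sup => _ [N _ <-]; rewrite lee_fin; exact: tmax_bound.
apply: (@le_trans _ _ (tmax f 0 0 x)%:E); first by rewrite lee_fin tmax_ge0.
by apply: ereal_sup_ubound; exists 0%N.
Qed.

(** Doob's inequality makes the supremum finite almost everywhere, and there [fine] changes nothing.
    Generation [k] belongs to the window of index |k|. *)
Lemma cexp_le_dyadic_max :
  {ae mu, forall x, forall k, (cexp k f x <= dyadic_max f x)%R}.
Proof.
have mX : measurable_fun setT (maxX f).
  apply: measurable_ereal_sup_range => N.
  by apply/measurable_EFinP; exact: measurable_tmaxX.
have X0 x : 0 <= maxX f x.
  apply: (@le_trans _ _ (tmax f 0 0 x `^ p)%:E).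
    by rewrite lee_fin powR_ge0.
  by apply: ereal_sup_ubound; exists 0%N.
have : mu.-integrable setT (maxX f).
  apply/integrableP; split => //.
  apply: (@le_lt_trans _ _ ((p' `^ p)%:E * \int[mu]_x (f x `^ p)%:E)).
    by apply: int_maxX => x; rewrite gee0_abs// X0 lexx.
  by rewrite lte_mul_pinfty// lee_fin powR_ge0.
move=> /(integrable_ae measurableT); apply: filterS => x /(_ I) Xfin k.
have E : maxX f x = (fine (maxX f x))%:E by rewrite fineK.
have bnd := tmax_bound f0 E.
apply: (@le_trans _ _ (tmax f `|k|%N (`|k| + `|k|) x)).
  have -> : k = (Posz `|k| - Posz (absz (Posz `|k| - k)))%R by lia.
  rewrite -(_ : `|k| = `|(Posz `|k| - Posz (absz (Posz `|k| - k)))%R|)%N; last by lia.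
  by apply: cexp_le_tmax; lia.
rewrite -lee_fin fineK; first by apply: ereal_sup_ubound; exists `|k|%N.
rewrite ge0_fin_numE.
  apply: (@le_lt_trans _ _ (fine (maxX f x) `^ p^-1)%:E); last exact: ltry.
  by apply: ge_ereal_sup => _ [N _ <-]; rewrite lee_fin.
apply: (@le_trans _ _ (tmax f 0 0 x)%:E); first by rewrite lee_fin tmax_ge0.
by apply: ereal_sup_ubound; exists 0%N.
Qed.

End lp.

End doob.

End maximal_function.

(** * Density of functions constant on cells *)

Import HBNNSimple.

Section density.
Context d (V : measurableType d) (R : realType) (mu : {measure set V -> \bar R}).
Variable F : dyadic_filtration mu.
Local Notation cell := (cell F).
Local Notation vol := (vol F).
Local Notation cexp := (cexp F).
Local Notation locint := (locint F).
Local Notation level := (level F).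

Lemma level_le T (i j : int) (h : V -> T) : i <= j -> level j h -> level i h.
Proof.
move=> ij lh; apply: (@levelW _ _ _ _ _ _ _ `|j - i|%N).
by rewrite (_ : i + `|j - i|%N = j)//; lia.
Qed.

Variables (Q : set V) (mQ : measurable Q) (Qfin : (mu Q < +oo)%E).
Implicit Types f g h : V -> R.
Local Open Scope ereal_scope.

Let dist f g := \int[mu]_(x in Q) (`|f x - g x|%R)%:E.

Let dist_triangle f g h : measurable_fun setT f -> measurable_fun setT g ->
  measurable_fun setT h -> dist f h <= dist f g + dist g h.
Proof.
move=> mf mg mh; rewrite -ge0_integralDr//; last 2 first.
- by apply: measurableT_comp => //; exact: measurable_funB.
- by apply: measurableT_comp => //; exact: measurable_funB.
by apply: le_ge0_integral => x _; rewrite lee_fin// ler_distD.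
Qed.

Definition level_approx f := measurable_fun setT f /\
  forall e : R, (0 < e)%R ->
  exists i h, level i h /\ \int[mu]_(x in Q) (`|f x - h x|%R)%:E <= e%:E.

Lemma level_approx_level i h : level i h -> level_approx h.
Proof.
move=> lh; split; first exact: measurable_level lh.
move=> e e0; exists i, h; split => //.
by rewrite integral0_eq ?lee_fin ?ltW// => x _; rewrite subrr normr0.
Qed.

(** Sum, difference and maximum are all 1-Lipschitz in this sense. Of the two generations of the
    approximants the finer one serves for both. *)
Lemma level_approx_lip2 (phi : R -> R -> R) f g :
  (forall a b a' b', `|phi a b - phi a' b'| <= `|a - a'| + `|b - b'|)%R ->
  measurable_fun setT (fun x => phi (f x) (g x)) ->
  level_approx f -> level_approx g -> level_approx (fun x => phi (f x) (g x)).
Proof.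
move=> phil mphi [mf af] [mg ag]; split => // e e0.
have e20 : (0 < e / 2)%R by rewrite divr_gt0.
have [i [u [lu fu]]] := af _ e20; have [j [v [lv gv]]] := ag _ e20.
exists (Order.min i j), (fun x => phi (u x) (v x)); split.
  move=> x y xy; rewrite (level_le _ lu xy) ?ge_min ?lexx//.
  by rewrite (level_le _ lv xy)// ge_min lexx orbT.
apply: (@le_trans _ _ (dist f u + dist g v)).
  rewrite -ge0_integralDr//; last 2 first.
  - by apply: measurableT_comp => //; apply: measurable_funB => //; exact: measurable_level lu.
  - by apply: measurableT_comp => //; apply: measurable_funB => //; exact: measurable_level lv.
  by apply: le_ge0_integral => x _; rewrite lee_fin.
by rewrite (splitr e) EFinD; exact: leeD.
Qed.

Lemma level_approxD f g : level_approx f -> level_approx g ->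
  level_approx (fun x => f x + g x)%R.
Proof.
move=> af ag; apply: (level_approx_lip2 (phi := +%R)) => //.
  by move=> a b a' b'; rewrite opprD addrACA ler_normD.
by apply: measurable_funD; [case: af|case: ag].
Qed.

Lemma level_approxB f g : level_approx f -> level_approx g ->
  level_approx (fun x => f x - g x)%R.
Proof.
move=> af ag; apply: (level_approx_lip2 (phi := fun a b => a - b)%R) => //.
  move=> a b a' b'; have -> : (a - b - (a' - b') = (a - a') - (b - b'))%R by ring.
  exact: ler_normB.
by apply: measurable_funB; [case: af|case: ag].
Qed.

Lemma level_approx_max f g : level_approx f -> level_approx g ->
  level_approx (fun x => Num.max (f x) (g x)).
Proof.
move=> af ag; apply: (level_approx_lip2 (phi := Num.max)) => //.
  move=> a b a' b'; rewrite /Num.max.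
  have := ler_norm (a - a')%R; have := ler_norm (b - b')%R.
  have := ler_norm (a' - a)%R; have := ler_norm (b' - b)%R.
  rewrite [`|b' - b|%R]distrC [`|a' - a|%R]distrC => ? ? ? ?.
  by rewrite ler_norml; case: ltP => ?; case: ltP => ?; apply/andP; split; lra.
by apply: measurable_maxr; [case: af|case: ag].
Qed.

Lemma level_approxZ f (c : R) : level_approx f -> level_approx (fun x => c * f x)%R.
Proof.
move=> [mf af]; split; first exact: measurable_funM.
move=> e e0; have e'0 : (0 < e / (`|c| + 1))%R by rewrite divr_gt0// ltr_wpDl.
have [i [u [lu fu]]] := af _ e'0; exists i, (fun x => c * u x)%R; split.
  by move=> x y xy; rewrite (lu _ _ xy).
apply: (@le_trans _ _ (`|c|%:E * dist f u)).
  rewrite -ge0_integralZr_EFin//.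
    by apply: le_ge0_integral => x _; rewrite lee_fin// -mulrBr normrM.
  by apply: measurableT_comp => //; apply: measurable_funB => //; exact: measurable_level lu.
apply: (le_trans (lee_wpmul2l _ fu)); first by rewrite lee_fin.
rewrite -EFinM lee_fin mulrCA; apply: ler_piMr; first exact: ltW.
by rewrite ler_pdivrMr ?mul1r ?lerDl// ltr_wpDl.
Qed.

Lemma level_approx_sum (I : Type) (s : seq I) (g : I -> V -> R) :
  (forall i, level_approx (g i)) -> level_approx (fun x => \sum_(i <- s) g i x)%R.
Proof.
move=> ag; elim: s => [|i s IHs].
  by under eq_fun do rewrite big_nil; exact: (@level_approx_level 0).
by under eq_fun do rewrite big_cons; exact: level_approxD.
Qed.

Lemma level_approx_lim f : measurable_fun setT f ->
  (forall e : R, (0 < e)%R -> exists g, level_approx g /\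
     \int[mu]_(x in Q) (`|f x - g x|%R)%:E <= e%:E) ->
  level_approx f.
Proof.
move=> mf lim; split => // e e0; have e20 : (0 < e / 2)%R by rewrite divr_gt0.
have [g [[mg ag] fg]] := lim _ e20; have [i [h [lh gh]]] := ag _ e20.
exists i, h; split => //.
apply: (le_trans (dist_triangle mf mg (measurable_level lh))).
by rewrite (splitr e) EFinD; exact: leeD.
Qed.

(** Dynkin's theorem: two cells are nested or disjoint, so the cells together with the empty set
    form a pi-system, and it generates the sigma-algebra by [cell_generate]. *)
Lemma level_approx_indic A : measurable A -> level_approx \1_A.
Proof.
set G := [set A | A = set0 \/ exists i x, A = cell i x].
have GE : @measurable _ V = <<s G >>.
  apply/seteqP; split => [B /(@cell_generate _ _ _ _ F)|].
    apply: sub_sigma_algebra2.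
    by move=> _ [[i x] _ <-]; right; exists i, x.
  apply: smallest_sub; first exact: sigma_algebra_measurable.
  by move=> _ [->|[i [x ->]]]//; exact: measurable_cell.
rewrite {1}GE; apply: (dynkin_induction (P := fun A => level_approx \1_A)) GE _ _ _ _ _ A.
- move=> _ _ [->|[i [x ->]]] [->|[j [y ->]]]; rewrite ?set0I ?setI0; try by left.
  have [//|] := eqVneq (cell i x `&` cell j y) set0; first by left.
  move=> /set0P[z [xz yz]]; right.
  rewrite -(cell_eq xz) -(cell_eq yz).
  wlog ij : i j {x y xz yz} / (i <= j)%R.
    move=> W; have [/W//|/ltW/W] := leP i j.
    by rewrite setIC.
  exists i, z; apply/setIidl.
  have := @cell_le _ _ _ _ F i z `|j - i|%N.
  by rewrite (_ : (i + `|j - i|%N)%R = j)//; lia.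
- by rewrite indicT; exact: (@level_approx_level 0).
- move=> _ [->|[i [x ->]]]; first by rewrite indic0; exact: (@level_approx_level 0).
  apply: (@level_approx_level i) => y z yz; rewrite !indicE.
  congr (nat_of_bool _)%:R; apply/idP/idP; rewrite !inE.
  + by move=> xz; rewrite -(cell_eq xz); exact: cell_sym.
  + by move=> xy; rewrite -(cell_eq xy).
- move=> S mS aS.
  rewrite (_ : \1_(~` S) = (fun x => cst 1 x - \1_S x)%R); last first.
    by apply/funext => x; rewrite !indicE in_setC; case: (x \in S); rewrite /= ?subrr ?subr0.
  by apply: level_approxB => //; exact: (@level_approx_level 0).
- move=> E mE tE aE; apply: level_approx_lim => [|e e0].
    exact/measurable_indic/bigcup_measurable.
  pose U n := \big[setU/set0]_(i < n) E i.
  have aU n : level_approx \1_(U n).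
    elim: n => [|n IHn].
      by rewrite /U big_ord0 indic0; exact: (@level_approx_level 0).
    rewrite (_ : \1_(U n.+1) = (fun x => Num.max (\1_(U n) x) (\1_(E n) x) : R)).
      exact: level_approx_max.
    apply/funext => x; rewrite /U big_ord_recr/= !indicE in_setU.
    by case: (_ \in _); case: (_ \in _); rewrite /= /Num.max ?ltxx ?ltr01// ltr10.
  (* The part of the union inside [Q] that the first [n] sets miss. It decreases to the empty set
     within a set of finite measure, so its measure, which bounds the error, tends to 0. *)
  pose W n := Q `&` (\bigcup_i E i `\` U n).
  have mU n : measurable (U n) by exact: bigsetU_measurable.
  have mbE : measurable (\bigcup_i E i) by exact: bigcup_measurable.
  have mW n : measurable (W n) by apply: measurableI => //; exact: measurableD.
  have W0 : \bigcap_n W n = set0.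
    apply/seteqP; split => // x xW; have [_ [[i _ Ei] _]] := xW 0%N I.
    have [_ [_]] := xW i.+1 I; apply; rewrite /U big_ord_recr/=; by right.
  have cvW : mu (W n) @[n --> \oo] --> 0.
    rewrite -(measure0 mu) -W0; apply: nonincreasing_cvg_mu => //.
    - rewrite (le_lt_trans _ Qfin)//; apply: le_measure; rewrite ?inE//.
      exact: subIsetl.
    - by rewrite W0.
    - apply/nonincreasing_seqP => n; apply/subsetPset => x [Qx [Ex nU]].
      split => //; split => // nU'; apply: nU.
      by rewrite /U big_ord_recr/=; left.
  have [n Wn] : exists n, mu (W n) <= e%:E.
    have /fine_cvgP[_ cv] := cvW.
    move/fine_cvgP : cvW => [/= finW /cvgrPdist_lt /(_ _ e0) small].
    have [n _ Hn] := filterI finW small.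
    have [fn] := Hn n (leqnn n); rewrite /= sub0r normrN => wn.
    exists n; rewrite -(fineK fn) lee_fin ltW//.
    by rewrite (le_lt_trans (ler_norm _)).
  exists \1_(U n); split => //; apply: le_trans Wn.
  rewrite -[mu (W n)]mul1e -integral_cst// [leRHS]integral_mkcondr.
  apply: le_ge0_integral => x _; first by rewrite lee_fin.
  rewrite /patch !indicE.
  have [xU|xU] := boolP (x \in U n).
    rewrite mem_set ?subrr ?normr0; last first.
      by move/set_mem : xU; rewrite /U -bigcup_mkord => -[i _ Ei]; exists i.
    by case: ifP => _; rewrite lee_fin.
  rewrite subr0 normr_nat in_setD xU andbT.
  by case: (x \in \bigcup_i E i).
Qed.

Lemma level_approx_ge0 f : measurable_fun setT f -> (forall x, 0 <= f x)%R ->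
  \int[mu]_(x in Q) (f x)%:E < +oo -> level_approx f.
Proof.
move=> mf f0 fi; apply: level_approx_lim => // e e0.
have mEf : measurable_fun setT (EFin \o f) by exact/measurable_EFinP.
pose u n := nnsfun_approx measurableT mEf n.
have cvu x : EFin \o u^~ x @ \oo --> (f x)%:E.
  by apply: (@cvg_nnsfun_approx _ _ _ _ measurableT _ mEf) => // y _; rewrite lee_fin.
have ui x : {homo (fun n => (u n x)%:E) : m n / (m <= n)%N >-> m <= n}.
  by move=> m n mn; rewrite lee_fin; exact/lefP/(nd_nnsfun_approx measurableT mEf).
have := @cvg_monotone_convergence _ _ _ mu Q mQ (fun n x => (u n x)%:E).
have mu_ n : measurable_fun Q (fun x => (u n x)%:E).
  by apply/measurable_EFinP; exact: measurable_funTS.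
move=> /(_ mu_) /(_ (fun n x _ => _)) /(_ (fun x _ => ui x)) cv.
have {}cv : \int[mu]_(x in Q) (u n x)%:E @[n --> \oo] --> \int[mu]_(x in Q) (f x)%:E.
  rewrite (_ : \int[mu]_(x in Q) (f x)%:E = \int[mu]_(x in Q) limn (fun n => (u n x)%:E)).
    by apply: cv => n x; rewrite lee_fin.
  by apply: eq_integral => x _; apply/esym/cvg_lim => //; exact: cvu.
have ule n x : (u n x <= f x)%R.
  rewrite -lee_fin -(cvg_lim _ (cvu x))//.
  by rewrite (cvg_lim _ (ereal_nondecreasing_cvgn (ui x)))//; apply: ereal_sup_ubound; exists n.
have fin : \int[mu]_(x in Q) (f x)%:E \is a fin_num.
  by rewrite ge0_fin_numE// integral_ge0// => x _; rewrite lee_fin.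
have [n un] : exists n, \int[mu]_(x in Q) (f x)%:E <= \int[mu]_(x in Q) (u n x)%:E + e%:E.
  move: cv; rewrite -(fineK fin) => /fine_cvgP[finW /cvgrPdist_lt /(_ _ e0) small].
  have [n _ Hn] := filterI finW small.
  have [fn] := Hn n (leqnn n); rewrite /= => wn; exists n.
  rewrite -(fineK fn) -EFinD lee_fin -lerBlDl ltW//.
  by rewrite (le_lt_trans (ler_norm _)).
exists (u n); split.
  rewrite (_ : (u n : V -> R) = (fun x => \sum_(y <- finmap.enum_fset (fset_set (range (u n))))
      y * \1_(u n @^-1` [set y]) x)%R); last first.
    by apply/funext => x; rewrite [LHS]fimfunE fsbig_finite.
  apply: level_approx_sum => y; apply: level_approxZ; apply: level_approx_indic.
  by rewrite -[X in measurable X]setTI; exact: measurable_funP.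
have fE : \int[mu]_(x in Q) (f x)%:E =
    \int[mu]_(x in Q) (u n x)%:E + \int[mu]_(x in Q) (`|f x - u n x|)%:E.
  rewrite -ge0_integralDr//; last by apply: measurableT_comp => //; exact: measurable_funB.
  by apply: eq_integral => x _; rewrite ger0_norm ?subr_ge0// addrCA subrr addr0.
move: un; rewrite fE leeD2lE//.
rewrite ge0_fin_numE.
  rewrite (le_lt_trans _ fi)//.
  by apply: le_ge0_integral => x _; rewrite lee_fin.
by apply: integral_ge0 => x _; rewrite lee_fin.
Qed.

Lemma level_approx_integrable f : measurable_fun setT f ->
  mu.-integrable Q (EFin \o f) -> level_approx f.
Proof.
move=> mf fi.
rewrite (_ : f = fun x => Num.max (f x) 0 - Num.max (- f x) 0)%R; last first.
  by apply/funext => x; rewrite /Num.max; case: ltP => ?; case: ltP => ?; lra.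
have [_ absfi] := integrableP _ _ _ fi.
have le (a : R) : (`|Num.max a 0| <= `|a|)%R.
  by rewrite /Num.max; case: ifP => _; rewrite ?normr0.
apply: level_approxB; apply: level_approx_ge0.
- exact: measurable_maxr.
- by move=> x; rewrite le_max lexx orbT.
- apply: le_lt_trans absfi; apply: le_ge0_integral => x _; rewrite lee_fin.
    by rewrite le_max lexx orbT.
  by rewrite (le_trans (ler_norm _)).
- by apply: measurable_maxr => //; exact: measurableT_comp.
- by move=> x; rewrite le_max lexx orbT.
- apply: le_lt_trans absfi; apply: le_ge0_integral => x _; rewrite lee_fin.
    by rewrite le_max lexx orbT.
  by rewrite (le_trans (ler_norm _))// (le_trans (le _))// normrN.
Qed.

End density.

Section cexp_density.
Context d (V : measurableType d) (R : realType) (mu : {measure set V -> \bar R}).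
Variable F : dyadic_filtration mu.
Local Notation cell := (cell F).
Local Notation vol := (vol F).
Local Notation cexp := (cexp F).
Local Notation locint := (locint F).
Local Open Scope ereal_scope.

(** An [L^1] substitute for almost everywhere convergence of averages: [f] is close to some [h]
    constant on small cells, and averaging over these cells is an [L^1] contraction fixing [h]. This
    costs the error twice, hence e / 2. *)
Lemma cexp_dense (f : V -> R) k x (e : R) : locint f -> (0 < e)%R ->
  exists j : nat,
    \int[mu]_(y in cell k x) (`|f y - cexp (k - j%:Z) f y|%R)%:E <= e%:E.
Proof.
move=> lf e0; have [mf fi] := lf.
have mQ := measurable_cell F k x.
have Qfin : mu (cell k x) < +oo by rewrite mu_cell ltry.
have e20 : (0 < e / 2)%R by rewrite divr_gt0.
have [_ /(_ _ e20)[i [h [lh fh]]]] := level_approx_integrable F mQ Qfin mf (fi k x).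
(* The generation of the approximant is lowered to at most [k], so that its cells partition the
   given cell. *)
pose j := `|k - Order.min i k|%N.
have jE : (k - j%:Z = Order.min i k)%R.
  have : (Order.min i k <= k)%R by rewrite ge_min lexx orbT.
  by rewrite /j; lia.
have {}lh : level F (k - j%:Z) h by apply: level_le lh; rewrite jE ge_min lexx.
exists j; have mh := measurable_level lh.
have mE := measurable_cexp F (k - j%:Z) f.
apply: (@le_trans _ _ (\int[mu]_(y in cell k x) (`|f y - h y| + `|h y - cexp (k - j%:Z) f y|)%:E)).
  by apply: le_ge0_integral => y _; rewrite lee_fin// ler_distD.
rewrite ge0_integralDr//; last 2 first.
- by apply: measurableT_comp => //; exact: measurable_funB.
- by apply: measurableT_comp => //; exact: measurable_funB.
rewrite (splitr e) EFinD; apply: leeD => //; apply: le_trans fh.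
apply: (le_integral_cells (F := F) (k := (k - j%:Z)%R)) => //.
- have := @saturated_cell _ _ _ _ F (k - j%:Z)%R j x.
  by rewrite subrK.
- by apply/measurable_EFinP/measurableT_comp => //; exact: measurable_funB.
- by apply/measurable_EFinP/measurableT_comp => //; exact: measurable_funB.
move=> y _; set k' := (k - j%:Z)%R.
have mc := measurable_cell F k' y.
rewrite (eq_integral (cst (`|h y - cexp k' f y|)%:E)); last first.
  by move=> z /set_mem yz; rewrite (lh _ _ yz) (cexp_level f yz).
rewrite integral_cst// mu_cell -EFinM.
have lhf : locint (fun z => h y - f z)%R by apply: locintB => //; exact: locint_cst.
rewrite (_ : (`|h y - cexp k' f y|)%R = `|cexp k' (fun z => h y - f z) y|%R); last first.
  have -> := @cexpB _ _ _ _ F k' (cst (h y)) f y (locint_cst F (h y)) lf.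
  have -> // : cexp k' (cst (h y)) y = h y by exact: cexp_cst_on.
have := cexp_norm k' y lhf.
rewrite -(ler_pM2l (vol_gt0 F k')) -lee_fin -integral_cexp; last exact: locint_norm.
rewrite mulrC => /le_trans; apply.
apply: le_ge0_integral => z yz; rewrite lee_fin//.
by rewrite (lh _ _ yz) distrC.
Qed.

End cexp_density.

(** * Mean oscillation against a weight *)

Section oscillation.
Context d (V : measurableType d) (R : realType) (mu : {measure set V -> \bar R}).
Variable F : dyadic_filtration mu.
Local Notation cell := (cell F).
Local Notation vol := (vol F).
Local Notation rho := (ratio F).
Local Notation cexp := (cexp F).
Local Notation locint := (locint F).
Local Notation level := (level F).
Local Open Scope ereal_scope.

Definition osc_le (b : V -> R) (beta : R) := forall k x,
  \int[mu]_(y in cell k x) (`|b y - cexp k b x|%R)%:E <= (beta * vol k)%:E.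

Variables (b : V -> R) (beta : R).
Hypotheses (lb : locint b) (beta0 : (0 < beta)%R) (oscb : osc_le b beta).

Let mb : measurable_fun setT b. Proof. by have [] := lb. Qed.
Let rho0 : (0 < rho)%R. Proof. exact: lt_trans (ratio_gt1 F). Qed.

(** The child carries the fraction 1/rho of the measure of its parent, so passing from a mean over
    the parent to one over the child costs a factor rho. *)
Lemma cexp_step k x y : cell (k + 1) x y ->
  (`|cexp k b y - cexp (k + 1) b x| <= rho * beta)%R.
Proof.
move=> xy; set c := cexp (k + 1) b x.
have lbc : locint (fun z => b z - c)%R by apply: locintB => //; exact: locint_cst.
have -> : (cexp k b y - c = cexp k (fun z => b z - c) y)%R.
  have -> := @cexpB _ _ _ _ F k b (cst c) y lb (locint_cst F c).
  by have -> : cexp k (cst c) y = c by exact: cexp_cst_on.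
apply: (le_trans (cexp_norm k y lbc)).
rewrite -(ler_pM2l (vol_gt0 F k)) -lee_fin -integral_cexp; last exact: locint_norm.
apply: (@le_trans _ _ (\int[mu]_(z in cell (k + 1) y) (`|b z - c|%R)%:E)).
  apply: ge0_subset_integral => //; try exact: measurable_cell.
    apply/measurable_EFinP/measurable_funTS/measurableT_comp => //.
    exact: measurable_funB.
  exact: cellS.
by rewrite (cell_eq xy) (le_trans (oscb _ _))// lee_fin volS mulrA mulrC [(beta * _)%R]mulrC.
Qed.

Variables (g m : V -> R).
Hypotheses (g0 : forall x, (0 <= g x)%R) (lg : locint g).
Hypotheses (m0 : forall x, (0 <= m x)%R) (mm : measurable_fun setT m).
Hypothesis gm : {ae mu, forall x, forall k, (cexp k g x <= m x)%R}.

Let mg : measurable_fun setT g. Proof. by have [] := lg. Qed.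

Local Notation lam := (2 * beta)%R.
Local Notation phi := (2 + rho)%R.

Let phi0 : (0 < phi)%R. Proof. by rewrite addr_gt0. Qed.

Section fixed_base.
Variable k0 : int.
Let b0 := cexp k0 b.
Let mb0 : measurable_fun setT b0. Proof. exact: measurable_cexp. Qed.

Let E (N : nat) (c : R) : set V :=
  [set x | exists2 i : nat, (i < N)%N & (lam < `|cexp (k0 + i%:Z) b x - c|)%R].

Let satE N c : saturated F k0 (E N c).
Proof.
move=> x [i iN xE] y xy; exists i => //.
by rewrite (levelW (@cexp_level _ _ _ _ F (k0 + i%:Z) b) xy).
Qed.

Let mE N c : measurable (E N c).
Proof. by apply: measurable_saturated; exact: satE. Qed.

Let ES N c x y : (`|cexp (k0 + N%:Z) b x - c| <= lam)%R -> cell (k0 + N%:Z) x y ->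
  \1_(E N.+1 c) y = \1_(E N c) y :> R.
Proof.
move=> le xy; rewrite !indicE; congr (nat_of_bool _)%:R.
apply/idP/idP; rewrite !inE => -[i iN yE]; exists i => //.
  move: iN; rewrite ltnS leq_eqVlt => /predU1P[iN|//].
  by move: yE; rewrite iN (cexp_level b xy) ltNge le.
exact: ltnW.
Qed.

Let EST N c x y : (lam < `|cexp (k0 + N%:Z) b x - c|)%R -> cell (k0 + N%:Z) x y ->
  \1_(E N.+1 c) y = 1%R :> R.
Proof.
move=> lt xy; rewrite indicE mem_set//; exists N => //.
by rewrite (cexp_level b xy).
Qed.

(* [E N c] is where the averages of [b], read downwards from generation
   [k0 + N - 1], leave the [lam]-ball around [c]. By [stop_mass] it fills at most
   half of a cell whose average is [c]. Hence the term [phi * beta * g] of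
   [stop_bound] can be charged to [m] off [E N c], whereas [m] on [E N c] pays
   for the stopped cells, to which [full_bound] is applied recursively. *)
Let stop_mass N := forall x c, (`|cexp (k0 + N%:Z) b x - c| <= lam)%R ->
  \int[mu]_(y in cell (k0 + N%:Z) x) (lam * \1_(E N c) y)%:E <=
  \int[mu]_(y in cell (k0 + N%:Z) x) (`|b y - c|%R)%:E.

Let stop_bound N := forall x c, (`|cexp (k0 + N%:Z) b x - c| <= lam)%R ->
  \int[mu]_(y in cell (k0 + N%:Z) x) (`|b0 y - c| * g y)%:E <=
  \int[mu]_(y in cell (k0 + N%:Z) x)
     (phi * beta * g y + 2 * (phi * beta) * (m y * \1_(E N c) y))%:E.

Let full_bound N := forall x,
  \int[mu]_(y in cell (k0 + N%:Z) x) (`|b0 y - cexp (k0 + N%:Z) b x| * g y)%:E <=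
  \int[mu]_(y in cell (k0 + N%:Z) x) (2 * (phi * beta) * m y)%:E.

Let pb0 : (0 < phi * beta)%R. Proof. exact: mulr_gt0. Qed.
Let pb20 : (0 < 2 * (phi * beta))%R. Proof. by rewrite mulr_gt0. Qed.
Let lam0 : (0 < lam)%R. Proof. by rewrite mulr_gt0. Qed.

Let mnorm c : measurable_fun setT (fun y => `|b y - c|)%R.
Proof. by apply: measurableT_comp => //; exact: measurable_funB. Qed.

Let mnorm0g c : measurable_fun setT (fun y => `|b0 y - c| * g y)%R.
Proof.
apply: measurable_funM => //; apply: measurableT_comp => //.
exact: measurable_funB.
Qed.

(** Chebyshev's inequality on stopped cells: the average of [b] over such a cell is further than
    [lam] from [c], so |b - c| has mass at least [lam] times its measure there. On the other
    children the induction hypothesis applies. *)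
Lemma stop_mass_rec N : stop_mass N.
Proof.
elim: N => [|N IHN] x c le.
  apply: le_ge0_integral => y _; first by rewrite lee_fin mulr_ge0// ltW.
  rewrite lee_fin indicE memNset ?mulr0//.
  by case.
apply: (le_integral_cells (F := F) (k := (k0 + N%:Z)%R)).
- have := @saturated_cell _ _ _ _ F (k0 + N%:Z)%R 1%N x.
  by rewrite -addrA -PoszD addn1.
- by apply/measurable_EFinP; exact: measurable_funM.
- exact/measurable_EFinP.
- by move=> y; rewrite lee_fin mulr_ge0// ltW.
- by move=> y; rewrite lee_fin.
move=> y _; have [yc|yc] := leP `|cexp (k0 + N%:Z) b y - c|%R lam.
  apply: le_trans (IHN y c yc); apply: le_ge0_integral => z yz.
    by rewrite lee_fin mulr_ge0// ltW.
  by rewrite lee_fin (ES yc yz).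
apply: (@le_trans _ _ (\int[mu]_(z in cell (k0 + N%:Z) y) (cst lam%:E) z)).
  apply: le_ge0_integral => z yz; first by rewrite lee_fin mulr_ge0// ltW.
  by rewrite lee_fin (EST yc yz) mulr1.
have lbc : locint (fun z => b z - c)%R by apply: locintB => //; exact: locint_cst.
rewrite integral_cst; last exact: measurable_cell.
rewrite mu_cell -EFinM integral_cexp; last exact: locint_norm.
rewrite lee_fin mulrC ler_pM2l ?vol_gt0//.
apply: le_trans (cexp_norm _ y lbc); apply: ltW; apply: (lt_le_trans yc).
have -> := @cexpB _ _ _ _ F (k0 + N%:Z)%R b (cst c) y lb (locint_cst F c).
by have -> : cexp (k0 + N%:Z) (cst c) y = c by exact: cexp_cst_on.
Qed.

Lemma full_of_stop N : stop_bound N -> full_bound N.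
Proof.
move=> sb x; set k := (k0 + N%:Z)%R; set c := cexp k b x.
have mc := measurable_cell F k x.
have cc : (`|c - c| <= lam)%R by rewrite subrr normr0 ltW.
apply: (le_trans (sb x c cc)); rewrite -/k.
have mEc : measurable (~` E N c) by exact: measurableC.
have mgE : measurable_fun setT (fun y => m y * \1_(E N c) y)%R by exact: measurable_funM.
have mgEC : measurable_fun setT (fun y => m y * \1_(~` E N c) y)%R.
  by apply: measurable_funM => //; exact: measurable_indic.
have split1 y : (\1_(E N c) y + \1_(~` E N c) y = 1 :> R)%R.
  by rewrite !indicE in_setC; case: (_ \in _); rewrite /= ?addr0 ?add0r.
have -> : \int[mu]_(y in cell k x) (2 * (phi * beta) * m y)%:E =
    \int[mu]_(y in cell k x) (2 * (phi * beta) * (m y * \1_(~` E N c) y)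
      + 2 * (phi * beta) * (m y * \1_(E N c) y))%:E.
  by apply: eq_integral => y _; rewrite -mulrDr -mulrDr [(\1_(~` _) y + _)%R]addrC split1 mulr1.
rewrite !ge0_integralDr//; try (by apply: measurable_funM);
  try by move=> y; rewrite !mulr_ge0// ltW.
apply: leeD2r.
have mass : \int[mu]_(y in cell k x) (lam * \1_(E N c) y)%:E <= (beta * vol k)%:E.
  exact: (le_trans (stop_mass_rec cc)).
(* The choice of [lam] as twice [beta] is made for this: the stopped set has measure at most beta
   vol / (2 beta) = vol / 2. *)
have half : (vol k / 2)%:E <= \int[mu]_(y in cell k x) (\1_(~` E N c) y)%:E.
  have : \int[mu]_(y in cell k x) (\1_(E N c) y + \1_(~` E N c) y)%:E = (vol k)%:E.
    rewrite (eq_integral (cst 1)); last by move=> y _; rewrite split1.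
    by rewrite integral_cst// mul1e; exact: mu_cell.
  rewrite ge0_integralDr//.
  move: mass; rewrite ge0_integralZr_EFin//; last exact: ltW.
  have : 0 <= \int[mu]_(y in cell k x) (\1_(E N c) y)%:E.
    by apply: integral_ge0 => y _; rewrite lee_fin.
  have : 0 <= \int[mu]_(y in cell k x) (\1_(~` E N c) y)%:E.
    by apply: integral_ge0 => y _; rewrite lee_fin.
  case: (\int[mu]_(y in cell k x) (\1_(E N c) y)%:E) => [u| |]//;
    case: (\int[mu]_(y in cell k x) (\1_(~` E N c) y)%:E) => [v| |]//.
  rewrite -EFinM -EFinD !lee_fin => v0 u0 uv [uvk].
  have : (u <= vol k / 2)%R.
    by rewrite -(ler_pM2l beta0); lra.
  by move: uvk; lra.
rewrite !ge0_integralZr_EFin//; try (by move=> y; rewrite mulr_ge0); try exact: ltW.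
rewrite integral_cexp//.
(* The mass of [g] is its average times vol, hence at most twice its average times the measure of
   the unstopped part, where [m] dominates that average almost everywhere. This is the origin of the
   factor 2. *)
apply: (@le_trans _ _ ((2 * (phi * beta))%:E *
    ((cexp k g x)%:E * \int[mu]_(y in cell k x) (\1_(~` E N c) y)%:E))).
  have gx0 : (0 <= cexp k g x)%R by exact: cexp_ge0.
  apply: (@le_trans _ _ ((2 * (phi * beta))%:E * ((cexp k g x)%:E * (vol k / 2)%:E))).
    by rewrite -!EFinM lee_fin le_eqVlt; apply/orP; left; apply/eqP; field.
  apply: lee_wpmul2l; first by rewrite lee_fin ltW.
  by apply: lee_wpmul2l => //; rewrite lee_fin.
apply: lee_wpmul2l; first by rewrite lee_fin ltW.
rewrite -ge0_integralZr_EFin//; last exact: cexp_ge0.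
apply: ae_ge0_le_integral => //.
- by move=> y _; rewrite lee_fin mulr_ge0// cexp_ge0.
- apply/measurable_EFinP/measurable_funTS.
  by apply: measurable_funM => //; exact: measurable_indic.
- by move=> y _; rewrite lee_fin mulr_ge0.
- exact/measurable_EFinP/measurable_funTS.
apply: filterS gm => y /(_ k) gmy xy; rewrite lee_fin.
by rewrite ler_wpM2r// -(cexp_level g xy).
Qed.

Lemma stop_bound_rec N : stop_bound N.
Proof.
elim: N => [|N IHN] x c le.
  apply: le_ge0_integral => y xy; first by rewrite lee_fin mulr_ge0.
  rewrite lee_fin indicE memNset; last by case.
  rewrite !mulr0 addr0 ler_wpM2r// /b0 -[k0](addr0 k0) (cexp_level b xy).
  rewrite (le_trans le)// ler_wpM2r ?lerDl// ltW//.
apply: (le_integral_cells (F := F) (k := (k0 + N%:Z)%R)).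
- have := @saturated_cell _ _ _ _ F (k0 + N%:Z)%R 1%N x.
  by rewrite -addrA -PoszD addn1.
- exact/measurable_EFinP.
- by apply/measurable_EFinP/measurable_funD; apply: measurable_funM => //; exact: measurable_funM.
- by move=> y; rewrite lee_fin mulr_ge0.
- by move=> y; rewrite lee_fin addr_ge0// !mulr_ge0// ltW.
move=> y xy; have [yc|yc] := leP `|cexp (k0 + N%:Z) b y - c|%R lam.
  apply: (le_trans (IHN y c yc)); apply: le_ge0_integral => z yz.
    by rewrite lee_fin addr_ge0// !mulr_ge0// ltW.
  by rewrite lee_fin (ES yc yz).
(* The parent's average is within [lam] = 2 beta of [c], and one step down adds at most rho beta;
   hence phi = 2 + rho. *)
have cy : (`|cexp (k0 + N%:Z) b y - c| <= phi * beta)%R.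
  rewrite (le_trans (ler_distD (cexp (k0 + N.+1%:Z) b x) _ _))//.
  rewrite mulrDl addrC lerD//.
  have -> : (k0 + N.+1%:Z = k0 + N%:Z + 1)%R by lia.
  by apply: cexp_step; move: xy; rewrite -addrA -PoszD addn1.
(* On a stopped child the oscillation is recentred at the child's own average. The change of centre
   costs [phi * beta * g], and the recentred integral is the full bound one generation lower. *)
apply: (@le_trans _ _ (\int[mu]_(z in cell (k0 + N%:Z) y)
   (`|b0 z - cexp (k0 + N%:Z) b y| * g z + phi * beta * g z)%:E)).
  apply: le_ge0_integral => z yz; first by rewrite lee_fin mulr_ge0.
  rewrite lee_fin -mulrDl ler_wpM2r//.
  by rewrite (le_trans (ler_distD (cexp (k0 + N%:Z) b y) _ _))// lerD2l.
have mc := measurable_cell F (k0 + N%:Z)%R y.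
rewrite ge0_integralDr//; last 3 first.
- exact: measurable_funM.
- by move=> z; rewrite mulr_ge0.
- by move=> z; rewrite mulr_ge0// ltW.
apply: (le_trans (leeD2r _ (full_of_stop IHN y))).
rewrite -ge0_integralDr//; last 4 first.
- exact: measurable_funM.
- exact: measurable_funM.
- by move=> z; rewrite !mulr_ge0// ltW.
- by move=> z; rewrite !mulr_ge0// ltW.
apply: le_ge0_integral => z yz.
  by rewrite lee_fin addr_ge0// !mulr_ge0// ltW.
by rewrite lee_fin (EST yc yz) mulr1 addrC.
Qed.

Lemma osc_base_mul_integral N x :
  \int[mu]_(y in cell (k0 + N%:Z) x) (`|b0 y - cexp (k0 + N%:Z) b x| * g y)%:E <=
  \int[mu]_(y in cell (k0 + N%:Z) x) (2 * (phi * beta) * m y)%:E.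
Proof. by apply: full_of_stop; exact: stop_bound_rec. Qed.

End fixed_base.

(** The averages over small cells approximate [b] in [L^1] only; the bound [L] on [g] is what allows
    this error to be multiplied by [g]. It disappears from the conclusion in the limit. *)
Lemma osc_mul_integral_bounded (L : R) k x : (forall y, g y <= L)%R ->
  \int[mu]_(y in cell k x) (`|b y - cexp k b x| * g y)%:E <=
  (2 * (phi * beta))%:E * \int[mu]_(y in cell k x) (m y)%:E.
Proof.
move=> gL; have mc := measurable_cell F k x.
have L0 : (0 <= L)%R by exact: le_trans (gL x).
apply/lee_addgt0Pr => e e0.
have e'0 : (0 < e / (L + 1))%R by rewrite divr_gt0// ltr_wpDl.
have [j je] := cexp_dense k x lb e'0.
have mbj : measurable_fun setT (fun y => `|b y - cexp (k - j%:Z) b y|)%R.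
  by apply: measurableT_comp => //; apply: measurable_funB => //; exact: measurable_cexp.
have := osc_base_mul_integral (k - j%:Z)%R j x.
rewrite subrK ge0_integralZr_EFin//; last by rewrite ltW// !mulr_gt0.
move=> bnd; apply: (@le_trans _ _ (\int[mu]_(y in cell k x)
    (`|cexp (k - j%:Z) b y - cexp k b x| * g y
     + L * `|b y - cexp (k - j%:Z) b y|)%:E)).
  apply: le_ge0_integral => y _; first by rewrite lee_fin mulr_ge0.
  rewrite lee_fin; apply: (@le_trans _ _
    ((`|cexp (k - j%:Z) b y - cexp k b x| + `|b y - cexp (k - j%:Z) b y|) * g y)%R).
    apply: ler_wpM2r => //.
    by apply: (le_trans (ler_distD (cexp (k - j%:Z) b y) _ _)); rewrite addrC.
  by rewrite mulrDl lerD2l mulrC ler_wpM2r.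
rewrite ge0_integralDr//; last 4 first.
- apply: measurable_funM => //; apply: measurableT_comp => //.
  by apply: measurable_funB => //; exact: measurable_cexp.
- exact: measurable_funM.
- by move=> y; rewrite mulr_ge0.
- by move=> y; rewrite mulr_ge0.
apply: leeD => //; rewrite ge0_integralZr_EFin//.
apply: (le_trans (lee_wpmul2l _ je)); first by rewrite lee_fin.
rewrite -EFinM lee_fin mulrCA; apply: ler_piMr; first exact: ltW.
by rewrite ler_pdivrMr ?mul1r ?lerDl// ltr_wpDl.
Qed.

End oscillation.

Section oscillation_mul.
Context d (V : measurableType d) (R : realType) (mu : {measure set V -> \bar R}).
Variable F : dyadic_filtration mu.
Local Open Scope ereal_scope.

(** Truncating [g] at height n lowers its averages, so the same [m] serves all truncations and
    monotone convergence removes the bound on [g]. *)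
Lemma osc_mul_integral (b : V -> R) (beta : R) (g m : V -> R) k x :
  locint F b -> (0 < beta)%R -> osc_le F b beta ->
  (forall x, 0 <= g x)%R -> locint F g ->
  (forall x, 0 <= m x)%R -> measurable_fun setT m ->
  {ae mu, forall x, forall k, (cexp F k g x <= m x)%R} ->
  \int[mu]_(y in cell F k x) (`|b y - cexp F k b x| * g y)%:E <=
  (2 * ((2 + ratio F) * beta))%:E * \int[mu]_(y in cell F k x) (m y)%:E.
Proof.
move=> lb beta0 oscb g0 lg m0 mm gm; have [mg _] := lg; have [mb _] := lb.
have mc := measurable_cell F k x.
have mbc c : measurable_fun setT (fun y => `|b y - c|)%R.
  by apply: measurableT_comp => //; exact: measurable_funB.
pose u n y := Num.min (g y) n%:R.
have u0 n y : (0 <= u n y)%R by rewrite le_min g0/=.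
have mu_ n : measurable_fun setT (u n) by exact: measurable_minr.
have ug n y : (u n y <= g y)%R by rewrite ge_min lexx.
have lu n : locint F (u n).
  by apply: (locint_le _ lg) => // y; rewrite ger0_norm.
apply: (integral_ereal_sup_le
  (u := fun n y => (`|b y - cexp F k b x| * u n y)%:E)) => //.
- by move=> n; apply/measurable_EFinP; exact: measurable_funM.
- by move=> n y; rewrite lee_fin mulr_ge0.
- move=> y i j ij; rewrite lee_fin ler_wpM2l// /u le_min !ge_min lexx/=.
  by rewrite ler_nat ij orbT.
- move=> n; have um : {ae mu, forall x, forall k, (cexp F k (u n) x <= m x)%R}.
    apply: filterS gm => y gmy i; apply: le_trans (gmy i).
    by apply: le_cexp => // z _; exact: ug.
  apply: (osc_mul_integral_bounded lb beta0 oscb (u0 n) (lu n) m0 mm um) => y.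
  by rewrite /u ge_min; apply/orP; right; exact: lexx.
move=> y _; apply/andP; split; first by rewrite lee_fin mulr_ge0.
have [n gn] : exists n : nat, (g y <= n%:R)%R.
  by exists (Num.truncn (g y)).+1; rewrite ltW// truncnS_gt.
apply: ereal_sup_ubound; exists n => //.
by rewrite /u min_l.
Qed.

End oscillation_mul.

(** * Hedberg estimates *)

Section geometric.
Variable R : realType.

(* Telescoping: [min x_j 1] increases by [x_j (1 - 1/r1)] while [x_j <= 1], and
   [min y_j 1] decreases by [y_j (1 - 1/r2)] once [y_j <= 1]. *)
Lemma sum_two_sided_geometric (r1 r2 : R) (x y t : nat -> R) (J : nat) :
  1 < r1 -> 1 < r2 ->
  (forall j, 0 < x j) -> (forall j, 0 < y j) ->
  (forall j, x j.+1 = r1 * x j) -> (forall j, y j = r2 * y j.+1) ->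
  (forall j, t j <= x j) -> (forall j, t j <= y j) ->
  (forall j, x j <= 1 \/ y j <= 1) ->
  \sum_(j < J) t j <= r1 / (r1 - 1) + r2 / (r2 - 1).
Proof.
move=> r11 r21 x0 y0 xS yS tx ty xy1.
have r10 : 0 < r1 by exact: lt_trans r11.
have r20 : 0 < r2 by exact: lt_trans r21.
set K1 := r1 / _; set K2 := r2 / _.
have K10 : 0 < K1 by rewrite divr_gt0// subr_gt0.
have K20 : 0 < K2 by rewrite divr_gt0// subr_gt0.
suff : \sum_(j < J) t j <=
    K1 * Num.min (x J / r1) 1 + K2 * (1 - Num.min (y J) 1).
  have m1 : Num.min (x J / r1) 1 <= 1 by rewrite ge_min lexx orbT.
  have m2 : 0 < Num.min (y J) 1 by rewrite lt_min y0 ltr01.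
  by move=> /le_trans; apply; apply: lerD;
    rewrite ger_pMr// lerBlDr lerDl ltW.
elim: J => [|J IHJ].
  rewrite big_ord0 addr_ge0// mulr_ge0 ?(ltW K10) ?(ltW K20)//.
    by rewrite le_min ler01 andbT divr_ge0// ltW.
  by rewrite subr_ge0 ge_min lexx orbT.
rewrite big_ord_recr/= xS.
have -> : r1 * x J / r1 = x J by rewrite mulrAC divff ?mul1r// gt_eqF.
apply: (le_trans (lerD IHJ (lexx _))).
have K1E : K1 * (r1 - 1) = r1 by rewrite divfK// gt_eqF// subr_gt0.
have K2E : K2 * (r2 - 1) = r2 by rewrite divfK// gt_eqF// subr_gt0.
have := tx J; have := ty J; have := x0 J; have := y0 J; have := y0 J.+1.
set X := x J; rewrite (yS J); set Y := y J.+1 => Y0 rY0 X0 tY tX.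
have XrX : X * r1^-1 <= X by rewrite ler_piMr ?(ltW X0)// invf_le1// ltW.
have YrY : Y <= r2 * Y by rewrite ler_peMl// ltW.
have dX : K1 * X - K1 * (X * r1^-1) = X.
  rewrite -mulrBr (_ : X - X * r1^-1 = (r1 - 1) * (X * r1^-1)).
    by rewrite [LHS]mulrA K1E mulrCA mulfV ?mulr1// gt_eqF.
  by rewrite mulrBl mul1r mulrCA mulfV ?mulr1// gt_eqF.
have dY : K2 * (r2 * Y) - K2 * Y = r2 * Y.
  by rewrite -mulrBr -{2}[Y]mul1r -mulrBl mulrA K2E.
have minY : Num.min Y 1 <= Num.min (r2 * Y) 1.
  by rewrite le_min !ge_min lexx YrY orbT.
have minX : Num.min (X * r1^-1) 1 <= Num.min X 1.
  by rewrite le_min !ge_min lexx XrX orbT.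
have := xy1 J; rewrite (yS J) -/X -/Y => -[X1|Y1].
  rewrite !(min_l X1) (min_l (le_trans XrX X1)).
  have : K2 * Num.min Y 1 <= K2 * Num.min (r2 * Y) 1 by rewrite ler_pM2l.
  by rewrite !mulrBr; lra.
rewrite (min_l Y1) (min_l (le_trans YrY Y1)).
have : K1 * Num.min (X * r1^-1) 1 <= K1 * Num.min X 1 by rewrite ler_pM2l.
by rewrite !mulrBr; lra.
Qed.

End geometric.

Section hedberg.
Context d (V : measurableType d) (R : realType) (mu : {measure set V -> \bar R}).
Variable F : dyadic_filtration mu.
Local Notation cell := (cell F).
Local Notation vol := (vol F).
Local Notation rho := (ratio F).
Local Notation cexp := (cexp F).
Local Notation locint := (locint F).

Lemma vol_shift k (j : nat) (r : R) :
  vol (k + j.+1%:Z) `^ r = rho `^ r * vol (k + j%:Z) `^ r.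
Proof.
have -> : k + j.+1%:Z = k + j%:Z + 1 by lia.
by rewrite volS powRM ?(ltW (vol_gt0 _ _))// ltW// (lt_trans _ (ratio_gt1 F)).
Qed.

Lemma powR_le1Dr (t p : R) : 1 <= p -> 0 <= t -> t <= 1 + t `^ p.
Proof.
move=> p1 t0; have [t1|t1] := leP t 1.
  by rewrite (le_trans t1)// lerDl powR_ge0.
by rewrite (le_trans (le1r_powR (ltW t1) p1))// lerDr.
Qed.

Lemma locint_powR (f : V -> R) (p C : R) : 1 <= p -> measurable_fun setT f ->
  (forall x, 0 <= f x) -> (\int[mu]_x (f x `^ p)%:E <= C%:E)%E -> locint f.
Proof.
move=> p1 mf f0 fC; apply: locint_ge0P => // k x.
have mc := measurable_cell F k x.
have mfp : measurable_fun setT (fun x => f x `^ p).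
  exact: (measurableT_comp (measurable_powR p)).
apply: (@le_lt_trans _ _ (\int[mu]_(y in cell k x) (1 + f y `^ p)%:E)%E).
  by apply: le_ge0_integral => y _; rewrite lee_fin ?powR_le1Dr.
rewrite ge0_integralDr//; last by move=> y; exact: powR_ge0.
rewrite integral_cst// mul1e lte_add_pinfty//; first by rewrite [X in (X < _)%E]mu_cell ltry.
apply: (le_lt_trans _ (ltry C)); apply: le_trans fC.
apply: ge0_subset_integral => //; first exact/measurable_EFinP.
by move=> y _; rewrite lee_fin powR_ge0.
Qed.

(** Hölder's bound with a cruder constant: t <= 1 + t^p at t = vol^(1/p) f, integrated over the
    cell. *)
Lemma cexp_le_vol (f : V -> R) (p C : R) k x : 1 <= p -> measurable_fun setT f ->
  (forall x, 0 <= f x) -> (\int[mu]_x (f x `^ p)%:E <= C%:E)%E ->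
  cexp k f x <= (1 + C) * vol k `^ (- p^-1).
Proof.
move=> p1 mf f0 fC; have p0 : 0 < p by exact: lt_le_trans p1.
have lf := locint_powR p1 mf f0 fC.
have mc := measurable_cell F k x; have v0 := vol_gt0 F k.
have mfp : measurable_fun setT (fun x => f x `^ p).
  exact: (measurableT_comp (measurable_powR p)).
rewrite powRN ler_pdivlMr ?powR_gt0// mulrC.
rewrite -(ler_pM2l v0) mulrCA -lee_fin EFinM -integral_cexp//.
rewrite -ge0_integralZr_EFin ?powR_ge0//.
apply: (@le_trans _ _ (\int[mu]_(y in cell k x) (1 + vol k * f y `^ p)%:E)%E).
  apply: le_ge0_integral => y _; rewrite lee_fin; first by rewrite mulr_ge0 ?powR_ge0.
  apply: (le_trans (powR_le1Dr p1 _)); first by rewrite mulr_ge0 ?powR_ge0.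
  by rewrite powRM ?powR_ge0// -powRrM mulVf ?gt_eqF// powRr1// ltW.
rewrite ge0_integralDr//; last 2 first.
- exact: measurable_funM.
- by move=> y; rewrite mulr_ge0 ?powR_ge0// ltW.
rewrite integral_cst// mul1e [X in (X + _)%E]mu_cell ge0_integralZr_EFin//; last 2 first.
- by move=> y; exact: powR_ge0.
- exact: ltW.
rewrite mulrDr mulr1 EFinD leeD2l// EFinM.
apply: lee_wpmul2l; first by rewrite lee_fin ltW.
apply: le_trans fC; apply: ge0_subset_integral => //; first exact/measurable_EFinP.
by move=> y _; rewrite lee_fin powR_ge0.
Qed.

Variables (a p1 p2 q : R).
Hypotheses (a0 : 0 < a) (p11 : 1 < p1) (p21 : 1 < p2) (q0 : 0 < q).
Hypothesis hq : q^-1 = p1^-1 + p2^-1 - a.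

Local Notation P := (p1^-1 + p2^-1).
Let P0 : 0 < P. Proof. by rewrite addr_gt0// invr_gt0 (lt_trans ltr01). Qed.
Let qV0 : 0 < q^-1. Proof. by rewrite invr_gt0. Qed.
Let aE : a = P - q^-1. Proof. by rewrite hq opprB addrC subrK. Qed.

(** Chosen so that P theta = 1/q and P (1 - theta) = a. With z = vol^P A, the two bounds vol^a A and
    vol^(-1/q) become A^theta z^(1 - theta) and A^theta z^(-theta), which balance at z = 1. *)
Let theta := q^-1 / P.
Let theta0 : 0 < theta. Proof. exact: divr_gt0. Qed.
Let theta1 : theta < 1.
Proof. by rewrite ltr_pdivrMr// mul1r; move: a0; rewrite aE subr_gt0. Qed.
Let thetaP : P * theta = q^-1. Proof. by rewrite mulrC divfK// gt_eqF. Qed.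

(** Divided by its scale, the sum is dominated by a growing geometric sequence where z <= 1 and by a
    decaying one beyond; the constant sees neither [A] nor the window. The exponent [s] is [q] for
    the oscillation sum when q <= 1, and 1 in the other uses. *)
Lemma hedberg_pointwise (s c : R) : 0 < s -> 1 <= c ->
  exists2 C : R, 0 <= C & forall (A : R) (k : int) (t : nat -> R) (J : nat),
    0 <= A -> (forall j, 0 <= t j) ->
    (forall j, t j <= vol (k + j%:Z) `^ a * A) ->
    (forall j, t j <= c * vol (k + j%:Z) `^ (- q^-1)) ->
    \sum_(j < J) t j `^ s <= C * A `^ (theta * s).
Proof.
move=> s0 c1; have c0 : 0 < c by exact: lt_le_trans c1.
have rho1 := ratio_gt1 F; have rho0 : 0 < rho by exact: lt_trans rho1.
have powR1lt (e : R) : 0 < e -> 1 < rho `^ e.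
  move=> e0; have : 1 `^ e < rho `^ e.
    by apply: gt0_ltr_powR => //; rewrite nnegrE// ltW.
  by rewrite powR1.
pose e1 := (1 - theta) * s; pose e2 := theta * s.
have e10 : 0 < e1 by rewrite mulr_gt0// subr_gt0.
have e20 : 0 < e2 by rewrite mulr_gt0.
pose r1 := rho `^ (P * e1); pose r2 := rho `^ (P * e2).
have r11 : 1 < r1 by apply: powR1lt; rewrite mulr_gt0.
have r21 : 1 < r2 by apply: powR1lt; rewrite mulr_gt0.
have K0 : 0 <= r1 / (r1 - 1) + r2 / (r2 - 1).
  have K (r : R) : 1 < r -> 0 <= r / (r - 1).
    by move=> r_1; rewrite divr_ge0// ?subr_ge0 ltW// (lt_trans _ r_1).
  by rewrite addr_ge0 ?K.
exists (c `^ s * (r1 / (r1 - 1) + r2 / (r2 - 1))).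
  by rewrite mulr_ge0 ?powR_ge0.
move=> A k t J A0 t0 tA tc.
have [A00|An0] := eqVneq A 0.
  rewrite big1 => [|j _]; first by rewrite !mulr_ge0 ?powR_ge0.
  have := tA j; rewrite A00 mulr0 => tj0.
  have -> : t j = 0 by apply/eqP; rewrite eq_le tj0 t0.
  by rewrite powR0// gt_eqF.
have {}A0 : 0 < A by rewrite lt_neqAle eq_sym An0.
pose z j := vol (k + j%:Z) `^ P * A.
have v0 j : 0 < vol (k + j%:Z) by exact: vol_gt0.
have z0 j : 0 < z j by rewrite mulr_gt0// powR_gt0.
have zS j : z j.+1 = rho `^ P * z j by rewrite /z vol_shift mulrA.
have At0 : 0 < A `^ theta by rewrite powR_gt0.
have eA j : vol (k + j%:Z) `^ a * A = A `^ theta * z j `^ (1 - theta).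
  rewrite powRM ?powR_ge0 ?(ltW A0)// -powRrM mulrBr mulr1 thetaP -aE.
  rewrite mulrCA -powRD; last by rewrite An0 implybT.
  by rewrite (_ : theta + (1 - theta) = 1) ?powRr1 ?(ltW A0)//; ring.
have eV j : vol (k + j%:Z) `^ (- q^-1) = A `^ theta * (z j `^ theta)^-1.
  rewrite powRM ?powR_ge0 ?(ltW A0)// -powRrM thetaP powRN invfM.
  by rewrite mulrCA divff ?mulr1 ?gt_eqF.
pose B := c `^ s * A `^ (theta * s).
have B0 : 0 < B by rewrite mulr_gt0// powR_gt0.
have Bt j (u : R) : 0 <= u -> t j <= c * A `^ theta * u -> t j `^ s / B <= u `^ s.
  move=> u0 tu; rewrite ler_pdivrMr// mulrC /B powRrM -powRM ?powR_ge0 ?(ltW c0)//.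
  rewrite -powRM//; last by rewrite mulr_ge0 ?powR_ge0 ?(ltW c0).
  by apply: ler_powR2 => //; exact: ltW.
rewrite [leRHS](_ : _ = (r1 / (r1 - 1) + r2 / (r2 - 1)) * B); last by rewrite /B; ring.
rewrite -ler_pdivrMr// mulr_suml.
apply: (@sum_two_sided_geometric _ r1 r2 (fun j => z j `^ e1)
   (fun j => (z j `^ e2)^-1) (fun j => t j `^ s / B) J r11 r21).
- by move=> j; rewrite powR_gt0.
- by move=> j; rewrite invr_gt0 powR_gt0.
- by move=> j /=; rewrite zS powRM ?powR_ge0 ?(ltW (z0 _))// -powRrM.
- move=> j /=; rewrite zS powRM ?powR_ge0 ?(ltW (z0 _))// -powRrM invfM.
  by rewrite mulrA divff ?mul1r// gt_eqF// powR_gt0// (lt_trans _ rho1).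
- move=> j; rewrite /e1 powRrM; apply: Bt; first exact: powR_ge0.
  apply: (le_trans (tA j)); rewrite eA -mulrA ler_peMl//.
  by rewrite mulr_ge0 ?powR_ge0.
- move=> j; have -> : (z j `^ e2)^-1 = ((z j `^ theta)^-1) `^ s.
    by rewrite -!powRN -powRrM mulNr.
  apply: Bt; first by rewrite invr_ge0 powR_ge0.
  by apply: (le_trans (tc j)); rewrite eV mulrA.
- move=> j; have [z1|z1] := leP (z j) 1; [left|right].
    by have := ler_powR2 (ltW e10) (ltW (z0 j)) z1; rewrite powR1.
  rewrite invf_le1 ?powR_gt0//.
  by have := ler_powR2 (ltW e20) ler01 (ltW z1); rewrite powR1.
Qed.

(** Young's inequality with exponents p1 P and p2 P: their reciprocals add up to 1 by the definition
    of P. *)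
Let young_max (u v : R) : 0 <= u -> 0 <= v ->
  (u * v) `^ P^-1 <= u `^ p1 + v `^ p2.
Proof.
move=> u0 v0; have p10 : 0 < p1 by exact: lt_trans p11.
have p20 : 0 < p2 by exact: lt_trans p21.
have i10 : 0 < p1^-1 by rewrite invr_gt0.
have i20 : 0 < p2^-1 by rewrite invr_gt0.
have r1 : 1 <= p1 * P by rewrite mulrDr divff ?gt_eqF// lerDl mulr_ge0 ?ltW.
have r2 : 1 <= p2 * P by rewrite mulrDr divff ?gt_eqF// lerDr mulr_ge0 ?ltW.
rewrite powRM//.
have := @conjugate_powR R (u `^ P^-1) (v `^ P^-1) (p1 * P) (p2 * P)
  (powR_ge0 _ _) (powR_ge0 _ _).
rewrite -!powRrM ![P^-1 * _]mulrC !mulfK ?(gt_eqF P0)//.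
have e : (p1 * P)^-1 + (p2 * P)^-1 = 1.
  by rewrite !invfM -mulrDl divff// gt_eqF.
move=> /(_ (lt_le_trans ltr01 r1) (lt_le_trans ltr01 r2) e) /le_trans; apply.
by apply: lerD; rewrite ler_pdivrMr ?(lt_le_trans ltr01)// ler_peMr// powR_ge0.
Qed.

Definition bilin_term (f1 f2 : V -> R) k x : R :=
  vol k `^ a * (cexp k f1 x * cexp k f2 x).

Lemma bilin_term_ge0 f1 f2 k x : (forall y, 0 <= f1 y) -> (forall y, 0 <= f2 y) ->
  0 <= bilin_term f1 f2 k x.
Proof.
move=> f10 f20; apply: mulr_ge0; first exact: powR_ge0.
by apply: mulr_ge0; exact: cexp_ge0.
Qed.

Lemma bilin_term_level f1 f2 k : level F k (bilin_term f1 f2 k).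
Proof. by move=> x y xy; rewrite /bilin_term !(cexp_level _ xy). Qed.

Lemma measurable_bilin_term f1 f2 k : measurable_fun setT (bilin_term f1 f2 k).
Proof. exact/measurable_level/bilin_term_level. Qed.

(** Whatever [s], the product of the two maximal functions ends up with exponent theta s (q/s) =
    1/P. The bounds [C1] and [C2] stay general because a maximal function will later take the place
    of [f1], and its norm is controlled only by Doob's constant. *)
Lemma hedberg_integral (s C1 C2 : R) : 0 < s -> 0 <= C1 -> 0 <= C2 ->
  exists2 C : R, 0 <= C & forall (f1 f2 : V -> R) (k : int) (J : nat),
    measurable_fun setT f1 -> measurable_fun setT f2 ->
    (forall x, 0 <= f1 x) -> (forall x, 0 <= f2 x) ->
    (\int[mu]_x (f1 x `^ p1)%:E <= C1%:E)%E ->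
    (\int[mu]_x (f2 x `^ p2)%:E <= C2%:E)%E ->
    (\int[mu]_x ((\sum_(j < J) bilin_term f1 f2 (k + j%:Z) x `^ s) `^ (q / s))%:E
       <= C%:E)%E.
Proof.
move=> s0 C10 C20.
have c1 : 1 <= (1 + C1) * (1 + C2) by nra.
have [K K0 HK] := hedberg_pointwise s0 c1.
pose D1 := (p1 / (p1 - 1)) `^ p1 * C1; pose D2 := (p2 / (p2 - 1)) `^ p2 * C2.
exists (K `^ (q / s) * (D1 + D2)).
  by rewrite mulr_ge0 ?powR_ge0// addr_ge0// mulr_ge0 ?powR_ge0.
move=> f1 f2 k J mf1 mf2 f10 f20 f1C f2C.
have lf1 := locint_powR (ltW p11) mf1 f10 f1C.
have lf2 := locint_powR (ltW p21) mf2 f20 f2C.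
have f1y := le_lt_trans f1C (ltry _); have f2y := le_lt_trans f2C (ltry _).
pose M1 := dyadic_max F f1; pose M2 := dyadic_max F f2.
have M10 x : 0 <= M1 x by exact: dyadic_max_ge0.
have M20 x : 0 <= M2 x by exact: dyadic_max_ge0.
have mM1 : measurable_fun setT M1 by exact: measurable_dyadic_max.
have mM2 : measurable_fun setT M2 by exact: measurable_dyadic_max.
have mMp1 : measurable_fun setT (fun x => M1 x `^ p1).
  exact: (measurableT_comp (measurable_powR p1)).
have mMp2 : measurable_fun setT (fun x => M2 x `^ p2).
  exact: (measurableT_comp (measurable_powR p2)).
have le1 := cexp_le_dyadic_max p11 f10 lf1 f1y.
have le2 := cexp_le_dyadic_max p21 f20 lf2 f2y.
apply: (@le_trans _ _ (\int[mu]_x (K `^ (q / s) * (M1 x `^ p1 + M2 x `^ p2))%:E)%E).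
  apply: ae_ge0_le_integral => //.
  - by move=> x _; rewrite lee_fin powR_ge0.
  - apply/measurable_EFinP/(measurableT_comp (measurable_powR _)).
    apply: measurable_sum => j.
    by apply: (measurableT_comp (measurable_powR _)); exact: measurable_bilin_term.
  - by move=> x _; rewrite lee_fin mulr_ge0 ?addr_ge0 ?powR_ge0.
  - by apply/measurable_EFinP/measurable_funM => //; exact: measurable_funD.
  apply: filterS2 le1 le2 => x xM1 xM2 _; rewrite lee_fin.
  apply: (@le_trans _ _ ((K * (M1 x * M2 x) `^ (theta * s)) `^ (q / s))).
    apply: ler_powR2; first by rewrite divr_ge0 ?ltW.
      by apply: sumr_ge0 => j _; exact: powR_ge0.
    apply: (HK _ k (fun j => bilin_term f1 f2 (k + j%:Z) x)).
    - exact: mulr_ge0.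
    - by move=> j; exact: bilin_term_ge0.
    - move=> j; rewrite ler_wpM2l ?powR_ge0// ler_pM ?cexp_ge0 ?xM1 ?xM2//.
    - move=> j; rewrite /bilin_term.
      have e1 := cexp_le_vol (k + j%:Z) x (ltW p11) mf1 f10 f1C.
      have e2 := cexp_le_vol (k + j%:Z) x (ltW p21) mf2 f20 f2C.
      apply: (@le_trans _ _ (vol (k + j%:Z) `^ a *
         ((1 + C1) * vol (k + j%:Z) `^ (- p1^-1) *
          ((1 + C2) * vol (k + j%:Z) `^ (- p2^-1))))).
        by rewrite ler_wpM2l ?powR_ge0// ler_pM ?cexp_ge0.
      have -> : - q^-1 = a + (- p1^-1 + - p2^-1) by rewrite aE; ring.
      have vn0 := vol_neq0 F (k + j%:Z).
      rewrite powRD ?vn0 ?implybT// powRD ?vn0 ?implybT//.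
      by rewrite le_eqVlt; apply/orP; left; apply/eqP; ring.
  rewrite powRM ?powR_ge0// -powRrM.
  rewrite (_ : theta * s * (q / s) = P^-1).
    by rewrite ler_wpM2l ?powR_ge0//; exact: young_max.
  rewrite (_ : _ * _ = q^-1 * q * (s * s^-1) * P^-1); last by rewrite /theta; ring.
  by rewrite mulVf ?gt_eqF// divff ?gt_eqF// !mul1r.
rewrite ge0_integralZr_EFin ?powR_ge0//; last 2 first.
- exact: measurable_funD.
- by move=> x; rewrite addr_ge0 ?powR_ge0.
rewrite EFinM; apply: lee_wpmul2l; first by rewrite lee_fin powR_ge0.
rewrite ge0_integralDr//; last 2 first.
- by move=> x; exact: powR_ge0.
- by move=> x; exact: powR_ge0.
rewrite EFinD; apply: leeD.
  apply: (le_trans (dyadic_max_powR p11 f10 lf1 f1y)).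
  by rewrite /D1 EFinM; apply: lee_wpmul2l => //; rewrite lee_fin powR_ge0.
apply: (le_trans (dyadic_max_powR p21 f20 lf2 f2y)).
by rewrite /D2 EFinM; apply: lee_wpmul2l => //; rewrite lee_fin powR_ge0.
Qed.
End hedberg.

(** * Sums of weighted oscillations *)

Section oscillation_sum.
Context d (V : measurableType d) (R : realType) (mu : {measure set V -> \bar R}).
Variable F : dyadic_filtration mu.
Local Notation cell := (cell F).
Local Notation vol := (vol F).
Local Notation rho := (ratio F).
Local Notation cexp := (cexp F).
Local Notation locint := (locint F).
Variables (a p1 p2 q : R).
Hypotheses (a0 : 0 < a) (p11 : 1 < p1) (p21 : 1 < p2) (q0 : 0 < q).
Hypothesis hq : q^-1 = p1^-1 + p2^-1 - a.
Local Notation bilin_term := (bilin_term F a).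

Definition osc_term (b f1 f2 : V -> R) k x : R :=
  bilin_term f1 f2 k x * `|b x - cexp k b x|.

Lemma osc_term_ge0 b f1 f2 k x :
  (forall y, 0 <= f1 y) -> (forall y, 0 <= f2 y) -> 0 <= osc_term b f1 f2 k x.
Proof. by move=> f10 f20; rewrite mulr_ge0// bilin_term_ge0. Qed.

Lemma measurable_osc_term b f1 f2 k : measurable_fun setT b ->
  measurable_fun setT (osc_term b f1 f2 k).
Proof.
move=> mb; apply: measurable_funM; first exact: measurable_bilin_term.
apply: measurableT_comp => //; apply: measurable_funB => //.
exact: measurable_cexp.
Qed.

Lemma powR_sum_le1 (t : nat -> R) (J : nat) : q <= 1 -> (forall j, 0 <= t j) ->
  (\sum_(j < J) t j) `^ q <= \sum_(j < J) t j `^ q.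
Proof.
move=> q1 t0; elim: J => [|J IHJ]; first by rewrite !big_ord0 powR0// gt_eqF.
rewrite !big_ord_recr/=; apply: le_trans (lerD IHJ (lexx _)).
set x := \sum_(i < J) t i; set y := t J.
have x0 : 0 <= x by exact: sumr_ge0.
have y0 : 0 <= y by exact: t0.
have [xy0|xyn0] := eqVneq (x + y) 0.
  by rewrite xy0 powR0 ?gt_eqF// addr_ge0 ?powR_ge0.
have xy0 : 0 < x + y by rewrite lt_neqAle eq_sym xyn0 addr_ge0.
(* The ratio t = z / (x + y) lies in [0, 1], where t <= t^q; the ratios of [x] and [y] add up to
   1. *)
have sub z : 0 <= z <= x + y -> (x + y) `^ q * (z / (x + y)) <= z `^ q.
  move=> /andP[]; rewrite le_eqVlt => /predU1P[<- _|z0 zxy].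
    by rewrite mul0r mulr0 powR_ge0.
  have z01 : 0 < z / (x + y) <= 1 by rewrite divr_gt0//= ler_pdivrMr// mul1r.
  apply: (@le_trans _ _ ((x + y) `^ q * (z / (x + y)) `^ q)).
    by rewrite ler_wpM2l ?powR_ge0// ger1_powR.
  by rewrite -powRM ?divr_ge0 ?(ltW z0) ?(ltW xy0)// mulrCA divff ?mulr1.
apply: (@le_trans _ _ ((x + y) `^ q * (x / (x + y)) + (x + y) `^ q * (y / (x + y)))).
  by rewrite -mulrDr -mulrDl divff ?mulr1.
by apply: lerD; apply: sub; rewrite ?x0 ?y0 ?lerDl ?lerDr.
Qed.

(** A linear majorant standing in for Jensen's inequality: for [u] of mean at most [beta] on a cell,
    the mean of u^q is at most 2 beta^q. *)
Lemma powR_le_scale (u beta : R) : q <= 1 -> 0 < beta -> 0 <= u ->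
  u `^ q <= beta `^ q * (1 + u / beta).
Proof.
move=> q1 b0 u0; have [ub|bu] := leP u beta.
  apply: (@le_trans _ _ (beta `^ q)); first by apply: ler_powR2 => //; exact: ltW.
  by rewrite ler_peMr ?powR_ge0// lerDl divr_ge0// ltW.
have -> : u = beta * (u / beta) by rewrite mulrCA divff ?mulr1// gt_eqF.
rewrite powRM ?divr_ge0 ?(ltW b0)// ler_wpM2l ?powR_ge0//.
rewrite mulrCA divff ?mulr1 ?gt_eqF//.
have ub1 : 1 <= u / beta by rewrite ler_pdivlMr// mul1r ltW.
by rewrite (le_trans (ler1_powR ub1 q1))// lerDr.
Qed.

Local Open Scope ereal_scope.

Lemma integral_sum_ge0 (A : set V) (t : nat -> V -> R) J : measurable A ->
  (forall j, measurable_fun setT (t j)) -> (forall j x, (0 <= t j x)%R) ->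
  \int[mu]_(x in A) (\sum_(j < J) t j x)%:E =
  \sum_(j < J) \int[mu]_(x in A) (t j x)%:E.
Proof.
move=> mA mt t0; under eq_integral do rewrite -sumEFin.
rewrite ge0_integral_sum//; last by move=> j x _; rewrite lee_fin.
by move=> j; apply/measurable_EFinP; exact: measurable_funTS.
Qed.

Section cells_osc.
Variables (b : V -> R) (beta : R).
Hypotheses (lb : locint b) (beta0 : (0 < beta)%R) (oscb : osc_le F b beta).
Let mb : measurable_fun setT b. Proof. by have [] := lb. Qed.

Let mosc k : measurable_fun setT (fun x => `|b x - cexp k b x|%R).
Proof.
apply: measurableT_comp => //; apply: measurable_funB => //.
exact: measurable_cexp.
Qed.

Lemma integral_level_osc_powR (h : V -> R) k : (q <= 1)%R -> level F k h ->
  (forall x, (0 <= h x)%R) ->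
  \int[mu]_x (h x * `|b x - cexp k b x| `^ q)%:E <=
  \int[mu]_x (2 * beta `^ q * h x)%:E.
Proof.
move=> q1 lh h0; have mh := measurable_level lh.
apply: (le_integral_cells (F := F) (k := k)) => //.
- apply/measurable_EFinP; apply: measurable_funM => //.
  exact: (measurableT_comp (measurable_powR q)).
- by apply/measurable_EFinP; exact: measurable_funM.
- by move=> x; rewrite lee_fin mulr_ge0// powR_ge0.
- by move=> x; rewrite lee_fin !mulr_ge0// powR_ge0.
move=> x _; have mc := measurable_cell F k x.
rewrite [leRHS](eq_integral (cst (2 * beta `^ q * h x)%:E)); last first.
  by move=> y /set_mem xy; rewrite (lh _ _ xy).
rewrite integral_cst// mu_cell.
pose c := (h x * beta `^ q)%R; have c0 : (0 <= c)%R by rewrite mulr_ge0 ?powR_ge0.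
apply: (@le_trans _ _ (\int[mu]_(y in cell k x)
    (c + c / beta * `|b y - cexp k b x|)%:E)).
  apply: le_ge0_integral => y xy; rewrite lee_fin; first by rewrite mulr_ge0 ?powR_ge0.
  rewrite (lh _ _ xy) (cexp_level b xy).
  apply: (le_trans (ler_wpM2l (h0 x) (powR_le_scale q1 beta0 (normr_ge0 _)))).
  by rewrite le_eqVlt; apply/orP; left; apply/eqP; rewrite /c; ring.
have cb0 : (0 <= c / beta)%R by rewrite divr_ge0// ltW.
have mbc : measurable_fun setT (fun y => `|b y - cexp k b x|%R).
  by apply: measurableT_comp => //; exact: measurable_funB.
rewrite ge0_integralDr//; last 2 first.
- exact: measurable_funM.
- by move=> y; rewrite mulr_ge0.
rewrite integral_cst// mu_cell ge0_integralZr_EFin//.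
apply: (le_trans (leeD2l _ (lee_wpmul2l _ (oscb k x)))); first by rewrite lee_fin.
rewrite -!EFinM -EFinD lee_fin le_eqVlt; apply/orP; left; apply/eqP.
by rewrite /c; field; rewrite gt_eqF.
Qed.

Lemma integral_level_osc_mul (h g m : V -> R) k : level F k h ->
  (forall x, (0 <= h x)%R) ->
  (forall x, (0 <= g x)%R) -> locint g ->
  (forall x, (0 <= m x)%R) -> measurable_fun setT m ->
  {ae mu, forall x, forall k, (cexp k g x <= m x)%R} ->
  \int[mu]_x (h x * `|b x - cexp k b x| * g x)%:E <=
  \int[mu]_x (h x * (2 * ((2 + rho) * beta) * m x))%:E.
Proof.
move=> lh h0 g0 lg m0 mm gm; have mh := measurable_level lh.
have [mg _] := lg.
have K0 : (0 <= 2 * ((2 + rho) * beta))%R.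
  by rewrite !mulr_ge0 ?addr_ge0 ?(ltW beta0)// ltW// (lt_trans _ (ratio_gt1 F)).
apply: (le_integral_cells (F := F) (k := k)) => //.
- by apply/measurable_EFinP; apply: measurable_funM => //; exact: measurable_funM.
- by apply/measurable_EFinP; apply: measurable_funM => //; exact: measurable_funM.
- by move=> x; rewrite lee_fin !mulr_ge0.
- by move=> x; rewrite lee_fin mulr_ge0// mulr_ge0.
move=> x _; have mc := measurable_cell F k x.
rewrite (eq_integral (fun y => (h x * (`|b y - cexp k b x| * g y))%:E)); last first.
  by move=> y /set_mem xy; rewrite (lh _ _ xy) (cexp_level b xy) mulrA.
rewrite [leRHS](eq_integral (fun y => (h x * (2 * ((2 + rho) * beta) * m y))%:E)); last first.
  by move=> y /set_mem xy; rewrite (lh _ _ xy).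
have mbc : measurable_fun setT (fun y => `|b y - cexp k b x|%R).
  by apply: measurableT_comp => //; exact: measurable_funB.
rewrite ge0_integralZr_EFin//; last 2 first.
- exact: measurable_funM.
- by move=> y; rewrite mulr_ge0.
rewrite ge0_integralZr_EFin//; last 2 first.
- exact: measurable_funM.
- by move=> y; rewrite mulr_ge0.
rewrite ge0_integralZr_EFin//.
apply: lee_wpmul2l; first by rewrite lee_fin.
exact: osc_mul_integral.
Qed.

End cells_osc.

Lemma osc_sum_le1 : (q <= 1)%R ->
  exists2 C : R, (0 <= C)%R & forall (b f1 f2 : V -> R) (beta : R) (k : int) (J : nat),
    locint b -> (0 < beta)%R -> osc_le F b beta ->
    measurable_fun setT f1 -> measurable_fun setT f2 ->
    (forall x, (0 <= f1 x)%R) -> (forall x, (0 <= f2 x)%R) ->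
    \int[mu]_x (f1 x `^ p1)%:E <= 1 ->
    \int[mu]_x (f2 x `^ p2)%:E <= 1 ->
    \int[mu]_x ((\sum_(j < J) osc_term b f1 f2 (k + j%:Z) x) `^ q)%:E
       <= (C * beta `^ q)%:E.
Proof.
move=> q1.
have [C C0 HC] := hedberg_integral F a0 p11 p21 q0 hq q0 ler01 ler01.
exists (2 * C)%R; first by rewrite mulr_ge0.
move=> b f1 f2 beta k J lb beta0 oscb mf1 mf2 f10 f20 f11 f21.
have [mb _] := lb.
pose h j x := (bilin_term f1 f2 (k + j%:Z) x `^ q)%R.
have lh j : level F (k + j%:Z) (h j).
  by move=> x y xy; rewrite /h (bilin_term_level _ _ _ xy).
have mh j := measurable_level (lh j).
have h0 j x : (0 <= h j x)%R by exact: powR_ge0.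
have mosc j : measurable_fun setT (fun x => `|b x - cexp (k + j%:Z) b x|%R).
  apply: measurableT_comp => //; apply: measurable_funB => //.
  exact: measurable_cexp.
apply: (@le_trans _ _ (\int[mu]_x
    (\sum_(j < J) h j x * `|b x - cexp (k + j%:Z) b x| `^ q)%:E)).
  apply: le_ge0_integral => x _; rewrite lee_fin ?powR_ge0//.
  apply: (le_trans (powR_sum_le1 _ q1 (t := fun j => osc_term b f1 f2 (k + j%:Z) x) _)).
    by move=> j; exact: osc_term_ge0.
  by apply: ler_sum => j _; rewrite powRM// bilin_term_ge0.
rewrite (integral_sum_ge0 _ (t := fun j x => h j x * `|b x - cexp (k + j%:Z) b x| `^ q)%R)//; last 2 first.
- move=> j; apply: measurable_funM => //.
  exact: (measurableT_comp (measurable_powR q)).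
- by move=> j x; rewrite mulr_ge0// powR_ge0.
apply: (@le_trans _ _ (\sum_(j < J) \int[mu]_x (2 * beta `^ q * h j x)%:E)).
  by apply: lee_sum => j _; exact: integral_level_osc_powR.
rewrite -(integral_sum_ge0 _ (t := fun j x => 2 * beta `^ q * h j x)%R)//; last 2 first.
- by move=> j; exact: measurable_funM.
- by move=> j x; rewrite !mulr_ge0// powR_ge0.
under eq_integral do rewrite -mulr_sumr.
rewrite ge0_integralZr_EFin//; last 3 first.
- exact: measurable_sum.
- by move=> x; exact: sumr_ge0.
- by rewrite mulr_ge0// powR_ge0.
rewrite [leRHS](_ : _ = (2 * beta `^ q)%:E * C%:E); last by rewrite -EFinM; congr EFin; ring.
apply: lee_wpmul2l; first by rewrite lee_fin mulr_ge0// powR_ge0.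
have := HC f1 f2 k J mf1 mf2 f10 f20 f11 f21.
apply: le_trans; apply: le_ge0_integral => x _; first by rewrite lee_fin sumr_ge0.
rewrite lee_fin divff ?gt_eqF// powRr1//.
by apply: sumr_ge0 => j _; exact: powR_ge0.
Qed.

(** The weight of [v] is tuned to what follows. With r = q / (q - 1), Doob's constant for the
    exponent r is q^r, so once [v] is the maximal function of the dual function, its term is at most
    half of the quantity being estimated. *)
Let young_absorb (u v : R) : (1 < q)%R -> (0 <= u)%R -> (0 <= v)%R ->
  (u * v <= (2 * q) `^ q * u `^ q +
     2^-1 * (q `^ (q / (q - 1)))^-1 * v `^ (q / (q - 1)))%R.
Proof.
move=> q1 u0 v0; set r := (q / (q - 1))%R.
have r0 : (0 < r)%R by exact: conj_exp_gt0.
have rV1 : (r^-1 <= 1)%R by rewrite conj_exp_invE// gerBl invr_ge0 ltW.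
have r1 : (1 <= r)%R by rewrite -invf_le1.
have qV1 : (q^-1 <= 1)%R by rewrite invf_le1// ltW.
have q20 : (0 < 2 * q)%R by exact: mulr_gt0.
have -> : (u * v = (2 * q * u) * ((2 * q)^-1 * v))%R.
  by rewrite mulrACA divff ?mul1r// gt_eqF.
have := @conjugate_powR R (2 * q * u)%R ((2 * q)^-1 * v)%R q r.
move=> /(_ (mulr_ge0 (ltW q20) u0)).
have iv0 : (0 <= (2 * q)^-1 * v)%R by rewrite mulr_ge0// invr_ge0 ltW.
move=> /(_ iv0 q0 r0 (conj_exp_inv q1)) /le_trans; apply.
rewrite !powRM ?invr_ge0 ?(ltW q20) ?(ltW q0)//; apply: lerD.
  by rewrite ler_piMr// !mulr_ge0 ?powR_ge0.
apply: (@le_trans _ _ (((2 * q)^-1) `^ r * v `^ r)%R).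
  by rewrite ler_piMr// mulr_ge0 ?powR_ge0.
rewrite ler_wpM2r ?powR_ge0// -powR_inv1 ?(ltW q20)// -powRrM mulN1r powRN.
rewrite powRM ?(ltW q0)// invfM ler_wpM2r ?invr_ge0 ?powR_ge0//.
rewrite lef_pV2 ?posrE ?powR_gt0//.
by rewrite -[leLHS]powRr1// ler_powR// ler1n.
Qed.

(** Sets of finite measure increasing to the whole space. The cells around one point would not do,
    since they may fill only a quadrant. *)
Let exhaust (n : nat) : set V := \big[setU/set0]_(i < n) cell 0 (point F i).

Let mexhaust n : measurable (exhaust n).
Proof. by apply: bigsetU_measurable => i _; exact: measurable_cell. Qed.

Let exhaust_fin n : mu (exhaust n) < +oo.
Proof.
elim: n => [|n IHn]; first by rewrite /exhaust big_ord0 measure0.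
have cfin : mu (cell 0 (point F n)) < +oo by rewrite mu_cell ltry.
rewrite /exhaust big_ord_recr/=; apply: (le_lt_trans _ (lte_add_pinfty IHn cfin)).
by apply: measureU2; [exact: mexhaust|exact: measurable_cell].
Qed.

Let exhaust_homo m n : (m <= n)%N -> exhaust m `<=` exhaust n.
Proof.
by move=> mn; exact: (@subset_bigsetU _ (fun i => cell 0 (point F i)) m n mn).
Qed.

Let exhaustT x : exists n, exhaust n x.
Proof.
have [i ix] := cell_point F 0 x; exists i.+1.
by rewrite /exhaust big_ord_recr/=; right.
Qed.

Lemma osc_sum_gt1 : (1 < q)%R ->
  exists2 C : R, (0 <= C)%R & forall (b f1 f2 : V -> R) (beta : R) (k : int) (J : nat),
    locint b -> (0 < beta)%R -> osc_le F b beta ->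
    measurable_fun setT f1 -> measurable_fun setT f2 ->
    (forall x, (0 <= f1 x)%R) -> (forall x, (0 <= f2 x)%R) ->
    \int[mu]_x (f1 x `^ p1)%:E <= 1 ->
    \int[mu]_x (f2 x `^ p2)%:E <= 1 ->
    \int[mu]_x ((\sum_(j < J) osc_term b f1 f2 (k + j%:Z) x) `^ q)%:E
       <= (C * beta `^ q)%:E.
Proof.
move=> q1; have qB0 : (0 < q - 1)%R by rewrite subr_gt0.
have [C C0 HC] := hedberg_integral F a0 p11 p21 q0 hq ltr01 ler01 ler01.
set phi := (2 * (2 + rho))%R.
have phi0 : (0 < phi)%R by rewrite mulr_gt0// addr_gt0// (lt_trans _ (ratio_gt1 F)).
exists (2 * ((2 * q) `^ q * phi `^ q * C))%R.
  by rewrite !mulr_ge0 ?powR_ge0.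
move=> b f1 f2 beta k J lb beta0 oscb mf1 mf2 f10 f20 f11 f21.
have [mb _] := lb.
set r := (q / (q - 1))%R; have r0 : (0 < r)%R by exact: conj_exp_gt0.
have r1 : (1 < r)%R by rewrite ltr_pdivlMr// mul1r ltrBlDr ltrDl.
have rr : (r / (r - 1) = q)%R.
  have -> : (r - 1 = (q - 1)^-1)%R by rewrite /r; field; rewrite gt_eqF.
  by rewrite invrK /r divfK// gt_eqF.
pose G x := (\sum_(j < J) osc_term b f1 f2 (k + j%:Z) x)%R.
pose S x := (\sum_(j < J) bilin_term f1 f2 (k + j%:Z) x)%R.
have t0 j x : (0 <= osc_term b f1 f2 (k + j%:Z) x)%R by exact: osc_term_ge0.
have s0 j x : (0 <= bilin_term f1 f2 (k + j%:Z) x)%R by exact: bilin_term_ge0.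
have G0 x : (0 <= G x)%R by exact: sumr_ge0.
have S0 x : (0 <= S x)%R by exact: sumr_ge0.
have mt j : measurable_fun setT (osc_term b f1 f2 (k + j%:Z)) by exact: measurable_osc_term.
have ms j : measurable_fun setT (bilin_term f1 f2 (k + j%:Z)) by exact: measurable_bilin_term.
have mG : measurable_fun setT G by exact: measurable_sum.
have mS : measurable_fun setT S by exact: measurable_sum.
have mpow (h : V -> R) (e : R) : measurable_fun setT h -> measurable_fun setT (fun x => h x `^ e)%R.
  by move=> mh; exact: (measurableT_comp (measurable_powR e)).
pose T n x := Num.min (G x) n%:R.
have T0 n x : (0 <= T n x)%R by rewrite le_min G0/=.
have mT n : measurable_fun setT (T n) by exact: measurable_minr.
(* The extremal function of the duality pairing with [G], cut off in height and in support. The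
   cut-offs make the integral of g^r finite, which the absorption at the end requires, and the
   inequality g^r <= G g survives them. *)
pose g n x := (T n x `^ (q - 1) * \1_(exhaust n) x)%R.
have g0 n x : (0 <= g n x)%R by rewrite mulr_ge0 ?powR_ge0.
have mind n : measurable_fun setT (\1_(exhaust n) : V -> R) by exact: measurable_indic.
have mg n : measurable_fun setT (g n).
  by apply: measurable_funM; [exact: mpow|exact: mind].
have grE n x : (g n x `^ r = T n x `^ q * \1_(exhaust n) x)%R.
  rewrite /g powRM ?powR_ge0// -powRrM (_ : ((q - 1) * r = q)%R); last first.
    by rewrite /r mulrC divfK// gt_eqF.
  by rewrite indicE; case: (_ \in _); rewrite ?powR1// powR0// gt_eqF.
have gG n x : (g n x `^ r <= G x * g n x)%R.
  rewrite grE /g mulrA ler_wpM2r// -mulr_powRB1// ler_wpM2r ?powR_ge0//.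
  by rewrite ge_min lexx.
have gfin n : \int[mu]_x (g n x `^ r)%:E < +oo.
  apply: (@le_lt_trans _ _ (\int[mu]_x (n%:R `^ q * \1_(exhaust n) x)%:E)).
    apply: le_ge0_integral => x _; rewrite lee_fin ?powR_ge0//.
    rewrite grE ler_wpM2r// ler_powR2 ?(ltW q0)// ge_min lexx orbT//.
  rewrite ge0_integralZr_EFin ?powR_ge0// integral_indic// setIT.
  by rewrite lte_mul_pinfty// lee_fin powR_ge0.
suff key n : \int[mu]_x (g n x `^ r)%:E <= (2 * ((2 * q) `^ q * phi `^ q * C) * beta `^ q)%:E.
  apply: (integral_ereal_sup_le (u := fun n x => (g n x `^ r)%:E)) => //.
  - by move=> n; apply/measurable_EFinP; exact: mpow.
  - by move=> n x; rewrite lee_fin powR_ge0.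
  - move=> x m n mn; rewrite lee_fin !grE; apply: ler_pM; rewrite ?powR_ge0//.
      apply: ler_powR2; rewrite ?(ltW q0)// /T le_min !ge_min lexx/=.
      by rewrite ler_nat mn orbT.
    rewrite !indicE ler_nat; have [xm|//] := boolP (x \in exhaust m).
    by rewrite mem_set//; apply: (exhaust_homo mn); exact/set_mem.
  move=> x _; apply/andP; split; first by rewrite lee_fin powR_ge0.
  have [n1 n1x] := exhaustT x; pose n2 := (Num.truncn (G x)).+1.
  apply: ereal_sup_ubound; exists (maxn n1 n2) => //.
  rewrite grE indicE mem_set ?mulr1; last by apply: exhaust_homo n1x; exact: leq_maxl.
  rewrite /T min_l// (@le_trans _ _ n2%:R)//; first by rewrite ltW// truncnS_gt.
  by rewrite ler_nat leq_maxr.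
have X0 : 0 <= \int[mu]_x (g n x `^ r)%:E.
  by apply: integral_ge0 => x _; rewrite lee_fin powR_ge0.
have lg : locint (g n).
  apply: (locint_powR F (ltW r1) (C := fine (\int[mu]_x (g n x `^ r)%:E))) => //.
  by rewrite fineK// ge0_fin_numE.
pose m := dyadic_max F (g n).
have m0 x : (0 <= m x)%R by exact: dyadic_max_ge0.
have mm : measurable_fun setT m by exact: measurable_dyadic_max.
have gm := cexp_le_dyadic_max r1 (g0 n) lg (gfin n).
have intm := dyadic_max_powR r1 (g0 n) lg (gfin n).
have bphi0 : (0 <= phi * beta)%R by exact/ltW/mulr_gt0.
have bphi0' : (0 <= 2 * ((2 + rho) * beta))%R by rewrite mulrA.
have : \int[mu]_x (g n x `^ r)%:E <= \int[mu]_x (phi * beta * S x * m x)%:E.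
  apply: (@le_trans _ _ (\int[mu]_x (\sum_(j < J) osc_term b f1 f2 (k + j%:Z) x * g n x)%:E)).
    apply: le_ge0_integral => x _; rewrite lee_fin ?powR_ge0//.
    by rewrite -mulr_suml gG.
  rewrite (integral_sum_ge0 _ (t := fun j x => osc_term b f1 f2 (k + j%:Z) x * g n x)%R)//; last 2 first.
  - by move=> j; exact: measurable_funM.
  - by move=> j x; rewrite mulr_ge0.
  apply: (@le_trans _ _ (\sum_(j < J) \int[mu]_x
      (bilin_term f1 f2 (k + j%:Z) x * (2 * ((2 + rho) * beta) * m x))%:E)).
    apply: lee_sum => j _.
    by apply: (integral_level_osc_mul lb beta0 oscb); [exact: bilin_term_level|..].
  rewrite -(integral_sum_ge0 _ (t := fun j x => bilin_term f1 f2 (k + j%:Z) x * (2 * ((2 + rho) * beta) * m x))%R)//; last 2 first.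
  - by move=> j; apply: measurable_funM => //; exact: measurable_funM.
  - by move=> j x; apply: mulr_ge0 => //; exact: mulr_ge0.
  apply: le_ge0_integral => x _; rewrite lee_fin.
    by apply: sumr_ge0 => j _; apply: mulr_ge0 => //; exact: mulr_ge0.
  by rewrite -mulr_suml le_eqVlt; apply/orP; left; apply/eqP; rewrite /phi /S; ring.
set K1 := ((2 * q) `^ q)%R; set K2 := (2^-1 * (q `^ r)^-1)%R.
have K20 : (0 <= K2)%R by rewrite mulr_ge0// invr_ge0 powR_ge0.
have : \int[mu]_x (phi * beta * S x * m x)%:E <=
    \int[mu]_x (K1 * (phi * beta) `^ q * S x `^ q + K2 * m x `^ r)%:E.
  apply: le_ge0_integral => x _; rewrite lee_fin; first by apply: mulr_ge0 => //; exact: mulr_ge0.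
  have bS0 : (0 <= phi * beta * S x)%R by rewrite mulr_ge0.
  apply: (le_trans (young_absorb q1 bS0 (m0 x))).
  by rewrite (powRM q bphi0 (S0 x)) mulrA.
rewrite ge0_integralDr//; last 4 first.
- by apply: measurable_funM => //; exact: mpow.
- by apply: measurable_funM => //; exact: mpow.
- by move=> x; rewrite !mulr_ge0 ?powR_ge0.
- by move=> x; rewrite mulr_ge0 ?powR_ge0.
rewrite ge0_integralZr_EFin//; last 3 first.
- exact: mpow.
- by move=> x; exact: powR_ge0.
- by rewrite mulr_ge0 ?powR_ge0.
rewrite ge0_integralZr_EFin//; last 2 first.
- exact: mpow.
- by move=> x; exact: powR_ge0.
move=> H1 H2; have {H1}H2 := le_trans H2 H1.
have SC : \int[mu]_x (S x `^ q)%:E <= C%:E.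
  have := HC f1 f2 k J mf1 mf2 f10 f20 f11 f21.
  apply: le_trans; apply: le_ge0_integral => x _; rewrite lee_fin ?powR_ge0//.
  rewrite divr1; apply: ler_powR2; rewrite ?(ltW q0)//.
  by apply: ler_sum => j _; rewrite powRr1.
have H3 : K2%:E * \int[mu]_x (m x `^ r)%:E <= (2^-1)%:E * \int[mu]_x (g n x `^ r)%:E.
  apply: (le_trans (lee_wpmul2l _ intm)); first by rewrite lee_fin.
  rewrite rr muleA -EFinM; apply: lee_wpmul2r => //.
  by rewrite lee_fin /K2 -mulrA mulVf ?mulr1// gt_eqF// powR_gt0.
have H4 : (K1 * (phi * beta) `^ q)%:E * \int[mu]_x (S x `^ q)%:E <=
    (K1 * (phi * beta) `^ q * C)%:E.
  by rewrite [leRHS]EFinM; apply: lee_wpmul2l => //; rewrite lee_fin mulr_ge0 ?powR_ge0.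
have := le_trans H2 (leeD H4 H3).
move: X0 (gfin n); case: (\int[mu]_x (g n x `^ r)%:E) => [X| |]// _ _.
rewrite -EFinM -EFinD !lee_fin powRM ?(ltW phi0) ?(ltW beta0)//.
rewrite -/K1; set U := (phi `^ q)%R; set W := (beta `^ q)%R => H.
have -> : (2 * (K1 * U * C) * W = 2 * (K1 * (U * W) * C))%R by ring.
lra.
Qed.

End oscillation_sum.

(** * Domination of the commutator *)

Section esum_int.
Variable R : realType.
Local Open Scope ereal_scope.

Lemma esum_int_le (g : int -> R) : (forall k, (0 <= g k)%R) ->
  \esum_(k in [set: int]) (g k)%:E <=
  ereal_sup (range (fun N : nat => (\sum_(j < N + N) g (- N%:Z + j%:Z))%:E)).
Proof.
move=> g0; apply: ge_ereal_sup => _ [X [finX _] <-].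
have [s Xs] := (finite_seqP X).1 finX.
pose N := (\max_(k <- s) `|k|%N).+1.
apply: (@le_trans _ _ (\sum_(j < N + N) g (- N%:Z + j%:Z))%:E); last first.
  by apply: ereal_sup_ubound; exists N.
pose h (j : nat) : int := (- N%:Z + j%:Z)%R.
rewrite -sumEFin (fsbig_ord _ (N + N) (fun j => (g (h j))%:E)).
have bij : set_bij `I_(N + N) (h @` `I_(N + N)) h.
  by split => // i j _ _ /addrI[].
rewrite -(reindex_fsbig _ _ _ (fun k => (g k)%:E) bij).
apply: lee_fsum_nneg_subset => //.
- exact: finite_image.
- move=> k; rewrite !inE Xs /= => ks.
  have kN : (`|k| < N)%N by rewrite ltnS; exact: (leq_bigmax_seq (F := fun k : int => `|k|%N)).
  by exists (absz ((k : int) + N%:Z)%R); rewrite /= /h; lia.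
- by move=> k _; rewrite lee_fin.
Qed.

Lemma esumZl_EFin (T : choiceType) (S : set T) (c : R) (f : T -> R) :
  (0 <= c)%R -> (forall i, (0 <= f i)%R) ->
  \esum_(i in S) (c * f i)%:E = c%:E * \esum_(i in S) (f i)%:E.
Proof.
move=> c0 f0.
have le (c' : R) (f' : T -> R) : (0 < c')%R -> (forall i, (0 <= f' i)%R) ->
    \esum_(i in S) (c' * f' i)%:E <= c'%:E * \esum_(i in S) (f' i)%:E.
  move=> c'0 f'0; apply: ge_ereal_sup => _ [X [finX XS] <-].
  rewrite (eq_fsbigr (fun i => c'%:E * (f' i)%:E)); last by move=> i _; rewrite EFinM.
  rewrite -ge0_mule_fsumr; last by move=> i; rewrite lee_fin.
  by rewrite lee_pmul2l//; apply: ereal_sup_ubound; exists X.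
move: c0; rewrite le_eqVlt => /predU1P[<-|c0].
  by rewrite mul0e esum1// => i _; rewrite mul0r.
apply/eqP; rewrite eq_le le//=.
rewrite -(@lee_pmul2l _ c^-1%:E)// ?lte_fin ?invr_gt0//.
rewrite muleA -EFinM mulVf ?gt_eqF// mul1e.
have := le c^-1%R (fun i => c * f i)%R.
rewrite invr_gt0 => /(_ c0 (fun i => mulr_ge0 (ltW c0) (f0 i))).
by under eq_esum do rewrite mulrA mulVf ?gt_eqF// mul1r.
Qed.

(* The bound [e |t i| <= g i] makes the two series absolutely convergent as soon
   as the right-hand side is finite. *)
Lemma esum_commutator_le (T : choiceType) (S : set T) (t s g : T -> R) (X e : R) :
  (0 < e)%R -> (forall i, e * `|t i| + `|X * t i - s i| <= g i)%R ->
  `|X%:E * (\esum_(i in S) (Num.max (t i) 0)%:E - \esum_(i in S) (Num.max (- t i) 0)%:E)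
    - (\esum_(i in S) (Num.max (s i) 0)%:E - \esum_(i in S) (Num.max (- s i) 0)%:E)|
  <= \esum_(i in S) (g i)%:E.
Proof.
move=> e0 tsg.
have max0 (u : R) : (0 <= Num.max u 0)%R by rewrite le_max lexx orbT.
have maxle (u : R) : (Num.max u 0 <= `|u|)%R.
  by rewrite /Num.max; case: ifP => _ //; exact: ler_norm.
have g0 i : (0 <= g i)%R.
  by apply: le_trans (tsg i); rewrite addr_ge0// mulr_ge0// ltW.
have gS : 0 <= \esum_(i in S) (g i)%:E by apply: esum_ge0 => i _; rewrite lee_fin.
have [->|gfin] := eqVneq (\esum_(i in S) (g i)%:E) +oo; first exact: leey.
have {}gfin : \esum_(i in S) (g i)%:E < +oo by rewrite ltey.
have tg i : (`|t i| <= e^-1 * g i)%R.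
  rewrite ler_pdivlMl//; apply: le_trans (tsg i); by rewrite lerDl.
have sg i : (`|s i| <= (`|X| * e^-1 + 1) * g i)%R.
  have -> : s i = (X * t i - (X * t i - s i))%R by ring.
  apply: (le_trans (ler_normB _ _)); rewrite mulrDl mul1r lerD//.
    by rewrite normrM -mulrA ler_wpM2l.
  by apply: le_trans (tsg i); rewrite lerDr mulr_ge0// ltW.
have bnd (c : R) (u : T -> R) : (0 <= c)%R -> (forall i, 0 <= u i <= c * g i)%R ->
    \esum_(i in S) (u i)%:E \is a fin_num.
  move=> c0 ug; rewrite ge0_fin_numE.
    apply: (@le_lt_trans _ _ (\esum_(i in S) (c * g i)%:E)).
      by apply: le_esum => i _; rewrite lee_fin; have /andP[] := ug i.
    by rewrite esumZl_EFin// lte_mul_pinfty// lee_fin.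
  by apply: esum_ge0 => i _; rewrite lee_fin; have /andP[] := ug i.
have c10 : (0 <= e^-1)%R by rewrite invr_ge0 ltW.
have c20 : (0 <= `|X| * e^-1 + 1)%R by rewrite addr_ge0// mulr_ge0.
have tp : \esum_(i in S) (Num.max (t i) 0)%:E \is a fin_num.
  by apply: (bnd _ _ c10) => i; rewrite max0/= (le_trans (maxle _)).
have tn : \esum_(i in S) (Num.max (- t i) 0)%:E \is a fin_num.
  by apply: (bnd _ _ c10) => i; rewrite max0/= (le_trans (maxle _))// normrN.
have sp : \esum_(i in S) (Num.max (s i) 0)%:E \is a fin_num.
  by apply: (bnd _ _ c20) => i; rewrite max0/= (le_trans (maxle _)).
have sn : \esum_(i in S) (Num.max (- s i) 0)%:E \is a fin_num.
  by apply: (bnd _ _ c20) => i; rewrite max0/= (le_trans (maxle _))// normrN.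
have gf : \esum_(i in S) (g i)%:E \is a fin_num by rewrite ge0_fin_numE.
pose Xp := Num.max X 0%R; pose Xn := Num.max (- X)%R 0%R.
have Xp0 : (0 <= Xp)%R by exact: max0.
have Xn0 : (0 <= Xn)%R by exact: max0.
have XE : X = (Xp - Xn)%R.
  by rewrite /Xp /Xn /Num.max; case: ltP => ?; case: ltP => ?; lra.
have posneg (u : R) : u = (Num.max u 0 - Num.max (- u) 0)%R.
  by rewrite /Num.max; case: ltP => ?; case: ltP => ?; lra.
(* The upper half of the estimate, with [X], [t] and [s] split into positive and negative parts and
   every negative term moved across: both sides are then sums of nonnegative terms and compare
   termwise. [key2] is the lower half. *)
have key1 : \esum_(i in S) (Xp * Num.max (t i) 0 + (Xn * Num.max (- t i) 0
       + Num.max (- s i) 0))%:E <=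
    \esum_(i in S) (Xn * Num.max (t i) 0 + (Xp * Num.max (- t i) 0
       + (Num.max (s i) 0 + g i)))%:E.
  apply: le_esum => i _; rewrite lee_fin.
  have : (X * t i - s i <= g i)%R.
    apply: (le_trans (ler_norm _)); apply: le_trans (tsg i).
    by rewrite lerDr mulr_ge0// ltW.
  by rewrite {1}XE {1}(posneg (t i)) {1}(posneg (s i)); lra.
have key2 : \esum_(i in S) (Xn * Num.max (t i) 0 + (Xp * Num.max (- t i) 0
       + Num.max (s i) 0))%:E <=
    \esum_(i in S) (Xp * Num.max (t i) 0 + (Xn * Num.max (- t i) 0
       + (Num.max (- s i) 0 + g i)))%:E.
  apply: le_esum => i _; rewrite lee_fin.
  have : (- (X * t i - s i) <= g i)%R.
    apply: (le_trans (ler_norm _)); rewrite normrN; apply: le_trans (tsg i).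
    by rewrite lerDr mulr_ge0// ltW.
  by rewrite {1}XE {1}(posneg (t i)) {1}(posneg (s i)); lra.
have split (u v : T -> R) : (forall i, 0 <= u i)%R -> (forall i, 0 <= v i)%R ->
    \esum_(i in S) (u i + v i)%:E = \esum_(i in S) (u i)%:E + \esum_(i in S) (v i)%:E.
  by move=> u0 v0; under eq_esum do rewrite EFinD; apply: esumD => i _; rewrite lee_fin.
move: key1 key2; rewrite !split;
  try by [move=> i; rewrite ?addr_ge0 ?mulr_ge0].
rewrite !esumZl_EFin//.
rewrite -(fineK tp) -(fineK tn) -(fineK sp) -(fineK sn) -(fineK gf).
rewrite -!EFinM -!EFinD !lee_fin => key1 key2.
rewrite ler_norml XE.
by apply/andP; split; lra.
Qed.

End esum_int.

(** As [q] may be below 1, the triangle inequality is replaced by the quasi-norm inequality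
    [powRD_le]. Using it twice produces the nested powers of 2. *)
Lemma powR_sum3_bound d (V : measurableType d) (R : realType)
    (mu : {measure set V -> \bar R}) (A B E : V -> R) (q beta K C1 C2 C3 : R) :
  (0 < q)%R -> (0 <= beta)%R -> (0 <= K)%R ->
  measurable_fun setT A -> measurable_fun setT B -> measurable_fun setT E ->
  (forall x, 0 <= A x)%R -> (forall x, 0 <= B x)%R -> (forall x, 0 <= E x)%R ->
  (\int[mu]_x (A x `^ q)%:E <= (C1 * beta `^ q)%:E)%E ->
  (\int[mu]_x (B x `^ q)%:E <= C2%:E)%E ->
  (\int[mu]_x (E x `^ q)%:E <= C3%:E)%E ->
  (\int[mu]_x ((A x + (beta * B x + K * beta * E x)) `^ q)%:E <=
    (2 `^ q * (C1 + 2 `^ q * (C2 + K `^ q * C3)) * beta `^ q)%:E)%E.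
Proof.
move=> q0 b0 K0 mA mB mE A0 B0 E0 IA IB IE; have q0' := ltW q0.
have mpow (h : V -> R) : measurable_fun setT h -> measurable_fun setT (fun x => h x `^ q)%R.
  by move=> mh; exact: (measurableT_comp (measurable_powR q)).
have mscale (c : R) (h : V -> R) : measurable_fun setT h -> measurable_fun setT (fun x => c * h x)%R.
  by move=> mh; exact: measurable_funM.
have madd (h g : V -> R) : measurable_fun setT h -> measurable_fun setT g ->
    measurable_fun setT (fun x => h x + g x)%R.
  by move=> mh mg; exact: measurable_funD.
have Kb0 : (0 <= K * beta)%R by exact: mulr_ge0.
have lin (A' B' E' : V -> R) (P W Kq : R) : (0 <= P)%R -> (0 <= W)%R -> (0 <= Kq)%R ->
    measurable_fun setT A' -> measurable_fun setT B' -> measurable_fun setT E' ->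
    (forall x, 0 <= A' x)%R -> (forall x, 0 <= B' x)%R -> (forall x, 0 <= E' x)%R ->
    (\int[mu]_x (A' x)%:E <= (C1 * W)%:E)%E -> (\int[mu]_x (B' x)%:E <= C2%:E)%E ->
    (\int[mu]_x (E' x)%:E <= C3%:E)%E ->
    (\int[mu]_x (P * (A' x + P * (W * B' x + Kq * W * E' x)))%:E <=
      (P * (C1 + P * (C2 + Kq * C3)) * W)%:E)%E.
  move=> P0 W0 Kq0 mA' mB' mE' A'0 B'0 E'0 IA' IB' IE'.
  have KW0 : (0 <= Kq * W)%R by exact: mulr_ge0.
  have mBE := madd _ _ (mscale W _ mB') (mscale (Kq * W) _ mE').
  have BE0 x : (0 <= W * B' x + Kq * W * E' x)%R by rewrite addr_ge0// mulr_ge0.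
  have PBE0 x : (0 <= P * (W * B' x + Kq * W * E' x))%R by exact: mulr_ge0.
  rewrite ge0_integralZr_EFin//; last 2 first.
  - exact/madd/mscale.
  - by move=> x; exact: addr_ge0.
  rewrite ge0_integralDr//; last exact: mscale.
  rewrite ge0_integralZr_EFin// ge0_integralDr//; last 4 first.
  - exact: mscale.
  - exact: mscale.
  - by move=> x; exact: mulr_ge0.
  - by move=> x; exact: mulr_ge0.
  rewrite !ge0_integralZr_EFin//.
  have -> : ((P * (C1 + P * (C2 + Kq * C3)) * W)%:E =
      P%:E * ((C1 * W)%:E + P%:E * (W%:E * C2%:E + (Kq * W)%:E * C3%:E)))%E.
    by rewrite -!(EFinM, EFinD); congr EFin; ring.
  apply: lee_wpmul2l; first by rewrite lee_fin.
  apply: leeD => //; apply: lee_wpmul2l; first by rewrite lee_fin.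
  by apply: leeD; apply: lee_wpmul2l => //; rewrite lee_fin.
have le x : ((A x + (beta * B x + K * beta * E x)) `^ q <= 2 `^ q * (A x `^ q
    + 2 `^ q * (beta `^ q * B x `^ q + K `^ q * beta `^ q * E x `^ q)))%R.
  apply: (le_trans (powRD_le q0' (A0 x) _)).
    by rewrite addr_ge0// mulr_ge0.
  rewrite ler_wpM2l ?powR_ge0// lerD2l.
  apply: (le_trans (powRD_le q0' _ _)); try exact: mulr_ge0.
  rewrite (powRM q b0 (B0 x)) (powRM q Kb0 (E0 x)) (powRM q K0 b0).
  by rewrite ler_wpM2l ?powR_ge0.
apply: le_trans (lin _ _ _ _ _ _ (powR_ge0 2 q) (powR_ge0 beta q) (powR_ge0 K q)
  (mpow _ mA) (mpow _ mB) (mpow _ mE) (fun x => powR_ge0 (A x) q)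
  (fun x => powR_ge0 (B x) q) (fun x => powR_ge0 (E x) q) IA IB IE).
by apply: le_ge0_integral => x _; rewrite lee_fin ?powR_ge0.
Qed.

Section majorant.
Context d (V : measurableType d) (R : realType) (mu : {measure set V -> \bar R}).
Variable F : dyadic_filtration mu.
Variables (a p1 p2 q : R).
Hypotheses (a0 : 0 < a) (p11 : 1 < p1) (p21 : 1 < p2) (q0 : 0 < q).
Hypothesis hq : q^-1 = p1^-1 + p2^-1 - a.
Local Open Scope ereal_scope.

(* Dominates the [k]-th term of the commutator: the mean of [(b - <b>_Q) f1] over
   [Q] is at most [2 (2 + rho) beta] times the mean of the maximal function of
   [f1]. The term with coefficient [beta] only serves to make the two series
   defining the operator converge absolutely. *)
Definition majorant (b : V -> R) (beta : R) (f1 f2 : V -> R) k x : R :=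
  osc_term F a b f1 f2 k x + (beta * bilin_term F a f1 f2 k x
    + 2 * ((2 + ratio F) * beta) * bilin_term F a (dyadic_max F f1) f2 k x).

Lemma majorant_sum_bound :
  exists2 C : R, (0 <= C)%R & forall (b f1 f2 : V -> R) (beta : R) (k : int) (J : nat),
    locint F b -> (0 < beta)%R -> osc_le F b beta ->
    measurable_fun setT f1 -> measurable_fun setT f2 ->
    (forall x, (0 <= f1 x)%R) -> (forall x, (0 <= f2 x)%R) ->
    \int[mu]_x (f1 x `^ p1)%:E <= 1 ->
    \int[mu]_x (f2 x `^ p2)%:E <= 1 ->
    \int[mu]_x ((\sum_(j < J) majorant b beta f1 f2 (k + j%:Z) x) `^ q)%:E
       <= (C * beta `^ q)%:E.
Proof.
have [C1 C10 H1] : exists2 C : R, (0 <= C)%R & forall (b f1 f2 : V -> R) (beta : R) (k : int) (J : nat),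
    locint F b -> (0 < beta)%R -> osc_le F b beta ->
    measurable_fun setT f1 -> measurable_fun setT f2 ->
    (forall x, (0 <= f1 x)%R) -> (forall x, (0 <= f2 x)%R) ->
    \int[mu]_x (f1 x `^ p1)%:E <= 1 ->
    \int[mu]_x (f2 x `^ p2)%:E <= 1 ->
    \int[mu]_x ((\sum_(j < J) osc_term F a b f1 f2 (k + j%:Z) x) `^ q)%:E
       <= (C * beta `^ q)%:E.
  have [q1|q1] := leP q 1%R; first exact: osc_sum_le1.
  exact: osc_sum_gt1.
pose D := ((p1 / (p1 - 1)) `^ p1)%R; have D0 : (0 <= D)%R by exact: powR_ge0.
have [C2 C20 H2] := hedberg_integral F a0 p11 p21 q0 hq ltr01 ler01 ler01.
have [C3 C30 H3] := hedberg_integral F a0 p11 p21 q0 hq ltr01 D0 ler01.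
pose K := (2 * (2 + ratio F))%R.
have rho0 : (0 < ratio F)%R by exact: lt_trans (ratio_gt1 F).
have K0 : (0 <= K)%R by rewrite mulr_ge0// addr_ge0// ltW.
have q0' := ltW q0.
exists (2 `^ q * (C1 + 2 `^ q * (C2 + K `^ q * C3)))%R.
  by rewrite mulr_ge0 ?powR_ge0// addr_ge0// mulr_ge0 ?powR_ge0// addr_ge0// mulr_ge0 ?powR_ge0.
move=> b f1 f2 beta k J lb beta0 oscb mf1 mf2 f10 f20 f11 f21.
have [mb _] := lb.
have beta0' := ltW beta0.
have f1y : \int[mu]_x (f1 x `^ p1)%:E < +oo by exact: le_lt_trans f11 (ltry _).
have lf1 := locint_powR F (ltW p11) mf1 f10 f11.
pose M := dyadic_max F f1.
have mM : measurable_fun setT M by exact: measurable_dyadic_max.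
have M0 x : (0 <= M x)%R by exact: dyadic_max_ge0.
have MD : \int[mu]_x (M x `^ p1)%:E <= D%:E.
  apply: (le_trans (dyadic_max_powR p11 f10 lf1 f1y)).
  by rewrite -[leRHS]mule1; apply: lee_wpmul2l f11; rewrite lee_fin.
pose A x := (\sum_(j < J) osc_term F a b f1 f2 (k + j%:Z) x)%R.
pose B x := (\sum_(j < J) bilin_term F a f1 f2 (k + j%:Z) x)%R.
pose E x := (\sum_(j < J) bilin_term F a M f2 (k + j%:Z) x)%R.
have A0 x : (0 <= A x)%R by apply: sumr_ge0 => j _; exact: osc_term_ge0.
have B0 x : (0 <= B x)%R by apply: sumr_ge0 => j _; exact: bilin_term_ge0.
have E0 x : (0 <= E x)%R by apply: sumr_ge0 => j _; exact: bilin_term_ge0.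
have mpow (h : V -> R) (e : R) : measurable_fun setT h -> measurable_fun setT (fun x => h x `^ e)%R.
  by move=> mh; exact: (measurableT_comp (measurable_powR e)).
have mA : measurable_fun setT A.
  by apply: measurable_sum => j; exact: measurable_osc_term.
have mB : measurable_fun setT B.
  by apply: measurable_sum => j; exact: measurable_bilin_term.
have mE : measurable_fun setT E.
  by apply: measurable_sum => j; exact: measurable_bilin_term.
have IA : \int[mu]_x (A x `^ q)%:E <= (C1 * beta `^ q)%:E by exact: H1.
have bil (h1 : V -> R) x : (forall y, 0 <= h1 y)%R ->
    (\sum_(j < J) bilin_term F a h1 f2 (k + j%:Z) x `^ 1 =
     \sum_(j < J) bilin_term F a h1 f2 (k + j%:Z) x)%R.
  by move=> h10; apply: eq_bigr => j _; rewrite powRr1// bilin_term_ge0.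
have IB : \int[mu]_x (B x `^ q)%:E <= C2%:E.
  have := H2 f1 f2 k J mf1 mf2 f10 f20 f11 f21.
  by under eq_integral => x _ do rewrite (bil f1 x f10) divr1.
have IE : \int[mu]_x (E x `^ q)%:E <= C3%:E.
  have := H3 M f2 k J mM mf2 M0 f20 MD f21.
  by under eq_integral => x _ do rewrite (bil M x M0) divr1.
have GE x : (\sum_(j < J) majorant b beta f1 f2 (k + j%:Z) x =
    A x + (beta * B x + K * beta * E x))%R.
  rewrite /majorant !big_split/= -!mulr_sumr -/(A x) -/(B x) -/(E x).
  by rewrite /K !mulrA.
under eq_integral => x _ do rewrite GE.
exact: powR_sum3_bound.
Qed.

Lemma majorant_ge0 b beta f1 f2 k x : (0 <= beta)%R ->
  (forall y, (0 <= f1 y)%R) -> (forall y, (0 <= f2 y)%R) ->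
  (0 <= majorant b beta f1 f2 k x)%R.
Proof.
move=> b0 f10 f20; have M0 y : (0 <= dyadic_max F f1 y)%R by exact: dyadic_max_ge0.
have r0 : (0 <= 2 * ((2 + ratio F) * beta))%R.
  by rewrite !mulr_ge0// addr_ge0// ltW// (lt_trans _ (ratio_gt1 F)).
rewrite /majorant addr_ge0 ?osc_term_ge0// addr_ge0//.
  by rewrite mulr_ge0// bilin_term_ge0.
by rewrite mulr_ge0// bilin_term_ge0.
Qed.

Lemma majorant_bound :
  exists2 C : R, (0 <= C)%R & forall (b f1 f2 : V -> R) (beta : R) (H : V -> \bar R),
    locint F b -> (0 < beta)%R -> osc_le F b beta ->
    measurable_fun setT f1 -> measurable_fun setT f2 ->
    (forall x, (0 <= f1 x)%R) -> (forall x, (0 <= f2 x)%R) ->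
    \int[mu]_x (f1 x `^ p1)%:E <= 1 ->
    \int[mu]_x (f2 x `^ p2)%:E <= 1 ->
    (forall x, `|H x| <= \esum_(k in [set: int]) (majorant b beta f1 f2 k x)%:E) ->
    'N[mu]_q%:E[H] <= (C * beta)%:E.
Proof.
have [C C0 HC] := majorant_sum_bound.
exists (C `^ q^-1)%R; first exact: powR_ge0.
move=> b f1 f2 beta H lb beta0 oscb mf1 mf2 f10 f20 f11 f21 HG.
have [mb _] := lb; have q0' := ltW q0.
pose u (N : nat) x := (\sum_(j < N + N) majorant b beta f1 f2 (- N%:Z + j%:Z) x)%R.
have G0 k x : (0 <= majorant b beta f1 f2 k x)%R by apply: majorant_ge0 => //; exact: ltW.
have u0 N x : (0 <= u N x)%R by exact: sumr_ge0.
have mu_ N : measurable_fun setT (u N).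
  apply: measurable_sum => j; rewrite /majorant; apply: measurable_funD.
    exact: measurable_osc_term.
  by apply: measurable_funD; apply: measurable_funM => //; exact: measurable_bilin_term.
have main : \int[mu]_x (`|H x| `^ q) <= (C * beta `^ q)%:E.
  apply: (integral_ereal_sup_le (u := fun N x => (u N x `^ q)%:E)) => //.
  - move=> N; apply/measurable_EFinP.
    exact: (measurableT_comp (measurable_powR q)).
  - by move=> N x; rewrite lee_fin powR_ge0.
  - move=> x; apply: (homo_leq (@lexx _ _) (@le_trans _ _)) => N.
    rewrite lee_fin; apply: ler_powR2 => //; rewrite /u.
    (* The window of index N covers the generations from -N to N - 1, so the next one gains the
       generation -N-1 below and N above. *)
    rewrite addSn addnS big_ord_recl big_ord_recr/=.
    apply: (@le_trans _ _ (\sum_(i < N + N) majorant b beta f1 f2 (- N.+1%:Z + (bump 0 i)%:Z) x)%R).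
      rewrite le_eqVlt; apply/orP; left; apply/eqP; apply: eq_bigr => i _.
      by congr majorant; rewrite /bump/=; lia.
    by rewrite addrCA lerDl addr_ge0.
  - by move=> N; exact: HC.
  move=> x _; rewrite poweR_ge0/=.
  have {}HG := le_trans (HG x) (esum_int_le (fun k => G0 k x)).
  set s := ereal_sup (range (fun N : nat => (u N x `^ q)%:E)).
  change (`|H x| `^ q <= s).
  have s0 : 0 <= s.
    apply: (@le_trans _ _ (u 0%N x `^ q)%:E); first by rewrite lee_fin powR_ge0.
    by apply: ereal_sup_ubound; exists 0%N.
  case E : s s0 => [c| |]; [|by rewrite !leey|by []].
  rewrite lee_fin => c0.
  have uc N : (u N x <= c `^ q^-1)%R.
    have : (u N x `^ q)%:E <= c%:E by rewrite -E; apply: ereal_sup_ubound; exists N.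
    rewrite lee_fin => Nc.
    have := @ler_powR2 R _ _ q^-1 _ (powR_ge0 _ _) Nc.
    by rewrite -powRrM divff ?gt_eqF// powRr1//; apply; rewrite invr_ge0.
  have Hc : `|H x| <= (c `^ q^-1)%:E.
    apply: (le_trans HG); apply: ge_ereal_sup => _ [N _ <-]; rewrite lee_fin.
    exact: uc.
  have -> : c%:E = (c `^ q^-1)%:E `^ q.
    by rewrite poweR_EFin -powRrM mulVf ?gt_eqF// powRr1.
  exact: lee_poweR2.
rewrite unlock.
have -> : (C `^ q^-1 * beta)%:E = (C * beta `^ q)%:E `^ q^-1.
  rewrite poweR_EFin powRM ?powR_ge0// -powRrM mulfV ?gt_eqF// powRr1//.
  exact: ltW.
apply: lee_poweR2 => //; first by rewrite invr_ge0.
by apply: integral_ge0 => x _; exact: poweR_ge0.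
Qed.

End majorant.

(** * The filtration of a dyadic grid *)

Section cubes.
Variables (R : realType) (n : nat).
Local Notation V := (Rn R n).
Local Notation mu := (lebesgue_Rn R n).
Implicit Types (a x : V) (l : R).

Lemma cubeE a l : cube a l =
  [set t : V | forall i, (fun i => `[tnth a i, tnth a i + l[%classic) i (tnth t i)].
Proof.
by apply/seteqP; split => t /= tE i; have := tE i; rewrite in_itv.
Qed.

Lemma measurable_cube a l : measurable (cube a l).
Proof.
rewrite (_ : cube a l = \bigcap_(i in [set: 'I_n])
    ((@tnth _ (measurableTypeR R) ^~ i) @^-1` `[tnth a i, tnth a i + l[%classic)).
  apply: fin_bigcap_measurable => // i _.
  by rewrite -[X in measurable X]setTI; exact: measurable_tnth.
by rewrite cubeE; apply/seteqP; split => [t At i _|t At i]; exact: At.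
Qed.

Lemma measure_cube a l : 0 <= l -> mu (cube a l) = (l ^+ n)%:E.
Proof.
move=> l0.
have mA (i : 'I_n) :
    measurable (`[tnth a i, tnth a i + l[%classic : set (measurableTypeR R)).
  exact: measurable_itv.
have box := @tuple_measure_box _ _ R [the {sigma_finite_measure set (measurableTypeR R) -> \bar R} of
  @lebesgue_measure R] n (fun i => `[tnth a i, tnth a i + l[%classic) mA.
transitivity (\prod_(i < n) (lebesgue_measure (`[tnth a i : R, tnth a i + l[%classic)%R : \bar R))%E.
  by apply: etrans box; rewrite cubeE.
rewrite (eq_bigr (fun=> l%:E)); last first.
  move=> i _; rewrite /= lebesgue_measure_itv/= lte_fin ltrDl.
  move: l0; rewrite le_eqVlt => /predU1P[<-|->]; first by rewrite ltxx.
  by rewrite -EFinB addrAC subrr add0r.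
by rewrite prodEFin prodr_const card_ord.
Qed.

(** Local integrability is tested on compact sets and the cube is half-open, so the cube is placed
    in the closed box [K]. *)
Lemma locally_integrable_cube (b : V -> R) a l : locally_integrable_Rn b ->
  mu.-integrable (cube a l) (EFin \o b).
Proof.
move=> [mb bK]; pose K := [set t : V | forall i, tnth a i <= tnth t i <= tnth a i + l].
have mK : measurable K.
  rewrite (_ : K = \bigcap_(i in [set: 'I_n])
      ((@tnth _ (measurableTypeR R) ^~ i) @^-1` `[tnth a i, tnth a i + l]%classic)).
    apply: fin_bigcap_measurable => // i _.
    by rewrite -[X in measurable X]setTI; exact: measurable_tnth.
  by apply/seteqP; split => [t At i|t At i]; have := At i; rewrite /= in_itv/=; [|apply].
have cK : compact (@rV_of_tuple R n @` K).
  rewrite (_ : @rV_of_tuple R n @` K = [set v : 'rV[R]_n | forall i,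
      `[tnth a i, tnth a i + l]%classic (v ord0 i)]).
    apply: (@rV_compact R n (fun i => `[tnth a i : R, tnth a i + l]%classic)) => i.
    exact: segment_compact.
  apply/seteqP; split => [_ [t Kt <-] i|v vK].
    by rewrite /= in_itv/= mxE; exact: Kt.
  exists [tuple v ord0 i | i < n] => [i|].
    by have := vK i; rewrite /= in_itv/= tnth_mktuple.
  by apply/rowP => i; rewrite mxE tnth_mktuple.
have sub : cube a l `<=` K.
  by move=> t tC i; have /andP[-> /ltW ->] := tC i.
apply/integrableP; split.
  by apply/measurable_EFinP; exact: measurable_funTS.
apply: le_lt_trans (bK K cK); apply: ge0_subset_integral => //.
- exact: measurable_cube.
- by apply/measurable_EFinP/measurable_funTS; exact: measurableT_comp.
Qed.

End cubes.

Section grid_filtration.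
Variables (R : realType) (n : nat) (n0 : (0 < n)%N).
Local Notation V := (Rn R n).
Local Notation mu := (lebesgue_Rn R n).
Variables (D : set (set V)) (hD : dyadic_grid D).
Implicit Types (k : int) (x y : V) (Q : set V).

Definition grid_cell k x : set V :=
  xget set0 [set Q | (D `&` cubes_of_side (2 ^ k)) Q /\ Q x].

Lemma grid_cellP k x :
  [/\ D (grid_cell k x), cubes_of_side (2 ^ k) (grid_cell k x) & grid_cell k x x].
Proof.
have [_ _ /(_ k) [cov _ _]] := hD.
have [Q QD Qx] : (cover (D `&` cubes_of_side (2 ^ k)) id) x by rewrite cov.
have [[? ?] ?] := @xgetI _ set0
  [set Q | (D `&` cubes_of_side (2 ^ k)) Q /\ Q x] Q (conj QD Qx).
by split.
Qed.

Lemma grid_cell_unique k x Q : D Q -> cubes_of_side (2 ^ k) Q -> Q x ->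
  grid_cell k x = Q.
Proof.
move=> DQ sQ Qx; have [Dc sc cx] := grid_cellP k x.
have [_ _ /(_ k) [_ tI _]] := hD.
by apply: (tI (grid_cell k x) Q) => //; exists x.
Qed.

Lemma gridP Q : D Q -> exists k x, Q = grid_cell k x.
Proof.
move=> DQ; have [/(_ _ DQ)[k sQ] _ /(_ k) [_ _ ne]] := hD.
have [x Qx] := ne _ (conj DQ sQ).
by exists k, x; rewrite (grid_cell_unique DQ sQ Qx).
Qed.

Lemma expz2_gt0 k : 0 < (2 : R) ^ k. Proof. by rewrite exprz_gt0. Qed.

Lemma measurable_grid_cell k x : measurable (grid_cell k x).
Proof. by have [_ [a _ <-] _] := grid_cellP k x; exact: measurable_cube. Qed.

Lemma measure_grid_cell k x : mu (grid_cell k x) = ((2 ^ k) ^+ n)%:E.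
Proof.
have [_ [a _ <-] _] := grid_cellP k x; rewrite measure_cube//.
exact/ltW/expz2_gt0.
Qed.

Lemma grid_cell_eq k x y : grid_cell k x y -> grid_cell k y = grid_cell k x.
Proof. by move=> xy; have [Dc sc _] := grid_cellP k x; exact: grid_cell_unique. Qed.

Lemma grid_volS k : ((2 : R) ^ (k + 1)) ^+ n = 2 ^+ n * (2 ^ k) ^+ n.
Proof. by rewrite exprzDr ?unitfE// expr1z exprMn mulrC. Qed.

(** Two cells sharing a point are nested, and the parent cannot lie inside the child because its
    volume is larger by the factor 2^n > 1. *)
Lemma grid_cellS k x : grid_cell k x `<=` grid_cell (k + 1) x.
Proof.
have [Dc _ cx] := grid_cellP k x; have [Dd _ dx] := grid_cellP (k + 1) x.
have [_ /(_ _ _ Dc Dd) nest _] := hD; case: nest => [e0|cd|dc].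
- suff : set0 x by []. by rewrite -e0.
- by rewrite -cd; exact: subIsetr.
have : (mu (grid_cell (k + 1) x) <= mu (grid_cell k x))%E.
  apply: le_measure; rewrite ?inE; try exact: measurable_grid_cell.
  by rewrite -dc; exact: subIsetl.
rewrite !measure_grid_cell lee_fin grid_volS leNgt ltr_pMl; last first.
  by rewrite exprn_gt0// expz2_gt0.
by rewrite exprn_egt1 ?ltr1n// lt0n_neq0.
Qed.

Definition grid_point (i : nat) : V :=
  let t := odflt [tuple 0 | _ < n] (unpickle i : option (n.-tuple rat)) in
  [tuple (ratr (tnth t j) : R) | j < n].

Lemma grid_cell_point k x : exists i, grid_cell k (grid_point i) x.
Proof.
have [_ [a _ aE] _] := grid_cellP k x.
have ex j : exists r : rat, tnth a j < ratr r < tnth a j + 2 ^ k.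
  have [|r] := @rat_in_itvoo R (tnth a j) (tnth a j + 2 ^ k).
    by rewrite ltrDl expz2_gt0.
  by rewrite in_itv/= => rE; exists r.
have [r rE] := fin_all_exists ex; exists (pickle [tuple r j | j < n]).
have xp : grid_cell k x (grid_point (pickle [tuple r j | j < n])).
  rewrite -aE => j; rewrite /grid_point pickleK/= !tnth_mktuple.
  by have /andP[/ltW -> ->] := rE j.
by rewrite (grid_cell_eq xp); have [] := grid_cellP k x.
Qed.

Lemma grid_cell_coord k x y i : grid_cell k x y -> `|tnth y i - tnth x i| < 2 ^ k.
Proof.
have [_ [a _ <-] xa] := grid_cellP k x; move=> ya.
have := ya i; have := xa i; move: (2 ^ k) => l /andP[? ?] /andP[? ?].
by rewrite ltr_norml; apply/andP; split; lra.
Qed.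

Lemma small_expz2 (e : R) : 0 < e -> exists m : nat, (2 : R) ^ (- m%:Z) < e.
Proof.
move=> e0; exists (Num.truncn e^-1).+1.
rewrite -invr_expz -exprnP invf_plt ?posrE ?exprn_gt0//.
apply: (lt_le_trans (truncnS_gt _)).
by rewrite -natrX ler_nat ltnW// ltn_expl.
Qed.

(** Cells have arbitrarily small sides, so the half-space where a coordinate is below [c] is the
    countable union of the cells contained in it. Such half-spaces generate the product
    sigma-algebra. *)
Lemma grid_cell_generate : @measurable _ V `<=`
  <<s [set grid_cell kx.1 kx.2 | kx in [set: int * V]] >>.
Proof.
set G := [set _ | _ in _].
apply: smallest_sub => // B.
have : (\big[setU/set0]_(i < n) preimage_set_system setT
    (fun t : V => tnth t i) measurable) B ->
    exists i : 'I_n, preimage_set_system setT (fun t : V => tnth t i) measurable B.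
  elim/big_ind: _ => [//|X Y hX hY [/hX|/hY]//|i _ iB]; by exists i.
move=> /[apply] -[i [A mA <-]].
suff : @measurable _ (measurableTypeR R) `<=`
    image_set_system setT (fun t : V => tnth t i) <<s G >> by exact.
rewrite RGenInftyO.measurableE.
apply: smallest_sub; first exact: sigma_algebra_image.
move=> _ [c ->]; rewrite /image_set_system/= setTI.
rewrite (_ : _ @^-1` _ = \bigcup_m \bigcup_(j in [set j |
    grid_cell (- m%:Z) (grid_point j) `<=` [set t : V | tnth t i < c]])
    grid_cell (- m%:Z) (grid_point j)).
  apply: sigma_algebra_bigcup => m; rewrite bigcup_mkcond.
  apply: sigma_algebra_bigcup => j; case: ifP => _; last exact: sigma_algebra0.
  by apply: sub_sigma_algebra; exists (- m%:Z, grid_point j).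
apply/seteqP; split => [t|t [m _ [j /= sub tj]]].
  rewrite /= in_itv/= => tc.
  have [m me] : exists m : nat, (2 : R) ^ (- m%:Z) < c - tnth t i.
    by apply: small_expz2; rewrite subr_gt0.
  have [j jt] := grid_cell_point (- m%:Z) t.
  exists m => //; exists j => //= y; rewrite -(grid_cell_eq jt) => /grid_cell_coord.
  by move=> /(_ i)/ltr_normlW yt; have := lt_trans yt me; rewrite ltrD2r.
by rewrite /= in_itv/=; exact: sub tj.
Qed.

Lemma grid_ratio_gt1 : 1 < (2 : R) ^+ n.
Proof. by rewrite exprn_egt1 ?ltr1n// lt0n_neq0. Qed.

Lemma grid_vol_gt0 k : 0 < ((2 : R) ^ k) ^+ n.
Proof. by rewrite exprn_gt0// expz2_gt0. Qed.

Definition grid_filtration : dyadic_filtration mu :=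
  DyadicFiltration grid_ratio_gt1 grid_vol_gt0 grid_volS measurable_grid_cell
    measure_grid_cell (fun k x => let: And3 _ _ xx := grid_cellP k x in xx)
    grid_cell_eq grid_cellS grid_cell_point grid_cell_generate.

End grid_filtration.

(** * The upper bound *)

Section upper_bound.
Variables (R : realType) (n : nat) (n0 : (0 < n)%N).
Local Notation V := (Rn R n).
Local Notation mu := (lebesgue_Rn R n).
Variables (D : set (set V)) (hD : dyadic_grid D).
Local Notation F := (grid_filtration n0 hD).

Lemma locint_locally_integrable (b : V -> R) : locally_integrable_Rn b -> locint F b.
Proof.
move=> lb; split; first by case: lb.
move=> k x; have [_ [a _ aE] _] := grid_cellP hD k x.
by rewrite /= -aE; exact: locally_integrable_cube.
Qed.

Lemma average_cexp (f : V -> R) k x : locint F f ->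
  average (EFin \o f) (grid_cell D k x) = (cexp F k f x)%:E.
Proof.
move=> lf; rewrite /average measure_grid_cell//=.
have -> : (\int[mu]_(y in grid_cell D k x) (EFin \o f) y)%E =
    (vol F k * cexp F k f x)%:E by exact: (integral_cexp k x lf).
by rewrite -EFinM mulrA mulVf ?mul1r//; exact: (vol_neq0 F).
Qed.

Lemma osc_le_BMO (b : V -> R) (beta : R) : locint F b ->
  (BMO_norm D b <= beta%:E)%E -> osc_le F b beta.
Proof.
move=> lb bmo k x; have [Dc _ _] := grid_cellP hD k x.
have : (average (fun y => `|(b y)%:E - average (EFin \o b) (grid_cell D k x)|)
    (grid_cell D k x) <= beta%:E)%E.
  by apply: le_trans bmo; apply: ereal_sup_ubound; exists (grid_cell D k x).
rewrite average_cexp// /average measure_grid_cell//=.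
rewrite -(@lee_pmul2l _ (vol F k)%:E) ?lte_fin ?(vol_gt0 F)//.
rewrite muleA -EFinM mulfV ?(vol_neq0 F)// mul1e.
by rewrite -EFinM mulrC.
Qed.

Lemma grid_cell_inj x : injective (fun k => grid_cell D k x).
Proof.
move=> i j e; have := measure_grid_cell hD i x.
rewrite [grid_cell D i x]e measure_grid_cell// => -[].
move/eqP; rewrite eqrXn2//; last 2 first.
- exact/ltW/expz2_gt0.
- exact/ltW/expz2_gt0.
move=> /eqP ij; apply/esym.
by apply: (@ieexprIz R 2) ij; rewrite ?pnatr_eq1.
Qed.

(** The members of the grid through [x] form a chain with exactly one cell per generation, distinct
    generations having distinct volumes. *)
Lemma esum_grid (x : V) (u : set V -> \bar R) :
  (forall Q, D Q -> ~ Q x -> u Q = 0%E) -> (forall Q, (0 <= u Q)%E) ->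
  \esum_(Q in D) u Q = \esum_(k in [set: int]) u (grid_cell D k x).
Proof.
move=> u_out u0; rewrite (esumID [set Q | Q x])//.
rewrite [X in (_ + X)%E](esum1 (D := D `&` ~` [set Q | Q x])); last first.
  by move=> Q [DQ nQx]; exact: u_out.
rewrite adde0; apply: (reindex_esum setT _ (fun k => grid_cell D k x)); split.
- by move=> k _; have [? _ ?] := grid_cellP hD k x; split.
- by move=> i j _ _; exact: grid_cell_inj.
- move=> Q [DQ Qx]; have [/(_ _ DQ)[k sQ] _ _] := hD.
  by exists k => //; exact: grid_cell_unique.
Qed.

Lemma dyadic_fractional_integralE (alpha : R) (f1 f2 : V -> R) x :
  locint F f1 -> locint F f2 ->
  dyadic_fractional_integral alpha D f1 f2 x =
  (\esum_(k in [set: int]) (Num.max (bilin_term F (alpha / n%:R) f1 f2 k x) 0)%:E -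
   \esum_(k in [set: int]) (Num.max (- bilin_term F (alpha / n%:R) f1 f2 k x) 0)%:E)%E.
Proof.
move=> lf1 lf2.
pose a Q := ((fine (mu Q) `^ (alpha / n%:R))%:E * average (EFin \o f1) Q *
  average (EFin \o f2) Q * (\1_Q x)%:E)%E.
rewrite [LHS](_ : _ = \esum_(Q in D) a^\+ Q - \esum_(Q in D) a^\- Q)%E//.
have aE k : a (grid_cell D k x) = (bilin_term F (alpha / n%:R) f1 f2 k x)%:E.
  rewrite /a indicE mem_set ?mule1; last by have [] := grid_cellP hD k x.
  by rewrite !average_cexp// measure_grid_cell//= /bilin_term -!EFinM mulrA.
have a_out Q : D Q -> ~ Q x -> a Q = 0%E.
  by move=> _ nQx; rewrite /a indicE memNset// mule0.
congr (_ - _)%E.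
- rewrite (@esum_grid x)//; last first.
    by move=> Q DQ nQx; rewrite funeposE a_out// maxxx.
  by apply: eq_esum => k _; rewrite funeposE aE EFin_max.
- rewrite (@esum_grid x)//; last first.
    by move=> Q DQ nQx; rewrite funenegE a_out// oppe0 maxxx.
  by apply: eq_esum => k _; rewrite funenegE aE EFin_max.
Qed.

Lemma integral_powR_Lnorm (p : R) (f : V -> R) : 0 < p ->
  ('N[mu]_p%:E[EFin \o f] <= 1)%E -> (\int[mu]_x (`|f x| `^ p)%:E <= 1)%E.
Proof.
move=> p0 f1; have := poweR_Lnorm mu (EFin \o f) (lt0r_neq0 p0).
move=> /= <-; rewrite -(poweR1r p); apply: lee_poweR2 => //; first exact: ltW.
exact: Lnorm_ge0.
Qed.

Variables (alpha p1 p2 q : R).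
Hypotheses (alpha0 : 0 < alpha) (p11 : 1 < p1) (p21 : 1 < p2) (q0 : 0 < q).
Hypothesis hq : q^-1 = p1^-1 + p2^-1 - alpha / n%:R.
Local Notation a := (alpha / n%:R).

Let a0 : 0 < a. Proof. by rewrite divr_gt0// ltr0n. Qed.

Lemma commutator_le_majorant (b f1 f2 : V -> R) (beta : R) x :
  locint F b -> 0 < beta -> osc_le F b beta ->
  measurable_fun setT f1 -> measurable_fun setT f2 ->
  (\int[mu]_x (`|f1 x| `^ p1)%:E <= 1)%E ->
  (\int[mu]_x (`|f2 x| `^ p2)%:E <= 1)%E ->
  (`|commutator1 b (dyadic_fractional_integral alpha D) f1 f2 x| <=
   \esum_(k in [set: int])
     (majorant F a b beta (fun y => `|f1 y|) (fun y => `|f2 y|) k x)%:E)%E.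
Proof.
move=> lb beta0 oscb mf1 mf2 f11 f21; have [mb _] := lb.
pose g1 y := `|f1 y|; pose g2 y := `|f2 y|.
have g10 y : 0 <= g1 y by exact: normr_ge0.
have g20 y : 0 <= g2 y by exact: normr_ge0.
have mg1 : measurable_fun setT g1 by exact: measurableT_comp.
have mg2 : measurable_fun setT g2 by exact: measurableT_comp.
have lg1 : locint F g1 := locint_powR F (ltW p11) mg1 g10 f11.
have lg2 : locint F g2 := locint_powR F (ltW p21) mg2 g20 f21.
have lf1 : locint F f1 by apply: (locint_le mf1 lg1).
have lf2 : locint F f2 by apply: (locint_le mf2 lg2).
have g1y : (\int[mu]_x (g1 x `^ p1)%:E < +oo)%E := le_lt_trans f11 (ltry _).
pose M := dyadic_max F g1.
have M0 y : 0 <= M y by exact: dyadic_max_ge0.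
have mM : measurable_fun setT M by exact: measurable_dyadic_max.
have gM := cexp_le_dyadic_max p11 g10 lg1 g1y.
have MD : (\int[mu]_x (M x `^ p1)%:E <= ((p1 / (p1 - 1)) `^ p1)%:E)%E.
  apply: (le_trans (dyadic_max_powR p11 g10 lg1 g1y)).
  by rewrite -[leRHS]mule1; apply: lee_wpmul2l f11; rewrite lee_fin powR_ge0.
have lM : locint F M := locint_powR F (ltW p11) mM M0 MD.
set Phi := 2 * ((2 + ratio F) * beta).
have oscM k y := osc_mul_integral k y lb beta0 oscb g10 lg1 M0 mM gM.
have mosc c : measurable_fun setT (fun z => `|b z - c| * g1 z).
  apply: measurable_funM => //; apply: measurableT_comp => //.
  exact: measurable_funB.
have int_osc k y : mu.-integrable (cell F k y)
    (fun z => (`|b z - cexp F k b y| * g1 z)%:E).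
  apply/integrableP; split; first exact/measurable_EFinP/measurable_funTS.
  apply: (@le_lt_trans _ _ (Phi%:E * \int[mu]_(z in cell F k y) (M z)%:E)%E).
    under eq_integral => z _ do rewrite gee0_abs ?lee_fin ?mulr_ge0//.
    exact: oscM.
  by rewrite integral_cexp// -EFinM ltry.
(* Integrability of b f1 on a cell comes from the stopping-time inequality: |b f1| is at most |b -
   <b>| |f1| + |<b>| |f1|, and [oscM] bounds the integral of the first term by that of the maximal
   function. *)
have lbf : locint F (fun z => b z * f1 z).
  split; first exact: measurable_funM.
  move=> k y; apply: (le_integrable (measurable_cell F k y) _ _
    (integrableD (measurable_cell F k y) (int_osc k y)
       (integrableZl (measurable_cell F k y) `|cexp F k b y| (lg1.2 k y)))).
    by apply/measurable_EFinP/measurable_funTS; exact: measurable_funM.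
  move=> z _; rewrite /= lee_fin normrM.
  rewrite [leRHS]ger0_norm; last by rewrite addr_ge0 ?mulr_ge0.
  rewrite -mulrDl; apply: ler_wpM2r => //.
  by rewrite -{1}(subrK (cexp F k b y) (b z)) ler_normD.
rewrite /commutator1 !dyadic_fractional_integralE//.
apply: (esum_commutator_le _ beta0) => k.
pose w := vol F k `^ a; have w0 : 0 <= w by exact: powR_ge0.
have E1 : `|cexp F k f1 x| <= cexp F k g1 x by exact: cexp_norm.
have E2 : `|cexp F k f2 x| <= cexp F k g2 x by exact: cexp_norm.
have e10 := cexp_ge0 F k x g10; have e20 := cexp_ge0 F k x g20.
have eM0 := cexp_ge0 F k x M0.
have key : `|b x * cexp F k f1 x - cexp F k (fun z => b z * f1 z) x| <=
    `|b x - cexp F k b x| * cexp F k g1 x + Phi * cexp F k M x.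
  have mc := measurable_cell F k x.
  pose c := cexp F k b x.
  have lbcf : locint F (fun z => b z * f1 z - c * f1 z).
    by apply: locintB => //; exact: locintZ.
  have -> : b x * cexp F k f1 x - cexp F k (fun z => b z * f1 z) x =
      (b x - c) * cexp F k f1 x - cexp F k (fun z => b z * f1 z - c * f1 z) x.
    have -> := @cexpB _ _ _ _ F k _ _ x lbf (locintZ c lf1).
    by rewrite cexpZ//; ring.
  apply: (le_trans (ler_normB _ _)); apply: lerD.
    by rewrite normrM ler_wpM2l.
  apply: (le_trans (cexp_norm k x lbcf)).
  rewrite -(ler_pM2l (vol_gt0 F k)) [leRHS]mulrCA -lee_fin.
  rewrite [leRHS]EFinM -!integral_cexp//; last exact: locint_norm.
  apply: le_trans (oscM k x).
  by apply: le_ge0_integral => z _; rewrite lee_fin// -mulrBl normrM.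
rewrite /majorant /osc_term /bilin_term -/g1 -/g2 -/M -/w -/Phi.
move: key; set u := `|b x - _|; have u0 : 0 <= u by exact: normr_ge0.
set d1 := cexp F k f1 x; set d2 := cexp F k f2 x; set db := cexp F k _ x => key.
have H1 : `|w * (d1 * d2)| <= w * (cexp F k g1 x * cexp F k g2 x).
  by rewrite normrM (ger0_norm w0) ler_wpM2l// normrM ler_pM.
have H2 : `|b x * (w * (d1 * d2)) - w * (db * d2)| <=
    w * ((u * cexp F k g1 x + Phi * cexp F k M x) * cexp F k g2 x).
  have -> : b x * (w * (d1 * d2)) - w * (db * d2) = w * ((b x * d1 - db) * d2) by ring.
  by rewrite normrM (ger0_norm w0) ler_wpM2l// normrM ler_pM.
have H1' := ler_wpM2l (ltW beta0) H1.
by apply: (le_trans (lerD H1' H2)); rewrite le_eqVlt; apply/orP; left; apply/eqP; ring.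
Qed.

Lemma opnorm_le_BMO : exists2 C : R, 0 < C & forall b : V -> R,
  locally_integrable_Rn b ->
  (bilinear_opnorm p1 p2 q (commutator1 b (dyadic_fractional_integral alpha D))
    <= C%:E * BMO_norm D b)%E.
Proof.
have [C C0 HC] := majorant_bound F a0 p11 p21 q0 hq.
(* [C] may vanish, and 0 times +oo is 0; a positive constant makes the right-hand side infinite when
   the BMO norm is. *)
have C1 : 0 < C + 1 by rewrite ltr_wpDl.
exists (C + 1) => // b lb; have lbF := locint_locally_integrable lb.
have B0 : (0 <= BMO_norm D b)%E.
  have [Dc _ _] := grid_cellP hD 0 (grid_point R n 0).
  apply: le_trans (ereal_sup_ubound _); last by exists (grid_cell D 0 (grid_point R n 0)).
  by apply: mule_ge0; [rewrite lee_fin invr_ge0 fine_ge0|exact: integral_ge0].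
have bound (beta : R) : 0 < beta -> (BMO_norm D b <= beta%:E)%E ->
    (bilinear_opnorm p1 p2 q (commutator1 b (dyadic_fractional_integral alpha D))
      <= ((C + 1) * beta)%:E)%E.
  move=> beta0 bb; have oscb := osc_le_BMO lbF bb.
  apply: ge_ereal_sup => _ [[f1 f2] /= [f1L f2L f11 f21] <-].
  have mf1 : measurable_fun setT f1 by exact: (set_mem (sub_Lfun_mfun f1L)).
  have mf2 : measurable_fun setT f2 by exact: (set_mem (sub_Lfun_mfun f2L)).
  have g11 := integral_powR_Lnorm (lt_trans ltr01 p11) f11.
  have g21 := integral_powR_Lnorm (lt_trans ltr01 p21) f21.
  apply: (@le_trans _ _ (C * beta)%:E); last first.
    by rewrite lee_fin ler_wpM2r ?lerDl// ltW.
  apply: (HC b (fun y => `|f1 y|) (fun y => `|f2 y|)) => //.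
  - exact: measurableT_comp.
  - exact: measurableT_comp.
  - by move=> x; exact: commutator_le_majorant.
move: B0 bound; case: (BMO_norm D b) => [r| |]// r0 bound; last first.
  by rewrite mulry gtr0_sg// mul1e leey.
(* The oscillation estimates need a positive [beta], whereas the BMO norm [r] may be 0. It is
   enlarged by a slack that contributes exactly [e]. *)
apply/lee_addgt0Pr => e e0.
have e'0 : 0 < e / (C + 1) by rewrite divr_gt0.
have r'0 : 0 < r + e / (C + 1) by rewrite ltr_wpDl.
have := bound _ r'0; rewrite !lee_fin lerDl (ltW e'0) => /(_ isT) /le_trans; apply.
by rewrite -EFinM -EFinD lee_fin mulrDr mulrCA divff ?mulr1// gt_eqF.
Qed.

End upper_bound.

(** * The lower bound *)

Section cexp_support.
Context d (V : measurableType d) (R : realType) (mu : {measure set V -> \bar R}).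
Variable F : dyadic_filtration mu.

Lemma eq_cexp (f g : V -> R) k x : (forall y, cell F k x y -> f y = g y) ->
  cexp F k f x = cexp F k g x.
Proof.
by move=> fg; congr (_ * _); apply: eq_Rintegral => y /set_mem/fg.
Qed.

Lemma cexp_support (h : V -> R) k j x z :
  (forall y, ~ cell F k x y -> h y = 0) -> cell F k x `<=` cell F j z ->
  cexp F j h z = (vol F j)^-1 * (vol F k * cexp F k h x).
Proof.
move=> h0 sub; congr (_ * _); rewrite /cexp mulVKf ?vol_neq0//.
rewrite -[in RHS](setIidr sub) Rintegral_mkcondr; apply: eq_Rintegral => y _.
by rewrite /patch; case: ifPn => // /negP yn; apply: h0 => xy; apply: yn; exact: mem_set.
Qed.

End cexp_support.

Section lower_bound.
Variables (R : realType) (n : nat) (n0 : (0 < n)%N).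
Local Notation V := (Rn R n).
Local Notation mu := (lebesgue_Rn R n).
Variables (D : set (set V)) (hD : dyadic_grid D).
Local Notation F := (grid_filtration n0 hD).
Variables (alpha p1 p2 q : R).
Hypotheses (p11 : 1 < p1) (p21 : 1 < p2) (q0 : 0 < q).
Hypothesis hq : q^-1 = p1^-1 + p2^-1 - alpha / n%:R.
Local Notation a := (alpha / n%:R).

Lemma Lfun_bounded_support (p : R) (f : V -> R) k x : 1 < p ->
  measurable_fun setT f ->
  (forall y, `|f y| <= vol F k `^ (- p^-1) * \1_(cell F k x) y) ->
  f \in Lfun mu p%:E /\ ('N[mu]_p%:E[EFin \o f] <= 1)%E.
Proof.
move=> p_gt1 mf fle; have p0 : 0 < p by exact: lt_trans p_gt1.
have v0 := vol_gt0 F k.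
have le1 : ('N[mu]_p%:E[EFin \o f] <= 1)%E.
  rewrite unlock -(poweR1r p^-1); apply: lee_poweR2; first by rewrite invr_ge0 ltW.
    by apply: integral_ge0 => y _; exact: poweR_ge0.
  apply: (@le_trans _ _ (\int[mu]_y ((vol F k)^-1 * \1_(cell F k x) y)%:E)%E).
    apply: le_ge0_integral => y _; first exact: poweR_ge0.
    rewrite /= lee_fin; apply: (le_trans (ler_powR2 (ltW p0) (normr_ge0 _) (fle y))).
    rewrite powRM ?powR_ge0 ?indicE ?ler0n// -powRrM mulNr mulVf ?gt_eqF//.
    rewrite powRN powRr1 ?(ltW v0)//.
    by case: (_ \in _); rewrite ?powR1// powR0// gt_eqF.
  rewrite ge0_integralZr_EFin ?invr_ge0 ?(ltW v0)//; last exact: measurable_indic (measurable_cell F k x).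
  rewrite integral_indic//; last exact: (measurable_cell F).
  by rewrite setIT mu_cell -EFinM mulVf// gt_eqF.
split => //; rewrite inE; apply/andP; split; rewrite inE//=.
by rewrite /finite_norm (le_lt_trans le1)// ltry.
Qed.

Variables (b : V -> R) (lb : locint F b) (k : int) (x : V).
Let Q := cell F k x.
Let Q' := cell F (k - 1) x.
Let v := vol F k.
Let c := cexp F k b x.
Let E := b @^-1` `[c, +oo[%classic.
(** The sign of b - c, with value 1 where b = c; through an indicator its measurability reduces to
    that of [E]. *)
Let s y : R := 2 * \1_E y - 1.
Let sigma := cexp F k s x.
Let osc := cexp F k (fun y => `|b y - c|) x.
(* [f1] has mean zero on [Q] and [f2] vanishes on [Q'], so that on [Q'] neither
   [Q] and its ancestors nor the cells below [Q] contribute to the operator at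
   [(f1, f2)], while the terms of the operator at [(b * f1, f2)] are
   nonnegative. *)
Let f1 y : R := v `^ (- p1^-1) * (2^-1 * ((s y - sigma) * \1_Q y)).
Let f2 y : R := v `^ (- p2^-1) * \1_(Q `\` Q') y.

Let mb : measurable_fun setT b. Proof. by have [] := lb. Qed.
Let mE : measurable E.
Proof. by rewrite -[E]setTI; apply: mb => //; exact: measurable_itv. Qed.
Let mQ : measurable Q. Proof. exact: measurable_cell. Qed.
Let mQ' : measurable Q'. Proof. exact: measurable_cell. Qed.
Let v0 : 0 < v. Proof. exact: vol_gt0. Qed.
Let Q'Q : Q' `<=` Q.
Proof. by have := @cellS _ _ _ _ F (k - 1) x; rewrite subrK. Qed.

Let s1 y : `|s y| <= 1.
Proof.
rewrite /s indicE; case: (_ \in _).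
  by rewrite mulr1 (_ : 2 - 1 = 1 :> R) ?normr1//; ring.
by rewrite mulr0 sub0r normrN normr1.
Qed.

Let ms : measurable_fun setT s.
Proof. by apply: measurable_funB => //; apply: measurable_funM => //; exact: measurable_indic. Qed.

Let ls : locint F s.
Proof. by apply: (locint_le ms (locint_cst F 1)) => y; exact: s1. Qed.

Let sigma1 : `|sigma| <= 1.
Proof.
apply: (le_trans (cexp_norm k x ls)).
rewrite -(@cexp_cst_on _ _ _ _ F k (cst 1) x 1)//.
by apply: le_cexp => //; [exact: locint_norm|exact: locint_cst].
Qed.

Let mf1 : measurable_fun setT f1.
Proof.
apply: measurable_funM => //; apply: measurable_funM => //.
apply: measurable_funM; last exact: measurable_indic.
exact: measurable_funB.
Qed.

Let mf2 : measurable_fun setT f2.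
Proof.
by apply: measurable_funM => //; apply: measurable_indic; exact: measurableD.
Qed.

(** The factor 1/2 in [f1] offsets |s - sigma| <= 2, so that [f1] has norm at most 1. *)
Let f1_le y : `|f1 y| <= v `^ (- p1^-1) * \1_Q y.
Proof.
rewrite /f1 !normrM (ger0_norm (powR_ge0 _ _)) ler_wpM2l ?powR_ge0//.
rewrite [`|\1_Q y|]ger0_norm; last by rewrite indicE ler0n.
rewrite mulrA ler_piMl//.
rewrite ger0_norm// -(ler_pM2l (ltr0Sn R 1)) mulrA mulfV// mul1r mulr1.
by rewrite (le_trans (ler_normB _ _))// (natrD R 1 1) lerD.
Qed.

Let f2_le y : `|f2 y| <= v `^ (- p2^-1) * \1_Q y.
Proof.
rewrite /f2 normrM (ger0_norm (powR_ge0 _ _)) ler_wpM2l ?powR_ge0//.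
rewrite !indicE in_setD; case: (y \in Q); case: (y \in Q');
  by rewrite /= ?normr0 ?normr1.
Qed.

Let lf1 : locint F f1.
Proof.
apply: (locint_le mf1 (locint_cst F (v `^ (- p1^-1)))) => y.
by rewrite (le_trans (f1_le y))// ler_piMr ?powR_ge0.
Qed.

Let lf2 : locint F f2.
Proof.
apply: (locint_le mf2 (locint_cst F (v `^ (- p2^-1)))) => y.
by rewrite (le_trans (f2_le y))// ler_piMr ?powR_ge0.
Qed.

Let lbf1 : locint F (fun y => b y * f1 y).
Proof.
apply: (locint_le _ (locintZ (v `^ (- p1^-1)) (locint_norm lb))).
  exact: measurable_funM.
move=> y; rewrite normrM mulrC ler_wpM2r//.
by rewrite (le_trans (f1_le y))// ler_piMr ?powR_ge0.
Qed.

Let f1_out y : ~ Q y -> f1 y = 0.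
Proof. by move=> Qy; rewrite /f1 indicE memNset// !mulr0. Qed.

Let f2_Q' y : Q' y -> f2 y = 0.
Proof. by move=> Q'y; rewrite /f2 indicE memNset ?mulr0// => -[]. Qed.

Let cexp_f1 : cexp F k f1 x = 0.
Proof.
rewrite (@eq_cexp _ _ _ _ F _ (fun y => v `^ (- p1^-1) * 2^-1 * (s y - sigma))).
  rewrite cexpZ; last by apply: locintB => //; exact: locint_cst.
  have -> := @cexpB _ _ _ _ F k s (cst sigma) x ls (locint_cst F sigma).
  have -> : cexp F k (cst sigma) x = sigma by exact: cexp_cst_on.
  by rewrite subrr mulr0.
by move=> y xy; rewrite /f1 indicE mem_set// mulr1 mulrA.
Qed.

Let lbs : locint F (fun y => b y * s y).
Proof.
apply: (locint_le _ (locint_norm lb)); first exact: measurable_funM.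
by move=> y; rewrite normrM ler_piMr.
Qed.

(** Here |b - c| = (b - c) s. As [c] is the average of [b], c sigma is the average both of c s and
    of sigma b; hence pairing [b] with s - sigma recovers the oscillation exactly. *)
Let oscE : osc = cexp F k (fun y => b y * s y) x - c * sigma.
Proof.
rewrite -(cexpZ k x c ls).
have <- := @cexpB _ _ _ _ F k _ _ x lbs (locintZ c ls).
apply: eq_cexp => y _; rewrite -mulrBl /s indicE.
have [yE|yE] := boolP (y \in E).
  have := set_mem yE; rewrite /E/= in_itv/= andbT => cb.
  by rewrite ger0_norm ?subr_ge0//=; ring.
have bc : b y < c.
  by rewrite ltNge; apply: contra yE => cb; rewrite inE /E/= in_itv/= cb.
by rewrite ltr0_norm ?subr_lt0//=; ring.
Qed.

Let cexp_bf1 : cexp F k (fun y => b y * f1 y) x = v `^ (- p1^-1) * 2^-1 * osc.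
Proof.
rewrite (@eq_cexp _ _ _ _ F _ (fun y => v `^ (- p1^-1) * 2^-1 * (b y * s y - sigma * b y))).
  rewrite cexpZ; last by apply: locintB => //; exact: locintZ.
  have -> := @cexpB _ _ _ _ F k _ _ x lbs (locintZ sigma lb).
  by rewrite cexpZ// oscE [c * _]mulrC.
by move=> y xy; rewrite /f1 indicE mem_set// mulr1; ring.
Qed.

Let osc0 : 0 <= osc. Proof. exact: cexp_ge0. Qed.

Let f2_ge0 y : 0 <= f2 y.
Proof. by rewrite /f2 mulr_ge0 ?powR_ge0// indicE ler0n. Qed.

(** The child [Q'] occupies the fraction 2^(-n) <= 1/2 of [Q], so at least half of [Q] is left for
    [f2]. *)
Let cexp_f2 : v `^ (- p2^-1) * 2^-1 <= cexp F k f2 x.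
Proof.
have lD : locint F (\1_(Q `\` Q') : V -> R).
  apply: (locint_le _ (locint_cst F 1)).
    by apply: measurable_indic; exact: measurableD.
  by move=> y; rewrite indicE; case: (_ \in _); rewrite ?normr0 ?normr1 ?ler01.
rewrite /f2 (cexpZ _ _ _ lD) ler_wpM2l ?powR_ge0//.
rewrite -(ler_pM2l v0) -lee_fin -(integral_cexp k x lD).
rewrite integral_indic//; last exact: measurableD.
have -> : (Q `\` Q') `&` cell F k x = Q `\` Q' by apply/setIidl => y [].
rewrite measureD//; last by rewrite [X in (X < _)%E](mu_cell F k x) ltry.
have -> : Q `&` Q' = Q' by exact/setIidr.
rewrite [X in (_ <= X - _)%E]mu_cell [X in (_ <= _ - X)%E]mu_cell -EFinB lee_fin.
have vE : v = ratio F * vol F (k - 1) by rewrite -volS subrK.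
rewrite -/v vE; have := vol_gt0 F (k - 1); set u := vol F (k - 1) => u0.
have r2 : 2 <= ratio F.
  rewrite /= -[leLHS]expr1 ler_weXn2l// ler1n//.
by nra.
Qed.

Let term_small h z j : (j <= k - 1)%R -> Q' z -> bilin_term F a h f2 j z = 0.
Proof.
move=> jk Q'z; rewrite /bilin_term (_ : cexp F j f2 z = 0) ?mulr0//.
apply: cexp_cst_on => y zy; apply: f2_Q'.
rewrite /Q' -(cell_eq Q'z).
have := @cell_le _ _ _ _ F j z (absz (k - 1 - j)%R) _ zy.
by rewrite (_ : j + (absz (k - 1 - j)%R) = k - 1)//; lia.
Qed.

Let cell_big z j : (k <= j)%R -> Q z -> Q `<=` cell F j z.
Proof.
move=> kj Qz; rewrite /Q -(cell_eq Qz).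
have := @cell_le _ _ _ _ F k z (absz (j - k)%R).
by rewrite (_ : k + (absz (j - k)%R) = j)//; lia.
Qed.

Let term_f1 z j : Q' z -> bilin_term F a f1 f2 j z = 0.
Proof.
move=> Q'z; have [jk|kj] := leP j (k - 1); first exact: term_small.
have {}kj : (k <= j)%R by lia.
rewrite /bilin_term (cexp_support f1_out (cell_big kj (Q'Q Q'z))) cexp_f1.
by rewrite !mulr0 mul0r mulr0.
Qed.

Let term_bf1_ge0 z j : Q' z -> 0 <= bilin_term F a (fun y => b y * f1 y) f2 j z.
Proof.
move=> Q'z; have [jk|kj] := leP j (k - 1); first by rewrite term_small.
have {}kj : (k <= j)%R by lia.
have bf1_out y : ~ Q y -> b y * f1 y = 0 by move=> /f1_out ->; rewrite mulr0.
rewrite /bilin_term (cexp_support bf1_out (cell_big kj (Q'Q Q'z))) cexp_bf1.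
rewrite mulr_ge0 ?powR_ge0// mulr_ge0 ?cexp_ge0//.
rewrite mulr_ge0 ?(ltW (invvol_gt0 _ _))// mulr_ge0 ?(ltW v0)//.
by rewrite mulr_ge0// mulr_ge0 ?powR_ge0.
Qed.

(** The powers of [v] from |Q|^a and from normalising [f1] and [f2] combine to v^(-1/q) by [hq]. Of
    the factor 1/4, one half comes from [f1] and the other from [cexp_f2]. *)
Let term_bf1_k z : Q' z ->
  v `^ (- q^-1) * (4^-1 * osc) <= bilin_term F a (fun y => b y * f1 y) f2 k z.
Proof.
move=> /Q'Q Qz; rewrite /bilin_term (cexp_level _ Qz) (cexp_level f2 Qz) cexp_bf1.
have -> : - q^-1 = a + (- p1^-1 + - p2^-1) by rewrite hq; ring.
have vn0 : v != 0 by rewrite gt_eqF.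
rewrite powRD ?vn0 ?implybT// powRD ?vn0 ?implybT//.
rewrite -[vol F k]/v -mulrA ler_wpM2l ?powR_ge0//.
apply: (@le_trans _ _ (v `^ (- p1^-1) * 2^-1 * osc * (v `^ (- p2^-1) * 2^-1))).
  by rewrite le_eqVlt; apply/orP; left; apply/eqP; field.
apply: ler_wpM2l cexp_f2.
by rewrite mulr_ge0// mulr_ge0 ?powR_ge0.
Qed.

Lemma osc_le_opnorm :
  ((4^-1 * (ratio F) `^ (- q^-1) * osc)%:E <=
   bilinear_opnorm p1 p2 q (commutator1 b (dyadic_fractional_integral alpha D)))%E.
Proof.
have [f1L f11] := Lfun_bounded_support p11 mf1 f1_le.
have [f2L f21] := Lfun_bounded_support p21 mf2 f2_le.
set T := commutator1 _ _.
apply: (@le_trans _ _ ('N[mu]_q%:E[T f1 f2])%E); last first.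
  by apply: ereal_sup_ubound; exists (f1, f2).
have TQ' z : Q' z -> ((v `^ (- q^-1) * (4^-1 * osc))%:E <= `|T f1 f2 z|)%E.
  move=> Q'z; have If1 : dyadic_fractional_integral alpha D f1 f2 z = 0%E.
    rewrite (dyadic_fractional_integralE alpha z lf1 lf2).
    by rewrite !esum1 ?sube0// => j _; rewrite term_f1// ?oppr0 maxxx.
  have Ibf1 : dyadic_fractional_integral alpha D (b \* f1) f2 z =
      (\esum_(j in [set: int])
         (Num.max (bilin_term F a (fun y => b y * f1 y) f2 j z) 0)%:E)%E.
    rewrite (dyadic_fractional_integralE alpha z lbf1 lf2).
    rewrite [X in (_ - X)%E]esum1 ?sube0// => j _.
    by rewrite max_r// oppr_le0 term_bf1_ge0.
  rewrite /T /commutator1 If1 Ibf1 mule0 sub0e abseN.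
  apply: le_trans (lee_abs _).
  apply: (@le_trans _ _ (Num.max (bilin_term F a (fun y => b y * f1 y) f2 k z) 0)%:E).
    by rewrite lee_fin le_max term_bf1_k.
  apply: esum_ge; exists [set k] => //.
  by rewrite fsbig_set1.
rewrite unlock.
have r0 : 0 < ratio F by exact: lt_trans (ratio_gt1 F).
set t := v `^ (- q^-1) * (4^-1 * osc).
have t0 : 0 <= t by rewrite mulr_ge0 ?powR_ge0// mulr_ge0.
have vE : v = ratio F * vol F (k - 1) by rewrite -volS subrK.
(* The lower bound [t] holds on [Q'], of measure v / ratio; v^(-1/q) (v / ratio)^(1/q) =
   ratio^(-1/q) is free of the size of the cube. *)
have -> : (4^-1 * ratio F `^ (- q^-1) * osc)%:E =
    ((t `^ q * vol F (k - 1))%:E `^ q^-1)%E.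
  have u0 := vol_gt0 F (k - 1).
  rewrite poweR_EFin powRM ?powR_ge0 ?(ltW u0)// -powRrM mulfV ?gt_eqF// powRr1//.
  rewrite /t vE powRM ?(ltW r0) ?(ltW u0)// [in RHS]powRN.
  congr EFin; rewrite [_ `^ (- q^-1)]powRN [vol F (k - 1) `^ (- q^-1)]powRN.
  by field; rewrite !gt_eqF ?powR_gt0.
apply: lee_poweR2; first by rewrite invr_ge0 ltW.
  by rewrite lee_fin mulr_ge0 ?powR_ge0// ltW// vol_gt0.
apply: (@le_trans _ _ (\int[mu]_z (t `^ q * \1_Q' z)%:E)%E).
  rewrite ge0_integralZr_EFin ?powR_ge0//.
  by rewrite integral_indic// setIT [X in (_ <= _ * X)%E](mu_cell F (k - 1) x).
apply: le_ge0_integral => z _.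
  by rewrite lee_fin mulr_ge0 ?powR_ge0// indicE ler0n.
rewrite indicE; have [zQ'|_] := boolP (z \in Q'); last by rewrite mulr0 poweR_ge0.
rewrite mulr1 -poweR_EFin; apply: lee_poweR2; first exact: ltW.
  by rewrite lee_fin.
by apply: TQ'; exact/set_mem.
Qed.

End lower_bound.

(** * The equivalence for the first commutator *)

Section grid_equivalence.
Variables (R : realType) (n : nat) (n0 : (0 < n)%N).
Local Notation V := (Rn R n).
Local Notation mu := (lebesgue_Rn R n).
Variables (D : set (set V)) (hD : dyadic_grid D).
Local Notation F := (grid_filtration n0 hD).
Variables (alpha p1 p2 q : R).
Hypotheses (alpha0 : 0 < alpha) (p11 : 1 < p1) (p21 : 1 < p2) (q0 : 0 < q).
Hypothesis hq : q^-1 = p1^-1 + p2^-1 - alpha / n%:R.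

Lemma BMO_le_opnorm : exists2 c : R, 0 < c & forall b, locally_integrable_Rn b ->
  (c%:E * BMO_norm D b <=
   bilinear_opnorm p1 p2 q (commutator1 b (dyadic_fractional_integral alpha D)))%E.
Proof.
pose c := 4^-1 * ratio F `^ (- q^-1).
have c0 : 0 < c by rewrite mulr_gt0 ?powR_gt0// (lt_trans _ (ratio_gt1 F)).
exists c => // b /(locint_locally_integrable n0 hD) lb.
set N := bilinear_opnorm _ _ _ _.
suff : (BMO_norm D b <= c^-1%:E * N)%E.
  have := lee_wpmul2l (_ : 0 <= c%:E)%E; rewrite lee_fin => /(_ (ltW c0)) h /h.
  by rewrite muleA -EFinM mulfV ?gt_eqF// mul1e.
apply: ge_ereal_sup => _ [Q DQ <-].
have [k [x ->]] := gridP hD DQ.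
rewrite (average_cexp k x lb).
have lbc : locint F (fun y => `|b y - cexp F k b x|).
  by apply: locint_norm; apply: locintB => //; exact: locint_cst.
have -> : average (fun y => `|(b y)%:E - (cexp F k b x)%:E|)%E (grid_cell D k x) =
    (cexp F k (fun y => `|b y - cexp F k b x|) x)%:E by exact: average_cexp.
have := lee_wpmul2l (_ : 0 <= c^-1%:E)%E (osc_le_opnorm p11 p21 q0 hq lb k x).
rewrite lee_fin invr_ge0 => /(_ (ltW c0)); apply: le_trans.
by rewrite -EFinM -/c mulrA mulVf ?mul1r// gt_eqF.
Qed.

Lemma commutator1_comparable : comparable_on (@locally_integrable_Rn R n)
  (fun b => bilinear_opnorm p1 p2 q (commutator1 b (dyadic_fractional_integral alpha D)))
  (BMO_norm D).
Proof.
have [c c0 lower] := BMO_le_opnorm.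
have [C C0 upper] := opnorm_le_BMO n0 hD alpha0 p11 p21 q0 hq.
by exists c, C; split => // b lb; split; [exact: lower|exact: upper].
Qed.

End grid_equivalence.

(** * Symmetry between the two commutators *)

Section swap.
Variables (R : realType) (n : nat).
Local Notation V := (Rn R n).
Local Notation mu := (lebesgue_Rn R n).

Lemma dyadic_fractional_integralC (alpha : R) (D : set (set V)) f1 f2 :
  dyadic_fractional_integral alpha D f1 f2 = dyadic_fractional_integral alpha D f2 f1.
Proof.
apply/funext => x; pose a g1 g2 Q := ((fine (mu Q) `^ (alpha / n%:R))%:E *
  average (EFin \o g1) Q * average (EFin \o g2) Q * (\1_Q x)%:E)%E.
have aC : a f1 f2 = a f2 f1 by apply/funext => Q; rewrite /a [X in (X * _)%E]muleAC.
rewrite -[LHS]/(\esum_(Q in D) (a f1 f2)^\+ Q - \esum_(Q in D) (a f1 f2)^\- Q)%E.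
by rewrite aC.
Qed.

Lemma commutator2E (b : V -> R) (alpha : R) (D : set (set V)) f1 f2 :
  commutator2 b (dyadic_fractional_integral alpha D) f1 f2 =
  commutator1 b (dyadic_fractional_integral alpha D) f2 f1.
Proof.
apply/funext => x; rewrite /commutator2 /commutator1.
rewrite (dyadic_fractional_integralC alpha D f1 f2).
by rewrite (dyadic_fractional_integralC alpha D f1 (b \* f2)).
Qed.

Lemma bilinear_opnormC (p1 p2 q : R) (T U : (V -> R) -> (V -> R) -> V -> \bar R) :
  (forall f1 f2, T f1 f2 = U f2 f1) ->
  bilinear_opnorm p1 p2 q T = bilinear_opnorm p2 p1 q U.
Proof.
move=> TU; congr (ereal_sup _); apply/seteqP.
by split => _ [[f1 f2] [f1L f2L f11 f21] <-]; exists (f2, f1); rewrite // TU.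
Qed.

End swap.

Theorem theorem1p2 (R : realType) (n : nat) (hn : (0 < n)%N)
    (alpha p1 p2 q : R)
    (halpha0 : 0 < alpha) (halpha : alpha < (2 * n)%:R)
    (hp1 : 1 < p1) (hp2 : 1 < p2) (hq0 : 0 < q)
    (hq : q^-1 = p1^-1 + p2^-1 - alpha / n%:R)
    (D : set (set (Rn R n))) (hD : dyadic_grid D) :
  let I := dyadic_fractional_integral alpha D in
  comparable_on [set b | locally_integrable_Rn b]
    (fun b => bilinear_opnorm p1 p2 q (commutator1 b I)) (BMO_norm D)
  /\
  comparable_on [set b | locally_integrable_Rn b]
    (fun b => bilinear_opnorm p1 p2 q (commutator2 b I)) (BMO_norm D).
Proof.
move=> I; split; first exact: commutator1_comparable.
(* Exchanging the two arguments turns the second commutator into the first with [p1] and [p2]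
   exchanged, and the relation between the exponents is symmetric in them. *)
have -> : (fun b => bilinear_opnorm p1 p2 q (commutator2 b I)) =
    (fun b => bilinear_opnorm p2 p1 q (commutator1 b I)).
  by apply/funext => b; apply: bilinear_opnormC => f1 f2; exact: commutator2E.
by apply: commutator1_comparable => //; rewrite hq [p1^-1 + _]addrC.
Qed.
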